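(* Let $F=\{f_1,\dots,f_S\}$ be a conformal IFS satisfying the open set condition and let $\Lambda$ be the self-conformal set generated by $F$. Let $v\in(0,1)$, $\mathbf t\in G$ and $\theta\in(1,\infty)$. Then: (1) If $\theta<\frac1{1-v}$, then $$\{\mathbf e\in\Sigma^{\mathbb N}:v_e(\mathbf e,\mathbf t)\ge v\}\cap\{\mathbf e\in\Sigma^{\mathbb N}:v_s(\mathbf e,\mathbf t)=\theta v\}=\emptyset.$$ (2) If $\theta\ge\frac1{1-v}$, then (i) there are $c\in\mathbb R$ and $\delta_0>0$ such that for all $\delta\in(0,\delta_0)$, $$\dim_{\mathscr H}\big(\pi(\Upsilon(\mathbf t,\theta,v,\delta))\big)\le\min\{s^+(\mathbf t,v,\theta)+c\,\delta,\ \dim_{\mathscr H}(\Lambda)\};$$ (ii) $\dim_{\mathscr H}\big(\pi(\Delta(\mathbf t,\theta,v))\big)\ge\min\{s^-(\mathbf t,v,\theta),\ \dim_{\mathscr H}(\Lambda)\}.$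
   Context: Conformal IFS. Let $d,S\in\mathbb N$, $S\ge 2$. A $C^1$ map $f$ from an open subset of $\mathbb R^d$ to $\mathbb R^d$ is conformal if $|f'(x)y|=|f'(x)||y|\ne0$ for all $x$ in its domain and $y\in\mathbb R^d\setminus\{0\}$, and there are $\alpha,c>0$ with $|f'(x)-f'(y)|\le c|x-y|^\alpha$ for all $x,y$ in the domain. A conformal IFS $F=\{f_1,\dots,f_S\}$ consists of injective conformal maps, defined on an open set containing $\overline U$ for some bounded open convex $U\subset\mathbb R^d$, with $f_i(\overline U)\subset U$ and $\|f_i'\|:=\sup_{x\in U}|f_i'(x)|<1$ for every $i$. Its attractor $\Lambda$, the unique nonempty compact set with $\Lambda=\bigcup_{i=1}^S f_i(\Lambda)$, is called the self-conformal set generated by $F$. The open set condition: there is a nonempty open set $O$ with $f_i(O)\subset O$ for all $i$ and $f_i(O)\cap f_j(O)=\emptyset$ for $i\neq j$. $\dim_{\mathscr H}$ is Hausdorff dimension. Symbolic notation. $\Sigma=\{1,\dots,S\}$, $\mathbb N=\{1,2,\dots\}$, $\sigma$ is the left shift on $\Sigma^{\mathbb N}$. For $\mathbf i=i_1i_2\cdots$, $\mathbf i|_n^m=i_n\cdots i_m$ if $m\ge n$ and the empty word if $m<n$; $[\mathbf w]$ is the cylinder of all infinite sequences beginning with the finite word $\mathbf w$ (all of $\Sigma^{\mathbb N}$ if $\mathbf w$ is empty). For a finite word $\mathbf w=w_1\cdots w_n$, $f_{\mathbf w}=f_{w_1}\circ\cdots\circ f_{w_n}$ and $\|f'_{\mathbf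 w}\|=\sup_{x\in U}|f'_{\mathbf w}(x)|$. The projection $\pi:\Sigma^{\mathbb N}\to\Lambda$ sends $a_1a_2\cdots$ to the single point of $\lim_{n\to\infty}f_{a_1}\circ\cdots\circ f_{a_n}(\Lambda)$. Rates. For $u\in[0,\infty)$, $R_e(u,\mathbf t)$ is the set of $\mathbf e\in\Sigma^{\mathbb N}$ for which there is $N\in\mathbb N$ such that for all $n\ge N$ there is $m\in\mathbb N$, $m\le n$, with $\sigma^m(\mathbf e)\in[\mathbf t|_1^{\lfloor un\rfloor}]$; $R_s(u,\mathbf t)$ is the set of $\mathbf e\in\Sigma^{\mathbb N}$ such that $\sigma^n(\mathbf e)\in[\mathbf t|_1^{\lfloor un\rfloor}]$ for infinitely many $n$. Put $v_e(\mathbf e,\mathbf t)=\sup\{u:\mathbf e\in R_e(u,\mathbf t)\}$ and $v_s(\mathbf e,\mathbf t)=\sup\{u:\mathbf e\in R_s(u,\mathbf t)\}$, both in $[0,\infty]$. Define $$\Delta(\mathbf t,\theta,v)=\{\mathbf e:v_e(\mathbf e,\mathbf t)\ge v\}\cap\{\mathbf e:v_s(\mathbf e,\mathbf t)\ge\theta v\},$$ $$\Upsilon(\mathbf t,\theta,v,\delta)=\{\mathbf e:v_e(\mathbf e,\mathbf t)\ge v\}\cap\{\mathbf e:(\theta-\delta)v\le v_s(\mathbf e,\mathbf t)\le(\theta+\delta)v\}.$$ The set $G$. For $\mathbf t\in\Sigma^{\mathbb N}$ let $\mathbf t(n,j)$ be $\mathbf t$ with its $n$-th digit replaced by $j\in\Sigma$.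 $G$ is the set of $\mathbf t\in\Sigma^{\mathbb N}$ for which there is $N\in\mathbb N$ such that for all $n>N$, all $m<n$ and all $j\ne \mathbf t|_n^n$ one has $\mathbf t(n,j)|_m^n\ne\mathbf t|_1^{n-m+1}$. Exponents. For $\mathbf t\in G$, $v\in(0,1)$, $\theta\in(1,\infty)$, and large $M$, let $p=\max\{p\in\mathbb N: vM/\theta^p\ge1\}$ and let $G(M,\mathbf t,\theta,v)$ be the finite word given by the concatenation $$\mathbf t|_1^{\lfloor vM/\theta^p\rfloor}\,\mathbf t|_1^{\lfloor vM/\theta^{p-1}\rfloor}\cdots\mathbf t|_1^{\lfloor vM/\theta\rfloor}\,\mathbf t|_1^{\lfloor vM\rfloor}\,\mathbf t|_1^{\lfloor\theta vM\rfloor}.$$ Put $\Omega^+(\mathbf t,\theta,v)=\limsup_{M\to\infty}\frac1M\log\|f'_{G(M,\mathbf t,\theta,v)}\|$ and $\Omega^-(\mathbf t,\theta,v)=\liminf_{M\to\infty}\frac1M\log\|f'_{G(M,\mathbf t,\theta,v)}\|$. The pressure is $P(s)=\lim_{n\to\infty}\frac1n\log\sum_{\mathbf i\in\Sigma^n}\|f'_{\mathbf i}\|^s$. For $\theta>\frac1{1-v}$, $s^{\pm}(\mathbf t,v,\theta)$ is the unique solution $s$ of $$P(s)=-s\,\frac{\theta-1}{\theta-\theta v-1}\,\Omega^{\pm}(\mathbf t,\theta,v).$$ For $\theta=\frac1{1-v}$, where the denominator vanishes, the equation is read in the cleared form $(\theta-\theta v-1)P(s)=-s(\theta-1)\Omega^\pm(\mathbf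 t,\theta,v)$, i.e. $s^\pm(\mathbf t,v,\theta)=0$. *)

(* Defs.v *)
(* MathComp-Analysis; R^d is 'rV[R]_d for R : realType. *)
From mathcomp Require Import all_boot all_order all_algebra.
From mathcomp Require Import all_classical all_reals all_analysis.

Set Implicit Arguments.
Unset Strict Implicit.
Unset Printing Implicit Defensive.

Import Order.TTheory GRing.Theory Num.Theory.
Import numFieldNormedType.Exports.

Local Open Scope classical_set_scope.
Local Open Scope ring_scope.

(* The library norm on 'rV[R]_d is the sup norm: the Euclidean norm is needed
   for conformality.  Both norms give the same topology and differential. *)
Definition enorm (R : realType) (d : nat) (x : 'rV[R]_d) : R :=
  Num.sqrt (\sum_(i < d) x ord0 i ^+ 2).

Definition opnorm (R : realType) (d : nat) (L : 'rV[R]_d -> 'rV[R]_d) : R :=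
  sup [set enorm (L y) | y in [set y | enorm y <= 1]].

(* Partial maps on an open set D are represented by total functions whose values
   outside D play no role. *)
Definition conformal (R : realType) (d : nat) (D : set 'rV[R]_d)
    (f : 'rV[R]_d -> 'rV[R]_d) : Prop :=
  [/\ (forall x, D x -> differentiable f x),
      (forall x, D x -> {for x, continuous (fun y => 'J f y)}),
      (forall x y, D x -> y != 0 ->
         enorm ('d f x y) = opnorm ('d f x) * enorm y /\ enorm ('d f x y) != 0)
    & exists alpha c : R, [/\ 0 < alpha, 0 < c
      & forall x y, D x -> D y ->
          opnorm (fun z => 'd f x z - 'd f y z) <= c * enorm (x - y) `^ alpha]].

Definition dnorm (R : realType) (d : nat) (U : set 'rV[R]_d)
    (f : 'rV[R]_d -> 'rV[R]_d) : R :=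
  sup [set opnorm ('d f x) | x in U].

Definition conformal_IFS (R : realType) (d S : nat) (D U : set 'rV[R]_d)
    (f : 'I_S -> 'rV[R]_d -> 'rV[R]_d) : Prop :=
  [/\ open D, closure U `<=` D,
      [/\ U !=set0, open U, bounded_set U & convex_set U]
    & forall i, [/\ conformal D (f i), set_inj D (f i),
                    f i @` closure U `<=` U & dnorm U (f i) < 1]].

(* The uniqueness of the attractor holds among subsets of closure U: the maps
   need not be contractions outside it. *)
Definition is_attractor (R : realType) (d S : nat) (U : set 'rV[R]_d)
    (f : 'I_S -> 'rV[R]_d -> 'rV[R]_d) (Lam : set 'rV[R]_d) : Prop :=
  [/\ Lam `<=` closure U, Lam !=set0, compact Lam
    & Lam = \bigcup_(i in [set: 'I_S]) (f i @` Lam)].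

(* O lies in U, where the f_i act as an IFS.  Given an open O' in the domain
   that satisfies the condition and meets U, O' `&` U also satisfies it. *)
Definition open_set_condition (R : realType) (d S : nat) (U : set 'rV[R]_d)
    (f : 'I_S -> 'rV[R]_d -> 'rV[R]_d) : Prop :=
  exists O : set 'rV[R]_d,
    [/\ O !=set0, open O, O `<=` U,
        (forall i, f i @` O `<=` O)
      & (forall i j, i != j -> (f i @` O) `&` (f j @` O) = set0)].

(* Sequences i_1 i_2 i_3 ... are functions on nat with the shifted indexing
   i_n = e n.-1; finite words are lists. *)
Definition digit (S : nat) (e : nat -> 'I_S) (n : nat) : 'I_S := e n.-1.

(* The word i_n ... i_m, for n >= 1; empty if m < n. *)
Definition block (S : nat) (e : nat -> 'I_S) (n m : nat) : seq 'I_S :=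
  [seq digit e k | k <- index_iota n m.+1].

Definition shift_seq (S : nat) (m : nat) (e : nat -> 'I_S) : nat -> 'I_S :=
  fun k => e (m + k)%N.

Definition cylinder (S : nat) (w : seq 'I_S) : set (nat -> 'I_S) :=
  [set e | block e 1 (size w) = w].

Definition fword (R : realType) (d S : nat) (f : 'I_S -> 'rV[R]_d -> 'rV[R]_d)
    (w : seq 'I_S) : 'rV[R]_d -> 'rV[R]_d :=
  foldr (fun i g => f i \o g) id w.

(* The sets f_{a_1} o ... o f_{a_n} (Lam) decrease with n, so that their limit is
   their intersection, a single point. *)
Definition coding (R : realType) (d S : nat) (f : 'I_S -> 'rV[R]_d -> 'rV[R]_d)
    (Lam : set 'rV[R]_d) (a : nat -> 'I_S) : 'rV[R]_d :=
  get (\bigcap_(n in [set: nat]) (fword f (block a 1 n) @` Lam)).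

Definition R_e (R : realType) (S : nat) (u : R) (t : nat -> 'I_S) :
    set (nat -> 'I_S) :=
  [set e | exists2 N : nat, (0 < N)%N & forall n : nat, (N <= n)%N ->
     exists m : nat, [/\ (0 < m)%N, (m <= n)%N
       & cylinder (block t 1 (Num.truncn (u * n%:R))) (shift_seq m e)]].

Definition R_s (R : realType) (S : nat) (u : R) (t : nat -> 'I_S) :
    set (nat -> 'I_S) :=
  [set e | infinite_set [set n : nat | (0 < n)%N /\
     cylinder (block t 1 (Num.truncn (u * n%:R))) (shift_seq n e)]].

Definition v_e (R : realType) (S : nat) (e t : nat -> 'I_S) : \bar R :=
  ereal_sup [set u%:E | u in [set u : R | 0 <= u /\ R_e u t e]].

Definition v_s (R : realType) (S : nat) (e t : nat -> 'I_S) : \bar R :=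
  ereal_sup [set u%:E | u in [set u : R | 0 <= u /\ R_s u t e]].

Definition Delta (R : realType) (S : nat) (t : nat -> 'I_S) (theta v : R) :
    set (nat -> 'I_S) :=
  [set e | (v%:E <= v_e R e t)%E] `&` [set e | ((theta * v)%:E <= v_s R e t)%E].

Definition Upsilon (R : realType) (S : nat) (t : nat -> 'I_S)
    (theta v delta : R) : set (nat -> 'I_S) :=
  [set e | (v%:E <= v_e R e t)%E] `&`
  [set e | (((theta - delta) * v)%:E <= v_s R e t)%E /\
           (v_s R e t <= ((theta + delta) * v)%:E)%E].

Definition replace_digit (S : nat) (t : nat -> 'I_S) (n : nat) (j : 'I_S) :
    nat -> 'I_S :=
  fun k => if k.+1 == n then j else t k.

Definition G_set (S : nat) : set (nat -> 'I_S) :=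
  [set t | exists2 N : nat, (0 < N)%N &
     forall n m : nat, (N < n)%N -> (0 < m)%N -> (m < n)%N ->
     forall j : 'I_S, j != digit t n ->
       block (replace_digit t n j) m n <> block t 1 (n - m).+1%N].

Definition G_exponent (R : realType) (v theta : R) (M : nat) : nat :=
  get [set p : nat | [/\ (0 < p)%N, 1 <= v * M%:R / theta ^+ p
    & forall q : nat, (0 < q)%N -> 1 <= v * M%:R / theta ^+ q -> (q <= p)%N]].

Definition G_word (R : realType) (S : nat) (t : nat -> 'I_S) (v theta : R)
    (M : nat) : seq 'I_S :=
  flatten [seq block t 1 (Num.truncn (v * M%:R / theta ^+ k))
          | k <- rev (iota 0 (G_exponent v theta M).+1)]
  ++ block t 1 (Num.truncn (theta * v * M%:R)).

Definition log_rate (R : realType) (d S : nat) (U : set 'rV[R]_d)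
    (f : 'I_S -> 'rV[R]_d -> 'rV[R]_d) (t : nat -> 'I_S) (theta v : R) :
    nat -> R :=
  fun M => M%:R^-1 * ln (dnorm U (fword f (G_word t v theta M))).

Definition Omega_plus (R : realType) (d S : nat) (U : set 'rV[R]_d)
    (f : 'I_S -> 'rV[R]_d -> 'rV[R]_d) (t : nat -> 'I_S) (theta v : R) : R :=
  limn_sup (log_rate U f t theta v).

Definition Omega_minus (R : realType) (d S : nat) (U : set 'rV[R]_d)
    (f : 'I_S -> 'rV[R]_d -> 'rV[R]_d) (t : nat -> 'I_S) (theta v : R) : R :=
  limn_inf (log_rate U f t theta v).

Definition pressure (R : realType) (d S : nat) (U : set 'rV[R]_d)
    (f : 'I_S -> 'rV[R]_d -> 'rV[R]_d) (s : R) : R :=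
  limn (fun n : nat =>
    n%:R^-1 * ln (\sum_(w : n.-tuple 'I_S) dnorm U (fword f w) `^ s)).

(* For theta = (1 - v)^-1 the denominator theta - theta * v - 1 vanishes, and
   the equation is read after multiplication by it. *)
Definition s_equation (R : realType) (d S : nat) (U : set 'rV[R]_d)
    (f : 'I_S -> 'rV[R]_d -> 'rV[R]_d) (theta v Omega s : R) : Prop :=
  if (1 - v)^-1 < theta then
    pressure U f s = - s * ((theta - 1) / (theta - theta * v - 1)) * Omega
  else
    (theta - theta * v - 1) * pressure U f s = - s * (theta - 1) * Omega.

Definition s_plus (R : realType) (d S : nat) (U : set 'rV[R]_d)
    (f : 'I_S -> 'rV[R]_d -> 'rV[R]_d) (t : nat -> 'I_S) (v theta : R) : R :=
  get [set s | s_equation U f theta v (Omega_plus U f t theta v) s].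

Definition s_minus (R : realType) (d S : nat) (U : set 'rV[R]_d)
    (f : 'I_S -> 'rV[R]_d -> 'rV[R]_d) (t : nat -> 'I_S) (v theta : R) : R :=
  get [set s | s_equation U f theta v (Omega_minus U f t theta v) s].

Definition diam (R : realType) (d : nat) (A : set 'rV[R]_d) : R :=
  sup [set enorm (p.1 - p.2) | p in A `*` A].

(* (diam A)^s with the convention that the empty set has weight 0, also for
   s = 0, whereas a nonempty set has weight 1 for s = 0. *)
Definition diam_pow (R : realType) (d : nat) (s : R) (A : set 'rV[R]_d) : R :=
  if A == set0 then 0 else diam A `^ s.

Definition delta_cover (R : realType) (d : nat) (delta : R) (A : set 'rV[R]_d) :
    set (nat -> set 'rV[R]_d) :=
  [set C | A `<=` \bigcup_(i in [set: nat]) C i /\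
           forall i x y, C i x -> C i y -> enorm (x - y) <= delta].

Definition hausdorff_premeasure (R : realType) (d : nat) (s delta : R)
    (A : set 'rV[R]_d) : \bar R :=
  ereal_inf [set (\sum_(0 <= i <oo) (diam_pow s (C i))%:E)%E
            | C in delta_cover delta A].

Definition hausdorff_measure (R : realType) (d : nat) (s : R)
    (A : set 'rV[R]_d) : \bar R :=
  ereal_sup [set hausdorff_premeasure s delta A
            | delta in [set delta : R | 0 < delta]].

Definition hausdorff_dim (R : realType) (d : nat) (A : set 'rV[R]_d) : \bar R :=
  ereal_inf [set s%:E
            | s in [set s : R | 0 <= s /\ hausdorff_measure s A = 0%E]].

(* Main.v *)
(** By bounded distortion, [w |-> ||f_w'||] is multiplicative up to a constant.

    Upper bound.  Let [e] be in Upsilon.  A match of an initial segment of [t] in [e]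
    that reaches further right than all matches starting before it is a record.  As
    [t] is in G, a long match that starts before the start [M] of a record ends before
    [M]; the rate [v_e] provides such a match of length about [v M], and the bound on
    [v_s] makes it start beyond about [M / theta].  Iterating, the first [M] letters
    of [e] contain disjoint copies of initial segments of [t] of lengths about
    [v M], [v M / theta], [v M / theta ^ 2], ..., which leave about [A M] free letters,
    [A = 1 - v theta / (theta - 1)].  Infinitely many records carry a match of length
    about [theta v M], and the sum of [||f_w'|| ^ s] over the words up to the end of
    these matches is about [exp (M (A P(s) + s Omega^+))], which decays once [s > s^+].
    The same disjointness gives [v (1 + theta v) <= theta v], whence (1).

    Lower bound.  Force a copy of [t], of length about [theta v n], at the positions
    [n = q theta ^ k], and choose the other letters in blocks [c] of length [q],
    independently and with weights proportional to [||f_c'|| ^ s].  If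
    [A P(s) + s Omega^- > 0] and [q] is large, the mass of a word [w] is at most
    [C ||f_w'|| ^ s].  By the open set condition, a set of diameter [r] meets boundedly
    many of the images [f_w(Lam)] of size about [r], and so the image of the support
    has positive s-dimensional measure: given a cover with a small sum, a point that
    it misses is found by descending the tree of words. *)
Require Import Defs.
From HB Require Import structures.
From mathcomp Require Import all_boot all_order all_algebra.
From mathcomp Require Import all_classical all_reals all_analysis.
From mathcomp Require Import ring lra zify.

Set Implicit Arguments.
Unset Strict Implicit.
Unset Printing Implicit Defensive.

Import Order.TTheory GRing.Theory Num.Theory.
Import numFieldNormedType.Exports.

Local Open Scope classical_set_scope.
Local Open Scope ring_scope.

(** * Euclidean norm and differentials *)

(** Every concatenation costs a factor [K]. Up to position [M] there are only about
    [ln M / ln theta] copies of [t], and so their total cost is [exp (o(M))]. The free letters of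
    the lower bound form a number of cells proportional to [M]; there the cost is paid by a cell
    length [q] with [q P(s) > s ln K].

    The rates are asymptotic, whereas the upper bound sums over words of one length. Upsilon is
    therefore cut into countably many pieces, one for each threshold [N1] in the rates, which are
    used with a slack of order [delta]. In a piece, the sum over the words that end at a record
    obeys a linear recursion in the previous record. A step at [M] has an error of order [delta M],
    but the previous record lies below [(1 - v / 2) M], so that the errors add up like a geometric
    series, again to order [delta M]. Raising the exponent above [s^+] by [c delta] pays for them
    because [Omega^+ < 0].

    When [theta = 1 / (1 - v)], one has [A = 0] and [s^- = 0], and the lower bound holds because
    dimensions are nonnegative. *)

Definition dotp (R : realType) (d : nat) (x y : 'rV[R]_d) : R :=
  \sum_(i < d) x ord0 i * y ord0 i.

Section EuclideanNorm.
Variables (R : realType) (d : nat).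
Implicit Types (x y z : 'rV[R]_d) (L : 'rV[R]_d -> 'rV[R]_d).

Lemma dotpDl x y z : dotp (x + y) z = dotp x z + dotp y z.
Proof. by rewrite -big_split; apply: eq_bigr => i _; rewrite mxE mulrDl. Qed.

Lemma dotpC x y : dotp x y = dotp y x.
Proof. by apply: eq_bigr => i _; rewrite mulrC. Qed.

Lemma dotpZl (a : R) x y : dotp (a *: x) y = a * dotp x y.
Proof. by rewrite mulr_sumr; apply: eq_bigr => i _; rewrite mxE mulrA. Qed.

Lemma dotpBl x y z : dotp (x - y) z = dotp x z - dotp y z.
Proof. by rewrite dotpDl -scaleN1r dotpZl mulN1r. Qed.

Lemma enorm_ge0 x : 0 <= enorm x.
Proof. exact: sqrtr_ge0. Qed.

Lemma sqr_enorm x : enorm x ^+ 2 = dotp x x.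
Proof.
rewrite sqr_sqrtr; last by apply: sumr_ge0 => i _; exact: sqr_ge0.
by apply: eq_bigr => i _; rewrite expr2.
Qed.

Lemma dotp_ge0 x : 0 <= dotp x x.
Proof. by rewrite -sqr_enorm sqr_ge0. Qed.

Lemma coord_le_enorm x i : `|x ord0 i| <= enorm x.
Proof.
rewrite -(@ler_pXn2r _ 2) ?nnegrE ?enorm_ge0// sqr_enorm real_normK ?num_real//.
rewrite /dotp (bigD1 i)//= -expr2 lerDl.
by apply: sumr_ge0 => j _; rewrite -expr2 sqr_ge0.
Qed.

Lemma enorm_eq0 x : enorm x = 0 -> x = 0.
Proof.
move=> x0; apply/rowP => i; rewrite mxE; apply/eqP; rewrite -normr_le0 -x0.
exact: coord_le_enorm.
Qed.

(** Cauchy-Schwarz, from the nonnegative square norm of [enorm y *: x - enorm x *: y]. *)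
Lemma dotp_le x y : dotp x y <= enorm x * enorm y.
Proof.
have [/enorm_eq0->|x0] := eqVneq (enorm x) 0.
  by rewrite -[0 in leLHS](scale0r 0) dotpZl mul0r mulr_ge0 ?enorm_ge0.
have [/enorm_eq0->|y0] := eqVneq (enorm y) 0.
  by rewrite dotpC -[0 in leLHS](scale0r 0) dotpZl mul0r mulr_ge0 ?enorm_ge0.
have {}x0 : 0 < enorm x by rewrite lt_neqAle eq_sym x0 enorm_ge0.
have {}y0 : 0 < enorm y by rewrite lt_neqAle eq_sym y0 enorm_ge0.
have := dotp_ge0 (enorm y *: x - enorm x *: y).
rewrite dotpBl dotpZl (dotpC x) dotpZl dotpBl dotpZl (dotpC y (_ - _)).
rewrite !dotpBl !dotpZl (dotpC y x) -!sqr_enorm => H.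
have : 0 <= (enorm x * enorm y) * (enorm x * enorm y - dotp x y) by nra.
by rewrite pmulr_rge0 ?mulr_gt0// subr_ge0.
Qed.

Lemma enormD x y : enorm (x + y) <= enorm x + enorm y.
Proof.
rewrite -(@ler_pXn2r _ 2) ?nnegrE ?addr_ge0 ?enorm_ge0//.
rewrite sqr_enorm dotpDl (dotpC x) (dotpC y) !dotpDl sqrrD !sqr_enorm (dotpC y x).
by have := dotp_le x y; rewrite -[_ *+ 2]mulr_natr; lra.
Qed.

Lemma enormZ (a : R) x : enorm (a *: x) = `|a| * enorm x.
Proof.
apply/eqP; rewrite -(@eqrXn2 _ 2) ?mulr_ge0 ?enorm_ge0// exprMn sqr_enorm dotpZl.
by rewrite dotpC dotpZl sqr_enorm real_normK ?num_real// mulrA expr2.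
Qed.

Lemma enormN x : enorm (- x) = enorm x.
Proof. by rewrite -scaleN1r enormZ normrN1 mul1r. Qed.

Lemma enormB x y : enorm (x - y) = enorm (y - x).
Proof. by rewrite -enormN opprB. Qed.

Lemma enorm0 : enorm (0 : 'rV[R]_d) = 0.
Proof. by rewrite -[0](scale0r 0) enormZ normr0 mul0r. Qed.

Lemma enorm_tri x y z : enorm (x - z) <= enorm (x - y) + enorm (y - z).
Proof. by rewrite (le_trans _ (enormD _ _))// addrA subrK. Qed.

Lemma enorm_gt0 x : x != 0 -> 0 < enorm x.
Proof.
move=> x0; rewrite lt_neqAle enorm_ge0 andbT eq_sym.
by apply: contra x0 => /eqP/enorm_eq0/eqP.
Qed.

Lemma norm_le_enorm x : `|x| <= enorm x.
Proof.
rewrite /Num.norm/= mx_normrE; apply: bigmax_le => [|i _]; first exact: enorm_ge0.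
by rewrite [i.1]ord1; exact: coord_le_enorm.
Qed.

Lemma enorm_sum (n : nat) (g : 'I_n -> 'rV[R]_d) :
  enorm (\sum_(i < n) g i) <= \sum_(i < n) enorm (g i).
Proof.
elim/big_ind2 : _ => // [|a a' b b' h1 h2]; first by rewrite enorm0.
exact: le_trans (enormD _ _) (lerD h1 h2).
Qed.

Lemma enorm_delta i : enorm (delta_mx ord0 i : 'rV[R]_d) = 1.
Proof.
rewrite /enorm (bigD1 i)//= mxE !eqxx expr1n big1 ?addr0 ?sqrtr1// => j ji.
by rewrite mxE (negPf ji) andbF expr0n.
Qed.

Lemma enorm_le_norm x : enorm x <= d%:R * `|x|.
Proof.
rewrite [in leLHS](row_sum_delta x).
apply: (le_trans (enorm_sum _)).
have -> : d%:R * `|x| = \sum_(i < d) `|x| by rewrite sumr_const card_ord mulr_natl.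
apply: ler_sum => i _; rewrite enormZ enorm_delta mulr1 [in leRHS]/Num.norm/= mx_normrE.
by apply: (le_trans _ (le_bigmax _ _ (ord0, i))).
Qed.

Lemma enorm_triB x y : `|enorm x - enorm y| <= enorm (x - y).
Proof.
have h (a b : 'rV[R]_d) : enorm a - enorm b <= enorm (a - b).
  by have := enormD (a - b) b; rewrite subrK lerBlDr.
by rewrite ler_norml h andbT lerNl opprB enormB h.
Qed.

Lemma enorm_continuous : continuous (@enorm R d).
Proof.
move=> x; rewrite /continuous_at; apply/(@cvgrPdist_le _ _ _ (nbhs x)) => e e0.
have e1 : 0 < d.+1%:R^-1 * e by rewrite mulr_gt0// invr_gt0.
have : \forall y \near x, `|x - y| <= d.+1%:R^-1 * e.
  apply/nbhs_normP; exists (d.+1%:R^-1 * e) => // y /=.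
  exact: ltW.
apply: filterS => y; rewrite ler_pdivlMl// => xy.
rewrite (le_trans (enorm_triB _ _))// (le_trans (enorm_le_norm _))//.
by rewrite (le_trans _ xy)// ler_wpM2r// ler_nat.
Qed.
End EuclideanNorm.

Section OperatorNorm.
Variables (R : realType) (d : nat).
Implicit Types (x y z : 'rV[R]_d) (L : 'rV[R]_d -> 'rV[R]_d).

(** A predicate on bare functions, so that it also covers [fun z => 'd f x z - 'd f y z], which
    carries no linear structure. *)
Definition bounded_homogeneous L :=
  (forall a y, L (a *: y) = a *: L y) /\
  exists B, forall y, enorm (L y) <= B * enorm y.

Lemma opnorm_le L c : 0 <= c -> (forall y, enorm (L y) <= c * enorm y) ->
  opnorm L <= c.
Proof.
move=> c0 h; apply: ge_sup.
  by exists (enorm (L 0)), 0 => //=; rewrite enorm0.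
move=> _ [y /= y1 <-]; apply: le_trans (h y) _.
by rewrite -[leRHS]mulr1 ler_wpM2l.
Qed.

Lemma opnorm_has_ubound L : bounded_homogeneous L ->
  has_ubound [set enorm (L y) | y in [set y | enorm y <= 1]].
Proof.
move=> [_ [B hB]]; exists `|B| => _ [z /= z1 <-]; apply: le_trans (hB z) _.
by rewrite (le_trans (ler_norm _))// normrM ler_piMr// ger0_norm// enorm_ge0.
Qed.

Lemma enorm_le_opnorm L y : bounded_homogeneous L ->
  enorm (L y) <= opnorm L * enorm y.
Proof.
move=> hL; have [hom _] := hL.
have [->|y0] := eqVneq y 0.
  by rewrite -[in leLHS](scale0r 0) hom scale0r !enorm0 mulr0.
rewrite -ler_pdivrMr ?enorm_gt0//.
have -> : enorm (L y) / enorm y = enorm (L ((enorm y)^-1 *: y)).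
  by rewrite hom enormZ mulrC ger0_norm// invr_ge0 enorm_ge0.
apply: ub_le_sup; first exact: opnorm_has_ubound.
exists ((enorm y)^-1 *: y) => //=.
by rewrite enormZ ger0_norm ?invr_ge0 ?enorm_ge0// mulVf// gt_eqF// enorm_gt0.
Qed.

Lemma opnorm_ge0 L : bounded_homogeneous L -> 0 <= opnorm L.
Proof.
move=> hL; have [hom _] := hL; apply: ub_le_sup; first exact: opnorm_has_ubound.
exists 0; first by rewrite /= enorm0.
by rewrite -[in LHS](scale0r 0) hom scale0r enorm0.
Qed.

Lemma exists_enorm1 : (0 < d)%N -> exists y, enorm y = 1.
Proof. by move=> d0; exists (delta_mx ord0 (Ordinal d0)); exact: enorm_delta. Qed.

Lemma opnorm_similarity L c : (0 < d)%N -> bounded_homogeneous L ->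
  (forall y, enorm (L y) = c * enorm y) -> opnorm L = c.
Proof.
move=> d0 hL h; have [y y1] := exists_enorm1 d0.
apply/eqP; rewrite eq_le opnorm_le ?andTb//=.
- by have := enorm_le_opnorm y hL; rewrite h y1 !mulr1.
- by have := enorm_ge0 (L y); rewrite h y1 mulr1.
- by move=> z; rewrite h.
Qed.

Lemma linear_bounded_homogeneous (L : {linear 'rV[R]_d -> 'rV[R]_d}) :
  bounded_homogeneous L.
Proof.
split=> [a y|]; first by rewrite linearZ.
exists (\sum_(i < d) enorm (L (delta_mx ord0 i))) => y.
rewrite [in leLHS](row_sum_delta y) linear_sum.
apply: (le_trans (enorm_sum _)); rewrite mulr_suml; apply: ler_sum => i _.
by rewrite linearZ enormZ mulrC ler_wpM2l ?enorm_ge0// coord_le_enorm.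
Qed.

Lemma bounded_homogeneousB L L' : bounded_homogeneous L ->
  bounded_homogeneous L' -> bounded_homogeneous (fun y => L y - L' y).
Proof.
move=> [h [B hB]] [h' [B' hB']]; split=> [a y|].
  by rewrite h h' scalerBr.
exists (B + B') => y; rewrite mulrDl (le_trans (enormD _ _))// enormN.
exact: lerD.
Qed.

Lemma opnorm_triB L L' : bounded_homogeneous L -> bounded_homogeneous L' ->
  opnorm L <= opnorm L' + opnorm (fun y => L y - L' y).
Proof.
move=> hL hL'; have hB := bounded_homogeneousB hL hL'.
apply: opnorm_le => [|y]; first by rewrite addr_ge0 ?opnorm_ge0.
rewrite mulrDl -[L y](subrK (L' y)) addrC (le_trans (enormD _ _))//.
by rewrite lerD//; [exact: enorm_le_opnorm | exact: (enorm_le_opnorm y hB)].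
Qed.
End OperatorNorm.

Section MeanValue.
Variables (R : realType) (d : nat).

(** The linear form that reduces the mean value inequality for vectors to the scalar mean value
    theorem. *)
Definition dotpr (a z : 'rV[R]_d) : R := dotp z a.

Lemma dotp_linear (a : 'rV[R]_d) : linear (dotpr a : _ -> R^o).
Proof. by move=> k x y; rewrite /dotpr dotpDl dotpZl. Qed.

HB.instance Definition _ (a : 'rV[R]_d) :=
  GRing.isLinear.Build R 'rV[R]_d R^o _ (dotpr a) (dotp_linear a).

Lemma dotp_continuous (a : 'rV[R]_d) : continuous (dotpr a : _ -> R^o).
Proof.
apply: bounded_linear_continuous; apply/linear_boundedP.
exists (d%:R * enorm a); split=> [|M /ltW hM z]; first exact: num_real.
apply: (@le_trans _ _ (enorm z * enorm a)).
  rewrite /dotpr ler_norml dotp_le andbT lerNl.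
  have := dotp_le (- z) a; rewrite enormN.
  by rewrite -{1}scaleN1r dotpZl mulN1r.
rewrite (le_trans _ (ler_wpM2r (normr_ge0 z) hM))//.
by rewrite -mulrAC ler_wpM2r ?enorm_ge0// enorm_le_norm.
Qed.

(** With [a = g x - g y], the scalar mean value theorem for [dotp (g _) a] along the segment and
    Cauchy-Schwarz give [|a|^2 <= C |x - y| |a|]. *)
Lemma mean_value_ineq (U : set 'rV[R]_d) (g : 'rV[R]_d -> 'rV[R]_d) (C : R) x y :
  (forall k : R, 0 <= k <= 1 -> U (y + k *: (x - y))) ->
  (forall z, U z -> differentiable g z) ->
  (forall z h, U z -> enorm ('d g z h) <= C * enorm h) ->
  enorm (g x - g y) <= C * enorm (x - y).
Proof.
move=> cvx dg dgC; set a := g x - g y.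
pose l (k : R) := y + k *: (x - y).
pose F (k : R) := dotp (g (l k)) a.
have dl (k : R) : is_diff k l ( *:%R^~ (x - y)).
  have -> : l = cst y + *:%R^~ (x - y) by [].
  rewrite -[X in is_diff _ _ X]add0r; exact: is_diffD.
have dF (k : R) : 0 <= k <= 1 ->
    is_derive k 1 F (dotp ('d g (l k) (x - y)) a).
  move=> k01; have dgk := dg _ (cvx _ k01).
  have dgl : differentiable (g \o l) k by apply: differentiable_comp.
  have dd : differentiable (dotpr a : _ -> R^o) (g (l k)).
    by apply: linear_differentiable; exact: dotp_continuous.
  have dFk : differentiable F k.
    exact: (@differentiable_comp _ _ _ _ (g \o l) (dotpr a : _ -> R^o)).
  apply: DeriveDef; first exact: diff_derivable.
  rewrite deriveE// (@diff_comp _ _ _ _ (g \o l) (dotpr a : _ -> R^o))//=.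
  rewrite (@diff_lin _ _ _ (dotpr a : _ -> R^o)); last exact: dotp_continuous.
  by rewrite /= diff_comp//= diff_val scale1r.
have [||c c01] := @MVT R F (fun k => dotp ('d g (l k) (x - y)) a) 0 1 ltr01.
- by move=> k; rewrite in_itv/= => /andP[k0 k1]; apply: dF; rewrite !ltW.
- apply: derivable_within_continuous => k; rewrite in_itv/= => k01.
  by have [] := dF _ k01.
rewrite subr0 mulr1 => Fc.
have : enorm a ^+ 2 <= C * enorm (x - y) * enorm a.
  rewrite sqr_enorm {1}/a dotpBl.
  have -> : dotp (g x) a = F 1 by rewrite /F /l scale1r addrC subrK.
  have -> : dotp (g y) a = F 0 by rewrite /F /l scale0r addr0.
  rewrite Fc (le_trans (dotp_le _ _))// ler_wpM2r ?enorm_ge0// dgC//.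
  by apply: cvx; move: c01; rewrite in_itv/= => /andP[/ltW-> /ltW->].
have [->|a0] := eqVneq a 0.
  rewrite enorm0 => _.
  have y01 : U y by rewrite -[y]addr0 -(scale0r (x - y)); apply: cvx; rewrite lexx ler01.
  exact: le_trans (enorm_ge0 _) (dgC _ (x - y) y01).
by rewrite expr2 ler_pM2r// enorm_gt0.
Qed.

Lemma mean_value_ineqB (U : set 'rV[R]_d) (g : 'rV[R]_d -> 'rV[R]_d)
    (L : {linear 'rV[R]_d -> 'rV[R]_d}) (C : R) x y :
  continuous L ->
  (forall k : R, 0 <= k <= 1 -> U (y + k *: (x - y))) ->
  (forall z, U z -> differentiable g z) ->
  (forall z h, U z -> enorm ('d g z h - L h) <= C * enorm h) ->
  enorm (g x - g y - L (x - y)) <= C * enorm (x - y).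
Proof.
move=> cL cvx dg dgC.
have dL z : differentiable L z by apply: linear_differentiable.
have -> : g x - g y - L (x - y) = (g - (L : _ -> _)) x - (g - (L : _ -> _)) y.
  by rewrite linearB/=; apply/rowP => i; rewrite !mxE; ring.
apply: (@mean_value_ineq U (g - (L : _ -> _)) C x y cvx) => [z Uz|z h Uz].
  by apply: differentiableB; [exact: dg|].
rewrite diffB; [|exact: dg|exact: dL].
have e : ('d (L : 'rV[R]_d -> 'rV[R]_d) z : 'rV[R]_d -> 'rV[R]_d) h = L h.
  by rewrite (@diff_lin _ _ _ L z cL).
exact: (eq_ind _ (fun w => enorm ('d g z h - w) <= C * enorm h) (dgC z h Uz) _ (esym e)).
Qed.
End MeanValue.

(** * Bounded distortion *)

Lemma finite_lower_bound (R : realType) (I : finType) (a : I -> R) :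
  (forall i, 0 < a i) -> exists2 m, 0 < m & forall i, m <= a i.
Proof.
move=> a0; have s0 : 0 < 1 + \sum_i (a i)^-1.
  by rewrite ltr_pwDl// sumr_ge0// => i _; rewrite invr_ge0 ltW.
exists (1 + \sum_i (a i)^-1)^-1 => [|i]; first by rewrite invr_gt0.
rewrite invf_ple ?posrE// (bigD1 i)//= addrCA lerDl addr_ge0//.
by rewrite sumr_ge0// => j _; rewrite invr_ge0 ltW.
Qed.

Lemma finite_upper_bound (R : realType) (I : finType) (a : I -> R) :
  exists2 m, 0 <= m & forall i, a i <= m.
Proof.
exists (\sum_i `|a i|) => [|i]; first by rewrite sumr_ge0.
by rewrite (bigD1 i)//= (le_trans (ler_norm _))// lerDl sumr_ge0.
Qed.

Section ConformalIFS.
Variables (R : realType) (d S : nat) (hd : (1 <= d)%N).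
Variables (D U : set 'rV[R]_d) (f : 'I_S -> 'rV[R]_d -> 'rV[R]_d).
Hypothesis hF : conformal_IFS D U f.

Lemma IFS_subset x : U x -> D x.
Proof. by case: hF => _ cUD _ _ Ux; apply: cUD; exact: subset_closure. Qed.

Lemma IFS_map i x : U x -> U (f i x).
Proof.
case: hF => _ _ _ /(_ i)[_ _ fU _] Ux; apply: fU; exists x => //.
exact: subset_closure.
Qed.

Lemma IFS_segment x y (k : R) : U x -> U y -> 0 <= k <= 1 ->
  U (y + k *: (x - y)).
Proof.
case: hF => _ _ [_ _ _ cU] _ Ux Uy /andP[k0 k1].
have := cU x y (Itv01 k0 k1); rewrite !inE => /(_ Ux Uy).
have -> // : y + k *: (x - y) = k *: x + (1 - k) *: y.
by apply/rowP => i; rewrite !mxE; ring.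
Qed.

Lemma IFS_diff i x : U x -> differentiable (f i) x.
Proof. by move=> /IFS_subset Dx; case: hF => _ _ _ /(_ i)[[+ _ _ _] _ _ _]; exact. Qed.

Lemma IFS_similar i x h : closure U x ->
  enorm ('d (f i) x h) = opnorm ('d (f i) x) * enorm h.
Proof.
case: hF => _ cUD _ /(_ i)[[_ _ H _] _ _ _] /cUD Dx.
have [->|h0] := eqVneq h 0; first by rewrite linear0 enorm0 mulr0.
by have [] := H x h Dx h0.
Qed.

Lemma IFS_opnorm_gt0 i x : closure U x -> 0 < opnorm ('d (f i) x).
Proof.
case: hF => _ cUD _ /(_ i)[[_ _ H _] _ _ _] /cUD Dx.
have [y y1] := exists_enorm1 R hd.
have y0 : y != 0 by apply: contraPneq y1 => ->; rewrite enorm0 => /eqP; rewrite eq_sym oner_eq0.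
have [e /eqP n0] := H x y Dx y0.
rewrite lt_neqAle (opnorm_ge0 (linear_bounded_homogeneous _)) andbT eq_sym.
by apply/eqP => p0; apply: n0; apply: eq_trans e _; rewrite p0 mul0r.
Qed.

Lemma fword_map w x : U x -> U (fword f w x).
Proof. by move=> Ux; elim: w => //= i w; exact: IFS_map. Qed.

Lemma fword_diff w x : U x -> differentiable (fword f w) x.
Proof.
move=> Ux; elim: w => [|i w ih]; first exact: ex_diff.
by apply: differentiable_comp => //; apply: IFS_diff; exact: fword_map.
Qed.

Lemma diff_fword_cons i w x h : U x ->
  'd (fword f (i :: w)) x h = 'd (f i) (fword f w x) ('d (fword f w) x h).
Proof.
move=> Ux.
exact: (congr1 (@^~ h) (diff_comp (fword_diff w Ux) (IFS_diff i (fword_map w Ux)))).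
Qed.

(* Sealed: comparing two differentials by conversion diverges in practice. *)
Fact rho_subproof :
  {r : seq 'I_S -> 'rV[R]_d -> R | forall w x, r w x = opnorm ('d (fword f w) x)}.
Proof. by exists (fun w x => opnorm ('d (fword f w) x)). Qed.

Definition rho : seq 'I_S -> 'rV[R]_d -> R := sval rho_subproof.

Lemma rhoE w x : rho w x = opnorm ('d (fword f w) x).
Proof. exact: (svalP rho_subproof). Qed.

Lemma rho_nil x : rho [::] x = 1.
Proof.
rewrite rhoE; apply: (opnorm_similarity hd (linear_bounded_homogeneous _)) => y.
by rewrite mul1r diff_val.
Qed.

Lemma fword_similar w x : U x ->
  forall h, enorm ('d (fword f w) x h) = rho w x * enorm h.
Proof.
move=> Ux; elim: w => [|i w ih] h.
  by rewrite rho_nil mul1r diff_val.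
have e y : enorm ('d (fword f (i :: w)) x y) =
    (opnorm ('d (f i) (fword f w x)) * rho w x) * enorm y.
  apply: eq_trans (congr1 (@enorm R d) (diff_fword_cons i w y Ux)) _.
  apply: eq_trans (IFS_similar i _ (subset_closure (fword_map w Ux))) _.
  apply: eq_trans (congr1 (fun z => _ * z) (ih y)) _.
  exact: mulrA.
apply: eq_trans (e h) _; congr (_ * _); symmetry; rewrite rhoE.
exact: (opnorm_similarity hd (linear_bounded_homogeneous _) e).
Qed.

Lemma rho_gt0 w x : U x -> 0 < rho w x.
Proof.
move=> Ux; elim: w => [|i w ih]; first by rewrite rho_nil.
have -> : rho (i :: w) x = opnorm ('d (f i) (fword f w x)) * rho w x.
  apply: (eq_trans (rhoE _ _)); apply: (opnorm_similarity hd (linear_bounded_homogeneous _)) => y.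
  apply: eq_trans (congr1 (@enorm R d) (diff_fword_cons i w y Ux)) _.
  apply: eq_trans (IFS_similar i _ (subset_closure (fword_map w Ux))) _.
  apply: eq_trans (congr1 (fun z => _ * z) (fword_similar w Ux y)) _.
  exact: mulrA.
exact: (mulr_gt0 (IFS_opnorm_gt0 i (subset_closure (fword_map w Ux))) ih).
Qed.

Lemma rho1 i x : U x -> rho [:: i] x = opnorm ('d (f i) x).
Proof.
move=> Ux; apply: (eq_trans (rhoE _ _)); apply: (opnorm_similarity hd (linear_bounded_homogeneous _)) => y.
apply: eq_trans (congr1 (@enorm R d) (diff_fword_cons i [::] y Ux)) _.
apply: eq_trans (IFS_similar i _ (subset_closure Ux)) _.
apply: eq_trans (congr1 (fun z => _ * z) (fword_similar [::] Ux y)) _.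
by congr (_ * _); rewrite rho_nil mul1r.
Qed.

Lemma rho_cons i w x : U x -> rho (i :: w) x = rho [:: i] (fword f w x) * rho w x.
Proof.
move=> Ux; apply: (eq_trans (rhoE _ _)); apply: (opnorm_similarity hd (linear_bounded_homogeneous _)) => y.
apply: eq_trans (congr1 (@enorm R d) (diff_fword_cons i w y Ux)) _.
apply: eq_trans (IFS_similar i _ (subset_closure (fword_map w Ux))) _.
apply: eq_trans (congr1 (fun z => _ * z) (fword_similar w Ux y)) _.
apply: eq_trans _ (congr1 (fun z => z * _ * _) (esym (rho1 i (fword_map w Ux)))).
exact: mulrA.
Qed.

Lemma fword_cat w v x : fword f (w ++ v) x = fword f w (fword f v x).
Proof. by elim: w => //= i w ->. Qed.

Lemma rho_cat w v x : U x -> rho (w ++ v) x = rho w (fword f v x) * rho v x.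
Proof.
move=> Ux; elim: w => [|i w ih]; first by rewrite rho_nil mul1r.
rewrite cat_cons rho_cons// ih (rho_cons i w (fword_map v Ux)) mulrA.
by rewrite fword_cat.
Qed.

Lemma IFS_norm_bound : exists2 B : R, 1 <= B & forall x, closure U x -> `|x| <= B.
Proof.
case: hF => _ _ [_ _ [M [_ hM]] _] _.
exists (Num.max 1 (M + 1)) => [|x]; first by rewrite le_max lexx.
have cl : closed [set x : 'rV[R]_d | `|x| <= Num.max 1 (M + 1)].
  have -> : [set x : 'rV[R]_d | `|x| <= Num.max 1 (M + 1)] =
      (fun x : 'rV[R]_d => `|x|) @^-1` [set y : R | y <= Num.max 1 (M + 1)] by [].
  apply: closed_comp => [y _|]; [exact: norm_continuous|exact: closed_le].
move: x; rewrite closureE; apply: smallest_sub => // y Uy /=.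
by rewrite le_max (hM (M + 1)) ?orbT// ltrDl.
Qed.

Lemma IFS_diam : exists2 B : R, 1 <= B &
  forall x y, closure U x -> closure U y -> enorm (x - y) <= B.
Proof.
have [B B1 hB] := IFS_norm_bound; exists (d%:R * (B + B)) => [|x y Ux Uy].
  by rewrite mulr_ege1 ?ler1n//; lra.
rewrite (le_trans (enorm_le_norm _))// ler_wpM2l//.
by rewrite (le_trans (ler_normB _ _))// lerD ?hB.
Qed.
End ConformalIFS.

Section Distortion.
Variables (R : realType) (d S : nat) (hd : (1 <= d)%N).
Variables (D U : set 'rV[R]_d) (f : 'I_S -> 'rV[R]_d -> 'rV[R]_d).
Hypothesis hF : conformal_IFS D U f.

(** For [0 < r <= B], the power [(r / B) ^ a] decreases in [a]; hence a common lower bound of the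
    exponents serves all the maps, once the constants are multiplied by [B ^ a]. *)
Lemma IFS_holder : exists alpha c : R, [/\ 0 < alpha, 0 < c &
  forall i x y, closure U x -> closure U y ->
    opnorm (fun z => 'd (f i) x z - 'd (f i) y z) <= c * enorm (x - y) `^ alpha].
Proof.
have [_ cUD _ hf] := hF.
have ex i : exists p : R * R, [/\ 0 < p.1, 0 < p.2 & forall x y, D x -> D y ->
    opnorm (fun z => 'd (f i) x z - 'd (f i) y z) <= p.2 * enorm (x - y) `^ p.1].
  by have [[_ _ _ [a [c [a0 c0 h]]] _ _ _]] := hf i; exists (a, c).
have [p hp] := choice ex.
have [B B1 hB] := IFS_diam hd hF.
have [|al al0 hal] := @finite_lower_bound R 'I_S (fun i => (p i).1).
  by move=> i; case: (hp i).
have [c c0 hc] := finite_upper_bound (fun i => (p i).2 * B `^ (p i).1).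
exists al, (c + 1); split=> // [|i x y Ux Uy]; first by rewrite ltr_wpDl.
have [p1 p2 h] := hp i.
apply: le_trans (h _ _ (cUD _ Ux) (cUD _ Uy)) _.
set r := enorm (x - y).
have r0 : 0 <= r := enorm_ge0 _.
have B0 : 0 < B by apply: lt_le_trans B1.
have rB : r = B * (r / B) by rewrite mulrCA divff ?mulr1 ?gt_eqF.
have rB1 : 0 <= r / B <= 1 by rewrite divr_ge0 ?(ltW B0)//= ler_pdivrMr// mul1r hB.
rewrite [in leLHS]rB powRM ?(ltW B0)//; last by case/andP: rB1.
rewrite mulrA (@le_trans _ _ (c * (r / B) `^ al))//.
  apply: ler_pM; rewrite ?powR_ge0//.
    by rewrite mulr_ge0 ?powR_ge0 ?ltW.
  have [->|r1] := eqVneq (r / B) 0.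
    by rewrite !powR0// gt_eqF.
  apply: ger_powR => //; case/andP: rB1 => r1' ->.
  by rewrite lt_neqAle eq_sym r1 r1'.
apply: ler_pM; rewrite ?powR_ge0//; first by rewrite lerDl.
apply: ge0_ler_powR; rewrite ?nnegrE ?(ltW al0)//; first by case/andP: rB1.
by rewrite ler_pdivrMr// ler_peMr.
Qed.

Lemma opnorm_dist i x y :
  opnorm ('d (f i) x) - opnorm ('d (f i) y) <=
  opnorm (fun z => 'd (f i) x z - 'd (f i) y z).
Proof.
rewrite lerBlDl.
exact: (opnorm_triB (linear_bounded_homogeneous _) (linear_bounded_homogeneous _)).
Qed.

(** By the Holder bound the norm of the differential is continuous on the compact set [closure U],
    where it does not vanish. *)
Lemma IFS_lower : exists2 m : R, 0 < m &
  forall i x, U x -> m <= opnorm ('d (f i) x).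
Proof.
have [al [c [al0 c0 hold]]] := IFS_holder.
have cU : compact (closure U).
  have [B B1 hB] := IFS_norm_bound hF.
  apply: bounded_closed_compact; last exact: closed_closure.
  exists B; split; first exact: num_real.
  by move=> M /ltW BM x /hB /le_trans; apply.
have ex i : exists m : R, 0 < m /\ forall x, U x -> m <= opnorm ('d (f i) x).
  pose F x := opnorm ('d (f i) x).
  have [[x0 Ux0] _ _ _] : [/\ U !=set0, open U, bounded_set U & convex_set U].
    by case: hF.
  have [||x xU hx] := @EVT_min_rV R d F (closure U) _ cU.
  - by exists x0; exact: subset_closure.
  - apply/subspace_continuousP => x Ux; apply/cvgrPdist_le => e e0.
    have p0 : 0 < (e / c) `^ (al^-1) by rewrite powR_gt0 ?divr_gt0.
    have : \forall y \near x, enorm (x - y) < (e / c) `^ (al^-1).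
      have := @enorm_continuous R d 0; rewrite /continuous_at enorm0.
      move=> /cvgrPdist_lt/(_ _ p0) /nbhs_normP[r r0 hr].
      apply/nbhs_normP; exists r => // y /= xy.
      have := hr (x - y); rewrite /= sub0r normrN => /(_ xy).
      by rewrite sub0r normrN ger0_norm// enorm_ge0.
    apply: filterS => y yx Uy.
    have le1 a b : closure U a -> closure U b -> enorm (a - b) < (e / c) `^ (al^-1) ->
        F a - F b <= e.
      move=> Ua Ub ab; apply: le_trans (opnorm_dist i a b) _.
      apply: le_trans (hold _ _ _ Ua Ub) _.
      rewrite -ler_pdivlMl// mulrC.
      have -> : e / c = ((e / c) `^ (al^-1)) `^ al.
        by rewrite -powRrM mulVf ?gt_eqF// powRr1// ltW// divr_gt0.
      by apply: ge0_ler_powR; rewrite ?nnegrE ?enorm_ge0 ?powR_ge0 ?(ltW al0)// ltW.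
    rewrite ler_norml le1// andbT lerNl opprB le1//.
    by rewrite enormB.
  - exists (F x); split.
      exact: (IFS_opnorm_gt0 hd hF i (set_mem xU)).
    by move=> y Uy; apply: hx; apply/mem_set; exact: subset_closure.
have [m hm] := choice ex.
have [|m0 m00 hm0] := @finite_lower_bound R 'I_S m; first by move=> i; case: (hm i).
by exists m0 => // i x Ux; apply: le_trans (hm0 i) _; have [_] := hm i; apply.
Qed.

Lemma IFS_upper : exists2 l : R, 0 < l < 1 &
  forall i x, U x -> opnorm ('d (f i) x) <= l.
Proof.
have [al [c [al0 c0 hold]]] := IFS_holder.
have [[x0 Ux0] _ _ _] : [/\ U !=set0, open U, bounded_set U & convex_set U].
  by case: hF.
have [B B1 hB] := IFS_diam hd hF.
have ub i x : U x -> opnorm ('d (f i) x) <= dnorm U (f i).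
  move=> Ux; apply: ub_le_sup; last by exists x.
  exists (opnorm ('d (f i) x0) + c * B `^ al) => _ [y Uy <-].
  rewrite -lerBlDl; apply: le_trans (opnorm_dist i y x0) _.
  apply: le_trans (hold _ _ _ (subset_closure Uy) (subset_closure Ux0)) _.
  rewrite ler_wpM2l ?(ltW c0)// ge0_ler_powR ?nnegrE ?enorm_ge0 ?(ltW al0)//.
    by rewrite (le_trans ler01).
  by apply: hB; exact: subset_closure.
have [|m m0 hm] := @finite_lower_bound R 'I_S (fun i => 1 - dnorm U (f i)).
  by move=> i; rewrite subr_gt0; case: hF => _ _ _ /(_ i)[].
(* The maximum with [1 / 2] keeps the ratio positive. *)
exists (Num.max (1 / 2) (1 - m)).
  by rewrite lt_max gt_max; lra.
move=> i x Ux; rewrite le_max; apply/orP; right.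
by rewrite (le_trans (ub i x Ux))//; have := hm i; lra.
Qed.

(** The differential of [fword f w] as a linear map, sealed for the same reason as [rho]. *)
Fact dfw_subproof :
  {g : seq 'I_S -> 'rV[R]_d -> {linear 'rV[R]_d -> 'rV[R]_d} |
   forall w x, g w x = 'd (fword f w) x}.
Proof. by exists (fun w x => 'd (fword f w) x). Qed.

Definition dfw : seq 'I_S -> 'rV[R]_d -> {linear 'rV[R]_d -> 'rV[R]_d} :=
  sval dfw_subproof.

Lemma dfwE w x : dfw w x = 'd (fword f w) x.
Proof. exact: (svalP dfw_subproof). Qed.

Local Notation rho := (rho f).

Lemma dfw_similar w x h : U x -> enorm (dfw w x h) = rho w x * enorm h.
Proof. by move=> Ux; rewrite dfwE; exact: (fword_similar hd hF w Ux). Qed.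

Lemma diff_fword_nil x h : 'd (fword f [::]) x h = h.
Proof. by rewrite diff_val. Qed.

Lemma dfw_nil x h : dfw [::] x h = h.
Proof. by rewrite dfwE; exact: diff_fword_nil. Qed.

Lemma dfw_cons i w x h : U x ->
  dfw (i :: w) x h = dfw [:: i] (fword f w x) (dfw w x h).
Proof.
move=> Ux; rewrite 3!dfwE; apply: eq_trans (diff_fword_cons hF i w h Ux) _.
apply: eq_trans _ (esym (diff_fword_cons hF i [::] _ (fword_map hF w Ux))).
exact: (congr1 ('d (f i) (fword f w x)) (esym (diff_fword_nil _ _))).
Qed.

Lemma dfw1 i x h : U x -> dfw [:: i] x h = 'd (f i) x h.
Proof.
move=> Ux; rewrite dfwE; apply: eq_trans (diff_fword_cons hF i [::] h Ux) _.
exact: (congr1 ('d (f i) x) (diff_fword_nil _ _)).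
Qed.

Lemma rho_ge0 w x : U x -> 0 <= rho w x.
Proof. by move=> Ux; apply/ltW; exact: (rho_gt0 hd hF w Ux). Qed.

Lemma rho_lower : exists2 m : R, 0 < m & forall i x, U x -> m <= rho [:: i] x.
Proof.
have [m m0 hm] := IFS_lower; exists m => // i x Ux.
by rewrite (rho1 hd hF)//; exact: hm.
Qed.

Lemma rho_upper : exists2 l : R, 0 < l < 1 & forall i x, U x -> rho [:: i] x <= l.
Proof.
have [m m0 hm] := IFS_upper; exists m => // i x Ux.
by rewrite (rho1 hd hF)//; exact: hm.
Qed.

Lemma dfw_holder : exists alpha c : R, [/\ 0 < alpha, 0 < c &
  forall i x y h, U x -> U y ->
    enorm (dfw [:: i] x h - dfw [:: i] y h) <= c * enorm (x - y) `^ alpha * enorm h].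
Proof.
have [al [c [al0 c0 hold]]] := IFS_holder; exists al, c; split=> // i x y h Ux Uy.
rewrite !dfw1//.
apply: le_trans (enorm_le_opnorm h (bounded_homogeneousB
  (linear_bounded_homogeneous _) (linear_bounded_homogeneous _))) _.
rewrite ler_wpM2r ?enorm_ge0//.
exact: hold (subset_closure Ux) (subset_closure Uy).
Qed.

Lemma rho_le_exp l : (forall i x, U x -> rho [:: i] x <= l) -> 
  forall w x, U x -> rho w x <= l ^+ size w.
Proof.
move=> hl w x Ux; elim: w => [|i w ih]; first by rewrite (rho_nil hd f)// expr0.
rewrite (rho_cons hd hF)// exprS ler_pM//.
- by apply: rho_ge0; exact: (fword_map hF).
- exact: rho_ge0.
- by apply: hl; exact: (fword_map hF).
Qed.

Lemma rho_ge_exp m : 0 < m -> (forall i x, U x -> m <= rho [:: i] x) -> 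
  forall w x, U x -> m ^+ size w <= rho w x.
Proof.
move=> m0 hm w x Ux; elim: w => [|i w ih]; first by rewrite (rho_nil hd f)// expr0.
rewrite (rho_cons hd hF)// exprS ler_pM ?exprn_ge0 ?(ltW m0)//.
by apply: hm; exact: (fword_map hF).
Qed.

Lemma fword_lip w C x y : U x -> U y -> (forall z, U z -> rho w z <= C) ->
  enorm (fword f w x - fword f w y) <= C * enorm (x - y).
Proof.
move=> Ux Uy hC; apply: (@mean_value_ineq R d U) => [k k01|z Uz|z h Uz].
- exact: (IFS_segment hF).
- exact: (fword_diff hF).
- rewrite -dfwE dfw_similar// ler_wpM2r ?enorm_ge0//; exact: hC.
Qed.

(** The induction adds letters on the left. The points [f_w x] and [f_w y] are at distance at most
    [l ^ n |x - y|], so that a new letter adds a relative error [(c / m) q ^ n |x - y| ^ alpha] with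
    [q = l ^ alpha]; [C] is the sum of this geometric series. The estimate compares the
    differentials and not only their norms, as [fword_ball] needs. *)
Lemma distortion : exists alpha C : R, [/\ 0 < alpha, 0 < C &
  forall w x y h, U x -> U y ->
    enorm (dfw w x h - dfw w y h) <=
    (expR (C * enorm (x - y) `^ alpha) - 1) * rho w y * enorm h].
Proof.
have [al [c [al0 c0 hold]]] := dfw_holder.
have [m m0 hm] := rho_lower.
have [l /andP[l0 l1] hl] := rho_upper.
pose q := l `^ al.
have q0 : 0 < q by rewrite powR_gt0.
have q1 : q < 1.
  have := @gt0_ltr_powR R al al0 l 1; rewrite !nnegrE powR1 (ltW l0) ler01.
  by apply.
pose C := (c / m) / (1 - q).
have C0 : 0 < C by rewrite !divr_gt0// subr_gt0.
exists al, C; split=> // w x y h Ux Uy.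
set r := enorm (x - y); pose A := r `^ al.
have A0 : 0 <= A := powR_ge0 _ _.
(* The factor [1 - q ^+ size w] stands for the partial sum of the series and makes the statement
   inductive. *)
suff H : enorm (dfw w x h - dfw w y h) <=
    (expR (C * (1 - q ^+ size w) * A) - 1) * rho w y * enorm h.
  apply: le_trans H _; rewrite ler_wpM2r ?enorm_ge0// ler_wpM2r//.
    exact: rho_ge0.
  rewrite lerB// ler_expR ler_wpM2r// ler_piMr ?(ltW C0)//.
  by rewrite lerBlDr lerDl exprn_ge0// ltW.
elim: w h => [|i w ih] h.
  by rewrite subrr mulr0 mul0r expR0 subrr !mul0r !dfw_nil subrr enorm0.
set n := size w; set E := expR (C * (1 - q ^+ n) * A).
have Uwx := fword_map hF w Ux; have Uwy := fword_map hF w Uy.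
have E0 : 0 < E := expR_gt0 _.
have ry0 : 0 < rho w y by exact: (rho_gt0 hd hF).
have rx : rho w x <= E * rho w y.
  have [k k1] := exists_enorm1 R hd.
  have := ih k; rewrite -/n -/E k1 mulr1.
  have := enorm_triB (dfw w x k) (dfw w y k).
  rewrite !dfw_similar// k1 !mulr1 ler_norml => /andP[_].
  by move=> /le_trans h1 /h1; rewrite mulrBl mul1r lerD2r.
have lip : enorm (fword f w x - fword f w y) `^ al <= q ^+ n * A.
  have -> : q ^+ n * A = (l ^+ n * r) `^ al.
    rewrite powRM ?exprn_ge0 ?(ltW l0) ?enorm_ge0//; congr (_ * _).
    by rewrite -(powR_mulrn _ (ltW l0)) -(powR_mulrn _ (ltW q0)) -!powRrM mulrC.
  apply: ge0_ler_powR; rewrite ?nnegrE ?(ltW al0) ?enorm_ge0//.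
    by rewrite mulr_ge0 ?exprn_ge0 ?(ltW l0) ?enorm_ge0.
  by apply: fword_lip => // z Uz; exact: rho_le_exp.
rewrite (dfw_cons i w h Ux) (dfw_cons i w h Uy).
have -> : dfw [:: i] (fword f w x) (dfw w x h) - dfw [:: i] (fword f w y) (dfw w y h)
   = (dfw [:: i] (fword f w x) (dfw w x h) - dfw [:: i] (fword f w y) (dfw w x h))
   + dfw [:: i] (fword f w y) (dfw w x h - dfw w y h).
  by rewrite linearB addrA subrK.
apply: le_trans (enormD _ _) _.
rewrite [X in _ + X]dfw_similar//.
have h1 := hold i _ _ (dfw w x h) Uwx Uwy.
rewrite [X in _ * X]dfw_similar// in h1.
have ri0 : m <= rho [:: i] (fword f w y) by exact: hm.
have h2 := ih h; rewrite -/n -/E in h2.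
apply: le_trans (lerD h1 (ler_wpM2l (le_trans (ltW m0) ri0) h2)) _.
rewrite (rho_cons hd hF i w Uy) -/n.
set a := enorm _ `^ _ in lip *; set ri := rho [:: i] _ in ri0 *.
set k := enorm h; have k0 : 0 <= k := enorm_ge0 _.
rewrite [size _]/= -/n.
have step : E * (1 + c / m * (q ^+ n * A)) <= expR (C * (1 - q ^+ n.+1) * A).
  have -> : C * (1 - q ^+ n.+1) * A = C * (1 - q ^+ n) * A + c / m * (q ^+ n * A).
    by rewrite /C exprS; field; rewrite !gt_eqF//; lra.
  by rewrite expRD ler_wpM2l ?(ltW E0)// expR_ge1Dx.
apply: (@le_trans _ _ ((E * (1 + c / m * (q ^+ n * A)) - 1) * (ri * rho w y) * k));
  last first.
  apply: ler_wpM2r => //. apply: ler_wpM2r; last by apply: lerB.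
  by rewrite mulr_ge0 ?(ltW ry0)// (le_trans (ltW m0)).
have t1 : c * a * (rho w x * k) <= c * (q ^+ n * A) * (E * rho w y) * k.
  rewrite mulrA ler_wpM2r// ler_pM ?mulr_ge0 ?powR_ge0 ?(ltW c0)//.
    exact: rho_ge0.
  by rewrite ler_wpM2l ?(ltW c0).
have t2 : c * (q ^+ n * A) * (E * rho w y) * k <=
    ri / m * (c * (q ^+ n * A) * (E * rho w y) * k).
  rewrite ler_peMl//; last by rewrite ler_pdivlMr// mul1r.
  by rewrite !mulr_ge0 ?exprn_ge0 ?(ltW c0) ?(ltW q0) ?(ltW E0) ?(ltW ry0).
apply: le_trans (lerD (le_trans t1 t2) (lexx _)) _.
by rewrite le_eqVlt; apply/orP; left; apply/eqP; field; rewrite gt_eqF.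
Qed.
End Distortion.

(* The properties of w |-> ||f_w'||; K is the distortion constant. *)
Record word_norm (R : realType) (S : nat) (N : seq 'I_S -> R) (K m l : R) : Prop :=
  WordNorm {
    wn_K : 1 <= K; wn_m : 0 < m; wn_l0 : 0 < l; wn_l1 : l < 1;
    wn_nil : N [::] = 1;
    wn_sub : forall w v, N (w ++ v) <= N w * N v;
    wn_super : forall w v, N w * N v <= K * N (w ++ v);
    wn_low : forall w, m ^+ size w <= N w;
    wn_up : forall w, N w <= l ^+ size w }.

Lemma expR_small (R : realType) (C alpha e : R) : 0 < C -> 0 < alpha -> 0 < e ->
  exists2 r : R, 0 < r & forall s, 0 <= s <= r -> expR (C * s `^ alpha) - 1 <= e.
Proof.
move=> C0 a0 e0; have l0 : 0 < ln (1 + e) by rewrite ln_gt0// ltrDl.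
exists ((ln (1 + e) / C) `^ alpha^-1) => [|s /andP[s0 sr]].
  by rewrite powR_gt0 ?divr_gt0.
rewrite lerBlDl -[leRHS]lnK ?posrE ?addr_gt0// ler_expR mulrC -ler_pdivlMr//.
have -> : ln (1 + e) / C = ((ln (1 + e) / C) `^ alpha^-1) `^ alpha.
  by rewrite -powRrM mulVf ?gt_eqF// powRr1// ltW// divr_gt0.
by apply: ge0_ler_powR; rewrite ?nnegrE ?(ltW a0)// powR_ge0.
Qed.

Lemma injective_linear_surj (R : realType) (d : nat)
    (L : {linear 'rV[R]_d -> 'rV[R]_d}) (a : 'rV[R]_d) :
  (forall h, L h = 0 -> h = 0) -> exists h, L h = a.
Proof.
move=> inj; have fr : row_free (lin1_mx L).
  by apply: inj_row_free => v; rewrite mul_rV_lin1; exact: inj.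
exists (a *m invmx (lin1_mx L)).
by rewrite -mul_rV_lin1 mulmxKV// -row_free_unit.
Qed.

(** The coordinates are cut into intervals of length [h = B r / (d + 1)]. Two points in the same
    cube are at distance less than [B r], and the number of cubes depends on [A], [B] and [d] only.
    The points are indexed by [T] because they will come from words. *)
Lemma packing (R : realType) (d : nat) (A B : R) : 0 < A -> 0 < B ->
  exists Nmax : nat, forall (T : eqType) (P : T -> 'rV[R]_d) (r : R) p (s : seq T),
    0 < r -> uniq s -> (forall x, x \in s -> enorm (P x - p) <= A * r) ->
    (forall x y, x \in s -> y \in s -> x != y -> B * r <= enorm (P x - P y)) ->
    (size s <= Nmax)%N.
Proof.
move=> A0 B0; pose Q := (Num.truncn (A * d.+1%:R / B)).+1.
exists #|{ffun 'I_d -> 'I_(Q + Q).+1}| => T P r p s r0 us hA hB.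
pose h := B * r / d.+1%:R.
have h0 : 0 < h by rewrite divr_gt0// mulr_gt0.
pose c x i : R := (P x - p) ord0 i / h + Q%:R.
have cb x i : x \in s -> 0 <= c x i < (Q + Q).+1%:R.
  move=> xs; have hQ : `|(P x - p) ord0 i / h| <= Q%:R.
    rewrite normrM [`|h^-1|]ger0_norm ?invr_ge0 ?(ltW h0)// ler_pdivrMr//.
    apply: le_trans (coord_le_enorm _ _) _; apply: le_trans (hA _ xs) _.
    have : A * d.+1%:R / B < Q%:R by exact: truncnS_gt.
    rewrite ltr_pdivrMr// => /ltW hq; rewrite /h mulrA ler_pdivlMr//.
    by have := ler_wpM2r (ltW r0) hq; lra.
  move: hQ; rewrite ler_norml /c -natr1 natrD => /andP[h1 h2].
  by lra.
pose g x : {ffun 'I_d -> 'I_(Q + Q).+1} := [ffun i => inord (Num.truncn (c x i))].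
have ginj : {in s &, injective g}.
  move=> x y xs ys gxy; apply: contrapT => /eqP xy.
  have := hB x y xs ys xy; apply/negP; rewrite -ltNge.
  have cxy i : `|(P x - P y) ord0 i| <= h.
    have := congr1 (fun u : {ffun _ -> _} => val (u i)) gxy; rewrite !ffunE.
    have /andP[x0 x1] := cb x i xs; have /andP[y0 y1] := cb y i ys.
    rewrite /= !inordK ?truncn_ltS//.
    + move=> e; have := truncn_itv x0; have := truncn_itv y0; rewrite e => /andP[a1 a2] /andP[b1 b2].
      have -> : (P x - P y) ord0 i = (c x i - c y i) * h.
        by rewrite /c !mxE; field; rewrite gt_eqF.
      rewrite normrM (gtr0_norm h0) ler_piMl ?(ltW h0)// ler_norml.
      by move: a2 b2; rewrite -natr1 => a2 b2; lra.
    + by rewrite truncn_lt_nat.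
    + by rewrite truncn_lt_nat.
  apply: le_lt_trans (enorm_le_norm _) _.
  have nh : `|P x - P y| <= h.
    rewrite /Num.norm/= mx_normrE; apply: bigmax_le => [|i _]; first exact: ltW.
    by rewrite [i.1]ord1; exact: cxy.
  apply: le_lt_trans (ler_wpM2l (ler0n _ _) nh) _.
  rewrite /h mulrCA -[ltRHS]mulr1 ltr_pM2l ?mulr_gt0//.
  by rewrite ltr_pdivrMr// mul1r ltr_nat.
rewrite -(size_map g) -(card_uniqP _); first exact: max_card.
by rewrite map_inj_in_uniq.
Qed.

Lemma enormB_continuous (R : realType) (d : nat) (T : topologicalType)
    (g : T -> 'rV[R]_d) (z : 'rV[R]_d) (x : T) :
  {for x, continuous g} -> {for x, continuous (fun y => enorm (g y - z))}.
Proof.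
move=> cg; apply: (@continuous_comp _ _ _ (fun y => g y - z) (@enorm R d) x).
  by apply: continuousB => //; exact: cst_continuous.
exact: enorm_continuous.
Qed.

Section WordNorm.
Variables (R : realType) (d S : nat) (hd : (1 <= d)%N).
Variables (D U : set 'rV[R]_d) (f : 'I_S -> 'rV[R]_d -> 'rV[R]_d).
Hypothesis hF : conformal_IFS D U f.

Variable N : seq 'I_S -> R.
Hypothesis hN : forall w, N w = dnorm U (fword f w).
Local Notation rho := (rho f).

Lemma dnorm_rho w : N w = sup [set rho w x | x in U].
Proof.
rewrite hN /dnorm; congr sup; apply/seteqP; split=> _ [x Ux <-]; exists x => //.
  exact: rhoE.
exact: (esym (rhoE _ _ _)).
Qed.

Lemma IFS_nonempty : exists x, U x.
Proof. by case: hF => _ _ [[x Ux] _ _ _] _; exists x. Qed.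

Lemma rho_distortion : exists2 K : R, 1 <= K &
  forall w x y, U x -> U y -> rho w x <= K * rho w y.
Proof.
have [al [C [al0 C0 dis]]] := distortion hd hF.
have [B B1 hB] := IFS_diam hd hF.
exists (expR (C * B `^ al)) => [|w x y Ux Uy].
  by rewrite -expR0 ler_expR mulr_ge0 ?powR_ge0 ?(ltW C0).
have [k k1] := exists_enorm1 R hd.
have := dis w x y k Ux Uy; rewrite k1 mulr1.
have := enorm_triB (dfw f w x k) (dfw f w y k).
rewrite !(dfw_similar hd hF)// k1 !mulr1 ler_norml => /andP[_].
move=> /le_trans h1 /h1; rewrite mulrBl mul1r lerD2r => /le_trans; apply.
apply: ler_wpM2r; first by exact: (rho_ge0 hd hF).
rewrite ler_expR ler_wpM2l ?(ltW C0)// ge0_ler_powR ?nnegrE ?enorm_ge0 ?(ltW al0)//.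
  by rewrite (le_trans ler01).
by apply: hB; exact: subset_closure.
Qed.

Lemma rho_le_dnorm w x : U x -> rho w x <= N w.
Proof.
move=> Ux; rewrite dnorm_rho; apply: ub_le_sup; last by exists x.
have [K _ hK] := rho_distortion.
by exists (K * rho w x) => _ [y Uy <-]; exact: hK.
Qed.

Lemma dnorm_le w c : (forall x, U x -> rho w x <= c) -> N w <= c.
Proof.
have [x Ux] := IFS_nonempty.
move=> h; rewrite dnorm_rho; apply: ge_sup; first by exists (rho w x), x.
by move=> _ [y Uy <-]; exact: h.
Qed.

Lemma IFS_word_norm : exists K m l, word_norm N K m l /\
  (forall w x, U x -> N w <= K * rho w x).
Proof.
have [K K1 hK] := rho_distortion.
have [m m0 hm] := rho_lower hd hF.
have [l /andP[l0 l1] hl] := rho_upper hd hF.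
have [x0 Ux0] := IFS_nonempty.
have NK w x : U x -> N w <= K * rho w x.
  by move=> Ux; apply: dnorm_le => y Uy; exact: hK.
exists K, m, l; split; last exact: NK.
apply: (WordNorm K1 m0 l0 l1).
- apply/eqP; rewrite eq_le dnorm_le/=.
    by rewrite -(rho_nil hd f x0); exact: rho_le_dnorm.
  by move=> x Ux; rewrite (rho_nil hd f).
- move=> w v; apply: dnorm_le => x Ux; rewrite (rho_cat hd hF)//.
  have Uvx := fword_map hF v Ux.
  apply: ler_pM; [exact: (rho_ge0 hd hF)|exact: (rho_ge0 hd hF)| |];
    exact: rho_le_dnorm.
- move=> w v; have N0 : 0 <= N w.
    by apply: le_trans (rho_le_dnorm w Ux0); exact: (rho_ge0 hd hF).
  have Kgt0 : 0 < K by apply: lt_le_trans K1.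
  have le1 x : U x -> N w * rho v x <= K * N (w ++ v).
    move=> Ux; apply: (@le_trans _ _ (K * rho (w ++ v) x)); last first.
      by rewrite ler_wpM2l ?(ltW Kgt0)//; exact: rho_le_dnorm.
    rewrite (rho_cat hd hF)// mulrA ler_wpM2r//; first exact: (rho_ge0 hd hF).
    by apply: NK; exact: (fword_map hF).
  have [->|w0] := eqVneq (N w) 0.
    rewrite mul0r mulr_ge0 ?(ltW Kgt0)//.
    by apply: le_trans (rho_le_dnorm (w ++ v) Ux0); exact: (rho_ge0 hd hF).
  have {N0 w0}N0 : 0 < N w by rewrite lt_neqAle eq_sym w0 N0.
  rewrite mulrC -ler_pdivlMr//; apply: dnorm_le => x Ux.
  by rewrite ler_pdivlMr// mulrC; exact: le1.
- move=> w; apply: le_trans (rho_le_dnorm w Ux0).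
  exact: (rho_ge_exp hd hF).
- by move=> w; apply: dnorm_le => x Ux; exact: (rho_le_exp hd hF).
Qed.

Lemma fword_dnorm_lip w x y : U x -> U y ->
  enorm (fword f w x - fword f w y) <= N w * enorm (x - y).
Proof. by move=> Ux Uy; apply: (fword_lip hd hF) => // z; exact: rho_le_dnorm. Qed.

(** * Inner balls of the images and separation *)

Lemma IFS_inj i x y : U x -> U y -> f i x = f i y -> x = y.
Proof.
move=> /(IFS_subset hF) Dx /(IFS_subset hF) Dy; case: hF => _ _ _ /(_ i)[_ inj _ _].
by apply: inj; rewrite inE.
Qed.

Lemma enorm_ball_compact (x0 : 'rV[R]_d) (p : R) : compact [set x : 'rV[R]_d | enorm (x - x0) <= p].
Proof.
apply: bounded_closed_compact.
  exists (p + `|x0|); split; first exact: num_real.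
  move=> M /ltW pM x /= hx; apply: le_trans pM.
  rewrite -[x in leLHS](subrK x0) (le_trans (ler_normD _ _))// lerD2r.
  exact: le_trans (norm_le_enorm _) hx.
have -> : [set x : 'rV[R]_d | enorm (x - x0) <= p] =
    ((fun x => enorm (x - x0)) : _ -> R) @^-1` [set y | y <= p] by [].
apply: closed_comp => [x _|]; last exact: closed_le.
by apply: (@enormB_continuous _ _ _ id).
Qed.

(** Let [x1] minimise [|f_w x - z|] on a closed ball of radius [p] about [x0], so small that the
    differential of [f_w] varies there by at most half its norm. On the sphere, [f_w] is at least
    [rho w x0 * p / 2] away from [f_w x0], so [x1] is interior. If the minimum were positive, a step
    from [x1] in the direction that the differential maps to [z - f_w x1] would lower it. By bounded
    distortion [p] does not depend on [w]. *)
Lemma fword_ball (O : set 'rV[R]_d) x0 : open O -> O `<=` U -> O x0 ->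
  exists2 c : R, 0 < c & forall w z,
    enorm (z - fword f w x0) < c * N w -> exists2 x, O x & fword f w x = z.
Proof.
move=> oO OU Ox0.
have [al [C [al0 C0 dis]]] := distortion hd hF.
have [K [_ [_ [[K1 _ _ _ _ _ _ _ _] hK]]]] := IFS_word_norm.
have K0 : 0 < K by apply: lt_le_trans K1.
have [r1 r10 hr1] : exists2 r : R, 0 < r & forall x, enorm (x - x0) <= r -> O x.
  have := open_nbhs_nbhs (conj oO Ox0) => /nbhs_normP[r r0 hr].
  exists (r / 2) => [|x hx]; first by rewrite divr_gt0.
  apply: hr => /=; rewrite -normrN opprB.
  apply: le_lt_trans (norm_le_enorm _) _; apply: le_lt_trans hx _.
  by move: r0 => /= r0; lra.
have [r3 r30 hr3] := @expR_small R C al (1 / 2) C0 al0 ltac:(lra).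
pose p := Num.min r1 r3.
have p0 : 0 < p by rewrite lt_min r10.
(* Chosen so that [2 c N w <= rho w x0 * p / 2], the lower bound on the sphere. *)
pose c := p / (4 * K).
have c0 : 0 < c by rewrite divr_gt0// mulr_gt0.
exists c => // w z hz.
have bO x : enorm (x - x0) <= p -> O x.
  by move=> h; apply: hr1; apply: le_trans h _; rewrite ge_min lexx.
have Ux0 := OU _ Ox0.
have w0 : 0 < rho w x0 by exact: (rho_gt0 hd hF).
pose F x : R := enorm (fword f w x - z).
have [||x1 /set_mem/= x1p hmin] := @EVT_min_rV R d F _ _ (@enorm_ball_compact x0 p).
- by exists x0; rewrite /= subrr enorm0 ltW.
- apply: continuous_in_subspaceT => x /set_mem/= xp.
  apply: (@enormB_continuous _ _ _ (fword f w)).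
  by apply: differentiable_continuous; apply: (fword_diff hF); apply: OU; exact: bO.
have Ox1 := bO _ x1p; have Ux1 := OU _ Ox1.
have min0 : F x1 <= F x0 by apply: hmin; rewrite inE/= subrr enorm0 ltW.
have F0 : F x0 < c * N w by rewrite /F enormB.
have seg x y (k : R) : enorm (x - x0) <= p -> enorm (y - x0) <= p -> 0 <= k <= 1 ->
    enorm (y + k *: (x - y) - x0) <= p.
  move=> hx hy /andP[k0 k1].
  have -> : y + k *: (x - y) - x0 = k *: (x - x0) + (1 - k) *: (y - x0).
    by apply/rowP => i; rewrite !mxE; ring.
  rewrite (le_trans (enormD _ _))// !enormZ (ger0_norm k0) ger0_norm ?subr_ge0//.
  have k1' : 0 <= 1 - k by rewrite subr_ge0.
  by have := ler_wpM2l k0 hx; have := ler_wpM2l k1' hy; lra.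
have x1i : enorm (x1 - x0) < p.
  rewrite lt_neqAle x1p andbT; apply/eqP => x1e.
  have : enorm (fword f w x1 - fword f w x0 - dfw f w x0 (x1 - x0))
      <= (1 / 2 * rho w x0) * enorm (x1 - x0).
    apply: (@mean_value_ineqB R d [set x | enorm (x - x0) <= p]).
    - by rewrite dfwE; apply: diff_continuous; exact: (fword_diff hF).
    - by move=> k k01 /=; apply: seg => //; rewrite subrr enorm0 ltW.
    - by move=> x /= /bO/OU Ux; exact: (fword_diff hF).
    - move=> x h /= xp; have Ux := OU _ (bO _ xp).
      rewrite -dfwE; apply: le_trans (dis w x x0 h Ux Ux0) _.
      rewrite ler_wpM2r ?enorm_ge0// ler_wpM2r ?(ltW w0)//.
      by apply: hr3; rewrite enorm_ge0 (le_trans xp)// ge_min lexx orbT.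
  have := enorm_triB (dfw f w x0 (x1 - x0)) (fword f w x1 - fword f w x0).
  rewrite (dfw_similar hd hF)// x1e ler_norml => /andP[_].
  rewrite [enorm (dfw _ _ _ _ - _)]enormB => h1 h2.
  have hw : 2 * c * N w <= 1 / 2 * rho w x0 * p.
    have -> : 2 * c * N w = (p / 2) * (N w / K) by rewrite /c; field; rewrite gt_eqF.
    have : N w / K <= rho w x0 by rewrite ler_pdivrMr// mulrC; exact: hK.
    by move/(ler_wpM2l (ltW (divr_gt0 p0 (ltr0Sn R 1)))) => h; lra.
  have tri := enorm_tri (fword f w x1) z (fword f w x0).
  by move: min0 F0; rewrite /F => min0 F0; lra.
have [fz|nz] := eqVneq (fword f w x1) z; first by exists x1.
exfalso; set a := fword f w x1 - z.
have a0 : 0 < enorm a by rewrite enorm_gt0// subr_eq0.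
have w1 : 0 < rho w x1 by exact: (rho_gt0 hd hF).
have [|h hh] := @injective_linear_surj R d (dfw f w x1) (- a).
  move=> h h0; apply: enorm_eq0; have := dfw_similar hd hF w h Ux1.
  by rewrite h0 enorm0 => /esym/eqP; rewrite mulf_eq0 (gt_eqF w1) => /eqP.
have ha : rho w x1 * enorm h = enorm a.
  by rewrite -(dfw_similar hd hF)// hh enormN.
have h0 : 0 < enorm h by rewrite -(pmulr_rgt0 _ w1) ha.
pose q := Num.min (p - enorm (x1 - x0)) r3.
have q0 : 0 < q by rewrite lt_min r30 subr_gt0 x1i.
(* The step stays in the ball and within the radius [r3] of small distortion, and [1 - e] is
   nonnegative. *)
pose e := Num.min 1 (q / enorm h).
have e0 : 0 < e by rewrite lt_min ltr01 divr_gt0.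
have e1 : e <= 1 by rewrite ge_min lexx.
have eh : e * enorm h <= q by rewrite -ler_pdivlMr// ge_min lexx orbT.
have x2b x : enorm (x - x1) <= e * enorm h -> enorm (x - x0) <= p.
  move=> hx; apply: le_trans (enorm_tri _ x1 _) _; rewrite -lerBrDr.
  by apply: le_trans hx _; apply: le_trans eh _; rewrite ge_min lexx.
have x2e : x1 + e *: h - x1 = e *: h by rewrite addrC addKr.
have x2n : enorm (x1 + e *: h - x1) = e * enorm h.
  by rewrite x2e enormZ ger0_norm// ltW.
have hx2 : F x1 <= F (x1 + e *: h).
  by apply: hmin; rewrite inE/=; apply: x2b; rewrite x2n.
have : enorm (fword f w (x1 + e *: h) - fword f w x1 - dfw f w x1 (x1 + e *: h - x1))
      <= (1 / 2 * rho w x1) * enorm (x1 + e *: h - x1).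
  apply: (@mean_value_ineqB R d [set x | enorm (x - x1) <= e * enorm h]).
  - by rewrite dfwE; apply: diff_continuous; exact: (fword_diff hF).
  - move=> k /andP[k0 k1] /=; rewrite x2e [x1 + _]addrC addrK enormZ (ger0_norm k0).
    by rewrite enormZ (gtr0_norm e0) ler_piMl// mulr_ge0 ?enorm_ge0// ltW.
  - by move=> x /= /x2b/bO/OU Ux; exact: (fword_diff hF).
  - move=> x k /= xp; have Ux := OU _ (bO _ (x2b _ xp)).
    rewrite -dfwE; apply: le_trans (dis w x x1 k Ux Ux1) _.
    rewrite ler_wpM2r ?enorm_ge0// ler_wpM2r ?(ltW w1)//.
    apply: hr3; rewrite enorm_ge0 (le_trans xp)// (le_trans eh)//.
    by rewrite ge_min lexx orbT.
rewrite x2n x2e linearZ/= hh => H.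
have eF : fword f w (x1 + e *: h) - z =
   (fword f w (x1 + e *: h) - fword f w x1 - e *: (- a)) + (1 - e) *: a.
  by rewrite /a; apply/rowP => i; rewrite !mxE; ring.
have := enormD (fword f w (x1 + e *: h) - fword f w x1 - e *: (- a)) ((1 - e) *: a).
rewrite -eF enormZ ger0_norm ?subr_ge0// => H2.
have ea : e * enorm a > 0 by rewrite mulr_gt0.
have H3 : 1 / 2 * rho w x1 * (e * enorm h) = 1 / 2 * (e * enorm a) by rewrite -ha; ring.
move: hx2 H2; rewrite /F -/a => hx2 H2; rewrite H3 in H.
by lra.
Qed.

(** Equal first letters are cancelled by injectivity; at the first difference the images of [O] are
    disjoint. *)
Lemma fword_disjoint (O : set 'rV[R]_d) : O `<=` U ->
  (forall i, f i @` O `<=` O) ->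
  (forall i j, i != j -> (f i @` O) `&` (f j @` O) = set0) ->
  forall w v x y, O x -> O y -> fword f w x = fword f v y ->
  prefix w v || prefix v w.
Proof.
move=> OU fO dO; have wO w x : O x -> O (fword f w x).
  by move=> Ox; elim: w => //= i w ih; apply: fO; exists (fword f w x).
elim=> [|i w ih] [|j v] x y Ox Oy //= e.
have [ij|ij] := eqVneq i j.
  move: e; rewrite ij => e; apply: (ih _ x y) => //.
  by apply: IFS_inj e; apply: OU; exact: wO.
have : ((f i @` O) `&` (f j @` O)) (f i (fword f w x)).
  by split; [exists (fword f w x)|exists (fword f v y)] => //; exact: wO.
by rewrite dO.
Qed.

(** The ball of radius [c * N w] about [f_w x0] lies in [f_w O]; if it contained [f_v x0], then
    [f_w O] and [f_v O] would meet. *)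
Lemma separation : open_set_condition U f -> exists x0 c, [/\ U x0, 0 < c &
  forall w v, ~~ prefix w v -> ~~ prefix v w ->
    c * N w <= enorm (fword f v x0 - fword f w x0)].
Proof.
move=> [] O [[x0 Ox0] oO OU fO dO].
have [c c0 hc] := fword_ball oO OU Ox0.
exists x0, c; split=> //; first exact: OU.
move=> w v wv vw; rewrite leNgt; apply/negP => h; have [x Ox e] := hc _ _ h.
by have := fword_disjoint OU fO dO Ox Ox0 e; rewrite (negPf wv) (negPf vw).
Qed.

End WordNorm.

(** * The coding map *)

Lemma blockE (S : nat) (e : nat -> 'I_S) n : block e 1 n = mkseq e n.
Proof.
rewrite /block /index_iota subSS subn0 /mkseq -[1%N]addn0 iotaDl -map_comp.
by apply: eq_map => k.
Qed.

Section Attractor.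
Variables (R : realType) (d S : nat) (hd : (1 <= d)%N).
Variables (D U : set 'rV[R]_d) (f : 'I_S -> 'rV[R]_d -> 'rV[R]_d).
Hypothesis hF : conformal_IFS D U f.
Variable N : seq 'I_S -> R.
Hypothesis hN : forall w, N w = dnorm U (fword f w).
Variable Lam : set 'rV[R]_d.
Hypothesis hLam : is_attractor U f Lam.

Lemma attractor_subset : Lam `<=` U.
Proof.
case: hLam => LU _ _ LE x; rewrite {1}LE => -[i _ [y Ly <-]].
by case: hF => _ _ _ /(_ i)[_ _ fU _]; apply: fU; exists y => //; exact: LU.
Qed.

Lemma fword_attractor w x : Lam x -> Lam (fword f w x).
Proof.
move=> Lx; elim: w => //= i w ih; case: hLam => _ _ _ ->.
by exists i => //; exists (fword f w x).
Qed.

Lemma fword_attractor_compact w : compact (fword f w @` Lam).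
Proof.
apply: continuous_compact; last by case: hLam.
apply: continuous_in_subspaceT => x /set_mem Lx.
apply: differentiable_continuous; apply: (fword_diff hF).
exact: attractor_subset.
Qed.

Lemma fword_prefix_image e m n : (m <= n)%N ->
  fword f (mkseq e n) @` Lam `<=` fword f (mkseq e m) @` Lam.
Proof.
move=> mn _ [x Lx <-]; rewrite -(subnKC mn) /mkseq iotaD map_cat (fword_cat f).
by exists (fword f [seq e i | i <- iota (0 + m) (n - m)] x) => //; exact: fword_attractor.
Qed.

(** Since [coding] is a [get], the intersection has to be shown nonempty: a cluster point of the
    orbit of one point of [Lam] lies in all the images, which are closed and decrease. *)
Lemma coding_fword e n : (fword f (mkseq e n) @` Lam) (coding f Lam e).
Proof.
suff : (\bigcap_(n in [set: nat]) (fword f (block e 1 n) @` Lam)) !=set0.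
  by move=> /getPex /(_ n I); rewrite blockE.
have [LU [x0 Lx0] cL LE] := hLam.
pose x n := fword f (mkseq e n) x0.
have [p [_ clp]] : exists p, Lam p /\ cluster (x @ \oo) p.
  have xL : (x @ \oo) Lam by exists 0%N => // m _; exact: fword_attractor.
  by have [p [Lp cp]] := cL (x @ \oo) _ xL; exists p.
exists p => m _; rewrite blockE.
have cm : closed (fword f (mkseq e m) @` Lam).
  by apply: compact_closed; [exact: norm_hausdorff|exact: fword_attractor_compact].
apply: cm => B Bp; apply: clp => //.
exists m => // k /= mk; apply: (fword_prefix_image mk).
by exists x0.
Qed.

Lemma coding_attractor e : Lam (coding f Lam e).
Proof. by have [x Lx <-] := coding_fword e 0. Qed.

Lemma attractor_diam : exists2 B : R, 0 < B & forall w x y,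
  (fword f w @` Lam) x -> (fword f w @` Lam) y -> enorm (x - y) <= B * N w.
Proof.
have [B B1 hB] := IFS_diam hd hF.
exists B => [|w _ _ [x Lx <-] [y Ly <-]]; first by apply: lt_le_trans B1.
have Ux := attractor_subset Lx; have Uy := attractor_subset Ly.
apply: le_trans (fword_dnorm_lip hd hF hN w Ux Uy) _.
rewrite mulrC ler_wpM2r//.
  apply: le_trans (rho_le_dnorm hd hF hN w Ux); exact: (rho_ge0 hd hF).
by apply: hB; exact: subset_closure.
Qed.

(** The points [f_w x0] lie within [(B + 1) r] of a point of [C] and are [c kappa r] apart by
    [separation], so that [packing] applies. *)
Lemma cut_count (kappa : R) : 0 < kappa -> open_set_condition U f ->
  exists Nmax : nat, forall (r : R) (C : set 'rV[R]_d) (s : seq (seq 'I_S)),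
    0 < r -> (forall x y, C x -> C y -> enorm (x - y) <= r) -> uniq s ->
    (forall w, w \in s -> [/\ kappa * r <= N w, N w <= r &
       exists2 x, (fword f w @` Lam) x & C x]) ->
    (forall w v, w \in s -> v \in s -> w != v -> ~~ prefix w v) ->
    (size s <= Nmax)%N.
Proof.
move=> k0 /(separation hd hF hN)[x0 [c [Ux0 c0 sep]]].
have [B B1 hB] := IFS_diam hd hF.
have B0 : 0 < B by apply: lt_le_trans B1.
have [Nmax pack] := @packing R d (B + 1) (c * kappa) (addr_gt0 B0 ltr01) (mulr_gt0 c0 k0).
exists Nmax => r C s r0 Cr us hs pre.
case: s us hs pre => // w0 s us hs pre.
have [_ _ [p _ Cp]] := hs w0 (mem_head _ _).
apply: (pack _ (fun w => fword f w x0) r p (w0 :: s) r0 us) => [w ws|w v ws vs wv].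
  have [_ Nr [y [x Lx ey] Cy]] := hs w ws.
  apply: le_trans (enorm_tri _ y _) _; rewrite mulrDl mul1r lerD//; last exact: Cr.
  rewrite -ey; have Ux := attractor_subset Lx.
  apply: le_trans (fword_dnorm_lip hd hF hN w Ux0 Ux) _.
  have N0 : 0 <= N w.
    apply: le_trans (rho_le_dnorm hd hF hN w Ux); exact: (rho_ge0 hd hF).
  by rewrite mulrC ler_pM ?enorm_ge0// hB//; exact: subset_closure.
rewrite enormB; have [kr _ _] := hs w ws.
apply: le_trans (sep w v (pre _ _ ws vs wv) _).
  by rewrite -mulrA ler_pM2l.
by apply: pre => //; rewrite eq_sym.
Qed.
End Attractor.

(** * Hausdorff measure *)

Section HausdorffMeasure.
Variables (R : realType) (d : nat).
Implicit Types (A B : set 'rV[R]_d) (s delta : R).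

Lemma diam_pow_ge0 s A : 0 <= diam_pow s A.
Proof. by rewrite /diam_pow; case: ifP => // _; exact: powR_ge0. Qed.

Lemma premeasure_ge0 s delta A : (0 <= hausdorff_premeasure s delta A)%E.
Proof.
apply: le_ereal_inf_tmp => _ [C _ <-].
by apply: nneseries_ge0 => i _ _; rewrite lee_fin diam_pow_ge0.
Qed.

Lemma hausdorff_measure_le A B s : A `<=` B ->
  (hausdorff_measure s A <= hausdorff_measure s B)%E.
Proof.
move=> AB; apply: ge_ereal_sup => _ [delta /= d0 <-].
apply: (@le_trans _ _ (hausdorff_premeasure s delta B)); last first.
  by apply: ereal_sup_ubound; exists delta.
apply: ereal_inf_le_tmp => _ [C [cC dC] <-]; exists C => //; split=> //.
exact: subset_trans cC.
Qed.

Lemma hausdorff_measure_ge0 s A : (0 <= hausdorff_measure s A)%E.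
Proof.
apply: (@le_trans _ _ (hausdorff_premeasure s 1 A)); first exact: premeasure_ge0.
by apply: ereal_sup_ubound; exists 1 => //=.
Qed.

Lemma hausdorff_dim_le A B : A `<=` B -> (hausdorff_dim A <= hausdorff_dim B)%E.
Proof.
move=> AB; apply: ereal_inf_le_tmp => _ [s [s0 hs] <-]; exists s => //; split=> //.
apply/eqP; rewrite eq_le hausdorff_measure_ge0 andbT -hs.
exact: hausdorff_measure_le.
Qed.

(** Bounds on all finite partial sums stand for the series, so that covers are handled with real
    sums only. *)
Lemma hausdorff_null_cover s A : hausdorff_measure s A = 0%E ->
  forall delta e, 0 < delta -> 0 < e -> exists2 C, delta_cover delta A C &
    forall n, \sum_(i < n) diam_pow s (C i) <= e.
Proof.
move=> hA delta e d0 e0.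
have : (hausdorff_premeasure s delta A < e%:E)%E.
  apply: le_lt_trans (_ : 0 < e%:E)%E; last by rewrite lte_fin.
  by rewrite -hA; apply: ereal_sup_ubound; exists delta.
move=> /ereal_inf_lt[_ [C dC <-] lte]; exists C => // n.
rewrite -lee_fin -sumEFin; apply: le_trans (ltW lte).
rewrite -(big_mkord xpredT (fun i => (diam_pow s (C i))%:E)).
apply: nneseries_lim_ge => i _ _; rewrite lee_fin; exact: diam_pow_ge0.
Qed.

Lemma hausdorff_null s A :
  (forall delta e, 0 < delta -> 0 < e -> exists2 C, delta_cover delta A C &
    forall n, \sum_(i < n) diam_pow s (C i) <= e) ->
  hausdorff_measure s A = 0%E.
Proof.
move=> h; apply/eqP; rewrite eq_le hausdorff_measure_ge0 andbT.
apply: ge_ereal_sup => _ [delta /= d0 <-].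
apply/lee_addgt0Pr => e e0; rewrite add0e.
have [C dC hC] := h _ _ d0 e0.
apply: (@le_trans _ _ (\sum_(0 <= i <oo) (diam_pow s (C i))%:E)%E).
  by apply: ereal_inf_lbound; exists C.
apply: lime_le.
  by apply: is_cvg_nneseries => i _ _; rewrite lee_fin diam_pow_ge0.
by apply: nearW => n; rewrite big_mkord sumEFin lee_fin.
Qed.

(** Covers may be indexed by a countable type, such as one of words. Numbers that code no index get
    the empty set, whose weight is 0. *)
Lemma hausdorff_null_countable (I : countType) s A :
  (forall delta e, 0 < delta -> 0 < e -> exists C : I -> set 'rV[R]_d,
    [/\ A `<=` \bigcup_(i in [set: I]) C i,
        forall i x y, C i x -> C i y -> enorm (x - y) <= delta &
        forall l : seq I, uniq l -> \sum_(i <- l) diam_pow s (C i) <= e]) ->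
  hausdorff_measure s A = 0%E.
Proof.
move=> h; apply: hausdorff_null => delta e d0 e0.
have [C [cC dC sC]] := h _ _ d0 e0.
pose C' n := if pickle_inv n is Some i then C i else (set0 : set 'rV[R]_d).
exists C'; first split.
- move=> x /cC[i _ Cx]; exists (@pickle I i) => //.
  by rewrite /C' pickleK_inv.
- by rewrite /C' => n x y; case: pickle_inv => // i; exact: dC.
move=> n; apply: le_trans (sC (pmap (@pickle_inv I) (iota 0 n)) _); last first.
  by apply: (pmap_uniq (@pickle_invK I)); exact: iota_uniq.
rewrite -(big_mkord xpredT (fun i => diam_pow s (C' i))) /index_iota subn0.
elim: (iota 0 n) => [|k l ih]; first by rewrite !big_nil.
rewrite big_cons /= /C' -/C'; case: pickle_inv => [i|] /=.
  by rewrite big_cons lerD2l.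
by rewrite /diam_pow eqxx add0r.
Qed.
End HausdorffMeasure.

(** The list is grouped by the first coordinate. Used twice, for covers indexed by a threshold, a
    length and a word. *)
Lemma sum_uniq_prod (R : realType) (J : countType) (g : nat * J -> R) (b : nat -> R) (B : R) :
  (forall x, 0 <= g x) ->
  (forall k l, uniq l -> \sum_(j <- l) g (k, j) <= b k) ->
  (forall n, \sum_(k < n) b k <= B) ->
  forall l : seq (nat * J), uniq l -> \sum_(x <- l) g x <= B.
Proof.
move=> g0 hb hB l ul; pose n := (\max_(x <- l) x.1).+1.
have ln x : x \in l -> (x.1 < n)%N.
  by move=> xl; rewrite ltnS (big_rem x)//= leq_maxl.
apply: le_trans (hB n); rewrite big_seq.
rewrite (partition_big (fun x : nat * J => inord x.1 : 'I_n) xpredT)//=.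
apply: ler_sum => k _.
pose l' := [seq x.2 | x <- l & x.1 == k :> nat].
apply: le_trans (hb k l' _); last first.
  rewrite map_inj_in_uniq ?filter_uniq// => -[a x] [a' x']; rewrite !mem_filter/=.
  by move=> /andP[/eqP-> _] /andP[/eqP-> _] /= ->.
rewrite big_map big_filter big_seq_cond [leRHS]big_seq_cond.
rewrite le_eqVlt; apply/orP; left; apply/eqP.
apply: eq_big => [x|x].
  case xl : (x \in l) => //=; rewrite -val_eqE/= inordK//; exact: ln.
by move=> /and3P[_ xl /eqP xk]; rewrite -xk inordK ?ln//; case: x {xl xk}.
Qed.

Lemma sum_half_powers (R : realType) n : \sum_(k < n) (2 ^+ k.+1)^-1 = 1 - (2 ^+ n)^-1 :> R.
Proof.
elim: n => [|n ih]; first by rewrite big_ord0 expr0 invr1 subrr.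
by rewrite big_ord_recr/= ih exprS; field; rewrite expf_neq0.
Qed.

(** * Matches and records *)

Section Matches.
Variable S : nat.
Implicit Types (e t : nat -> 'I_S).

(** Here [m] is the number of letters of [e] before the match, as in the shift by [m]. *)
Definition agrees e t m L : Prop := forall k, (k < L)%N -> e (m + k)%N = t k.

Lemma agrees_le e t m L L' : (L' <= L)%N -> agrees e t m L -> agrees e t m L'.
Proof. by move=> LL h k kL; apply: h; exact: leq_trans LL. Qed.

Lemma cylinder_agrees e t m L :
  cylinder (block t 1 L) (shift_seq m e) <-> agrees e t m L.
Proof.
rewrite /cylinder /= !blockE size_mkseq; split=> [h k kL|h].
  by have := congr1 (fun s => nth (t 0%N) s k) h; rewrite !nth_mkseq.
by apply: (@eq_from_nth _ (t 0%N)) => [|k]; rewrite !size_mkseq// => kL;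
  rewrite !nth_mkseq//; exact: h.
Qed.

(** A match of length exactly [L] at [m] shows [t] with its digit [L + 1] replaced. Membership in G
    forbids that a final part of this word, ending with the replaced digit, is an initial segment of
    [t]; so no match that starts inside the first one runs across its break. *)
Lemma G_break t : G_set t -> exists N0 : nat, forall e m L a, (N0 <= L)%N -> (a < L)%N ->
  agrees e t m L -> e (m + L)%N <> t L -> ~ agrees e t (m + a) (L.+1 - a).
Proof.
move=> [N0 N00 hG]; exists N0 => e m L a NL aL hm hL ha.
have jt : e (m + L)%N != digit t L.+1 by apply/eqP.
apply: (hG L.+1 a.+1 NL _ aL _ jt) => //.
apply: (@eq_from_nth _ (t 0%N)).
  by rewrite /block !size_map /index_iota !size_iota; lia.
rewrite /block size_map /index_iota size_iota => k kL.
rewrite !(nth_map 0%N) ?size_iota; [|lia..].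
rewrite !nth_iota; [|lia..].
rewrite /digit /replace_digit addSn add1n /= eqSS.
have [akL|akL] := eqVneq (a + k)%N L.
  by rewrite -akL addnA; apply: ha; lia.
have <- : e (m + a + k)%N = t k by apply: ha; lia.
by rewrite -addnA hm//; lia.
Qed.

(** Let the first letter of [t] occur late, at distance [q] from [m]. Then [t] matches itself at [q]
    for ever: otherwise [t], with the digit at the break corrected, contradicts [G_break]. So [t]
    has period [q], and the match at [m] starts again at each [m + B q]. *)
Lemma infinite_match e t m : G_set t ->
  (forall L, agrees e t m L) ->
  (forall B, exists n, (B <= n)%N /\ agrees e t n 1) ->
  forall B, exists n, (B <= n)%N /\ forall L, agrees e t n L.
Proof.
move=> /G_break[N0 hG] hm hn B.
have [a [Na ha]] := hn (m + N0).+1.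
pose q := (a - m)%N.
have q0 : (N0 < q)%N by rewrite /q; lia.
have am : a = (m + q)%N by rewrite /q; lia.
have tq L : agrees t t q L.+1.
  elim: L => [|L ih].
    by move=> [|//] _; rewrite addn0 -(hm q.+1)// -am -(ha 0%N)// addn0.
  move=> k; rewrite ltnS leq_eqVlt => /orP[/eqP->|]; last exact: ih.
  apply: contrapT => hL.
  pose r i := if i == (q + L.+1)%N then t L.+1 else t i.
  apply: (hG r 0%N (q + L.+1)%N q).
  - lia.
  - lia.
  - by move=> i iq; rewrite /r add0n ltn_eqF.
  - by rewrite /r add0n eqxx => /esym.
  - move=> i iL0; rewrite add0n /r eqn_add2l.
    by have [->//|iL'] := eqVneq i L.+1; rewrite (ih i)//; lia.
have tj j k : t (j * q + k)%N = t k.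
  elim: j k => [|j ih] k; first by rewrite mul0n.
  by rewrite mulSn -addnA (tq (j * q + k)%N) ?ih.
exists (m + B * q)%N; split; first by nia.
by move=> L k kL; rewrite -addnA (hm (B * q + k).+1)// tj.
Qed.

(* A match of t that starts at M reaches further to the right, namely up to E,
   than every match that starts earlier. *)
Definition is_record e t M := exists E, [/\ (M <= E)%N, agrees e t M (E - M) &
  forall m, (0 < m < M)%N -> ~ agrees e t m (E - m)].

(** The leftmost start of a match of length [L] is a record, with [E = m + L]. *)
Lemma record_min e t n L : (0 < n)%N -> agrees e t n L ->
  exists m, [/\ (0 < m <= n)%N, agrees e t m L & is_record e t m].
Proof.
move=> n0 hn; pose P m := `[< (0 < m)%N /\ agrees e t m L >].
have exP : exists m, P m by exists n; apply/asboolP.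
have [m /asboolP[m0 hm] mmin] := ex_minnP exP.
have mn : (m <= n)%N by apply: mmin; apply/asboolP.
exists m; split=> //; first by rewrite m0.
exists (m + L)%N; split; rewrite ?leq_addr ?addKn// => m' /andP[m'0 m'm] h.
have : (m <= m')%N by apply: mmin; apply/asboolP; split=> //; apply: agrees_le h; lia.
lia.
Qed.

(** As [M] is a record, the match at [m] breaks before [E]. If it went beyond [M], the match at [M],
    which reaches [E], would run across this break, against [G_break]. *)
Lemma record_disjoint t : G_set t -> exists N0 : nat, forall e M m L,
  is_record e t M -> (0 < m < M)%N -> (N0 <= L)%N -> agrees e t m L -> (m + L <= M)%N.
Proof.
move=> /G_break[N0 hG]; exists N0 => e M m L [E [ME hM hE]] mM NL hm.
have nm := hE m mM.
pose P k := e (m + k)%N != t k.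
have exP : exists k, P k.
  apply: contrapT => h; apply: nm => k _; apply/eqP; apply/negPn/negP => hk.
  by apply: h; exists k.
have [L' /eqP hL' min] := ex_minnP exP.
have ag : agrees e t m L'.
  move=> k kL; apply/eqP; apply/negPn/negP => /min; lia.
have LL : (L <= L')%N.
  by rewrite leqNgt; apply/negP => lt; apply: hL'; exact: hm.
have L'E : (m + L' < E)%N.
  rewrite ltnNge; apply/negP => le; apply: nm => k kE; apply: ag; lia.
apply: contrapT => /negP; rewrite -ltnNge => lt.
have := hG e m L' (M - m)%N (leq_trans NL LL); apply => //; first lia.
have -> : (m + (M - m))%N = M by lia.
by apply: agrees_le hM; lia.
Qed.
End Matches.

Lemma infinite_natP (A : set nat) :
  infinite_set A <-> forall B, exists n, (B <= n)%N /\ A n.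
Proof.
split=> [infA B|h].
  apply: contrapT => nex; apply: infA; apply: sub_finite_set (finite_II B).
  move=> n An /=; rewrite ltnNge; apply/negP => Bn; apply: nex; by exists n.
move=> /finite_seqP[s As]; have [n [sn]] := h (\max_(x <- s) x).+1.
by rewrite As /= => ns; move: sn; rewrite (big_rem n)//=; lia.
Qed.

Lemma exists_nat_gt (R : realType) (x : R) : exists n : nat, x < n%:R.
Proof. by exists (Num.truncn x).+1; exact: truncnS_gt. Qed.

(** * Rates, regular sequences and the step back to an earlier record *)

Section Rates.
Variables (R : realType) (S : nat).
Implicit Types (e t : nat -> 'I_S) (u w v x y : R).

Lemma R_sP u e t : R_s u t e <->
  forall B, exists n, [/\ (B <= n)%N, (0 < n)%N & agrees e t n (Num.truncn (u * n%:R))].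
Proof.
apply: (iff_trans (infinite_natP _)); split=> h B; have [n] := h B.
  by move=> [Bn [n0 /cylinder_agrees hn]]; exists n.
by move=> [Bn n0 hn]; exists n; split=> //; split=> //; apply/cylinder_agrees.
Qed.

Lemma R_e_gt u v e t : 0 <= u -> u < v -> (v%:E <= v_e R e t)%E ->
  exists N1, forall n, (N1 <= n)%N ->
    exists m, (0 < m <= n)%N /\ agrees e t m (Num.truncn (u * n%:R)).
Proof.
move=> u0 uv hv; have : (u%:E < v_e R e t)%E by apply: lt_le_trans hv; rewrite lte_fin.
move=> /ereal_sup_gt[_ [u1 [u10 [N1 N10 hN]] <-]]; rewrite lte_fin => uu1.
exists N1 => n /hN[m [m0 mn /cylinder_agrees hm]]; exists m; split; first by rewrite m0.
by apply: agrees_le hm; apply: le_truncn; rewrite ler_wpM2r// ltW.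
Qed.

Lemma R_s_gt u v e t : 0 <= u -> u < v -> (v%:E <= v_s R e t)%E -> R_s u t e.
Proof.
move=> u0 uv hv; have : (u%:E < v_s R e t)%E by apply: lt_le_trans hv; rewrite lte_fin.
move=> /ereal_sup_gt[_ [u1 [u10 /R_sP hN] <-]]; rewrite lte_fin => uu1.
apply/R_sP => B; have [n [Bn n0 hn]] := hN B; exists n; split=> //.
by apply: agrees_le hn; apply: le_truncn; rewrite ler_wpM2r// ltW.
Qed.

(** Both rates with one constant [N1] valid at all positions, for [u] below [v_e] and [w] above
    [v_s]. The choice of [N1] sorts the sequences into countably many classes. *)
Definition regular e t u w (N1 : nat) : Prop :=
  (forall n, (N1 <= n)%N ->
    exists m, (0 < m <= n)%N /\ agrees e t m (Num.truncn (u * n%:R))) /\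
  (forall n L, (0 < n)%N -> agrees e t n L -> L%:R <= w * n%:R + N1%:R).

(** The inequality [v_s < w] bounds the matches at all late starts. The finitely many other starts
    admit a bound unless one of them has an infinite match; as [v_s] is positive, [infinite_match]
    would then give infinite matches at arbitrarily late starts, against [v_s < w]. *)
Lemma exists_regular e t u v w x y : G_set t -> 0 <= u -> u < v -> 0 < x -> y < w ->
  0 <= w ->
  (v%:E <= v_e R e t)%E -> (x%:E <= v_s R e t)%E -> (v_s R e t <= y%:E)%E ->
  exists N1, regular e t u w N1.
Proof.
move=> Gt u0 uv x0 yw w0 hv hx hy.
have [Na ha] := R_e_gt u0 uv hv.
have w'0 : (w%:E <= v_s R e t)%E -> False.
  by move=> h; have := le_trans h hy; rewrite lee_fin leNgt yw.
have nRs : ~ R_s w t e.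
  move=> h; apply: w'0; apply: ereal_sup_ubound; exists w => //.
have fin_match m : (0 < m)%N -> exists L, ~ agrees e t m L.
  move=> m0; apply: contrapT => h; apply: nRs; apply/R_sP => B.
  have {}h L : agrees e t m L by apply: contrapT => h'; apply: h; exists L.
  have [|n [Bn hn]] := infinite_match Gt h _ (maxn B 1).
    move=> B'; have x2 : 0 <= x / 2 by rewrite divr_ge0// ltW.
    have x2x : x / 2 < x by rewrite ltr_pdivrMr// ltr_pMr// ltr1n.
    have [q hq] := exists_nat_gt (2 / x).
    have /R_sP/(_ (B' + q)%N)[n [Bn n0 hn]] := R_s_gt x2 x2x hx.
    exists n; split; first by apply: leq_trans Bn; exact: leq_addr.
    apply: agrees_le hn; rewrite truncn_gt0.
    have : (2 / x) < n%:R.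
      by apply: lt_le_trans hq _; rewrite ler_nat; apply: leq_trans Bn; exact: leq_addl.
    by rewrite ltr_pdivrMr// => h2; rewrite mulrAC ler_pdivlMr// mul1r mulrC ltW.
  by exists n; split; [clear -Bn; lia|clear -Bn; lia|exact: hn].
have [B hB] : exists B, forall n, (B <= n)%N -> (0 < n)%N ->
    ~ agrees e t n (Num.truncn (w * n%:R)).
  apply: contrapT => h; apply: nRs; apply/R_sP => B.
  apply: contrapT => h'; apply: h; exists B => n Bn n0 hn; apply: h'.
  by exists n.
have [C hC] : exists C, forall n L, (0 < n < B)%N -> agrees e t n L -> (L <= C)%N.
  elim: (B) => [|b [C hC]]; first by exists 0%N => n L; clear; lia.
  have [b0|b0] := posnP b; first by exists 0%N => n L; clear -b0; lia.
  have [Lb hLb] := fin_match b b0.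
  exists (maxn C Lb) => n L /andP[n0]; rewrite ltnS leq_eqVlt => /orP[/eqP->|nb] hn.
    rewrite leq_max; apply/orP; right; rewrite leqNgt; apply/negP => lt.
    by apply: hLb; apply: agrees_le hn; exact: ltnW.
  by rewrite leq_max (hC n L)//; apply/andP.
exists (maxn Na C); split=> [n nN|n L n0 hn].
  by apply: ha; lia.
have [Bn|nB] := leqP B n.
  apply: (@le_trans _ _ (w * n%:R)); last by rewrite lerDl.
  rewrite leNgt; apply/negP => lt; apply: (hB n Bn n0); apply: agrees_le hn.
  rewrite -(ler_nat R); apply: le_trans (ltW lt); rewrite truncn_le.
  by rewrite mulr_ge0.
have : (L <= maxn Na C)%N by rewrite leq_max (hC n L) ?orbT// n0 nB.
rewrite -(ler_nat R) => /le_trans; apply; rewrite lerDr.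
by rewrite mulr_ge0.
Qed.

(** A match of length [x n] at [n] is moved to its leftmost start [M]. If [M] stayed below [B],
    regularity would bound the length of the match. *)
Lemma large_records e t u w N1 x : 0 < w -> regular e t u w N1 -> 0 < x ->
  R_s x t e ->
  forall B, exists M, [/\ (B <= M)%N, (0 < M)%N, is_record e t M &
     agrees e t M (Num.truncn (x * M%:R))].
Proof.
move=> w0 [_ hb] x0 /R_sP hx B.
have [q hq] := exists_nat_gt ((w * B%:R + N1%:R + 1) / x).
have [n [nB n0 hn]] := hx q.
have [M [/andP[M0 Mn] hM rM]] := record_min n0 hn.
exists M; split=> //; last first.
  by apply: agrees_le hM; apply: le_truncn; rewrite ler_wpM2l ?ler_nat// ltW.
rewrite leqNgt; apply/negP => MB.
have := hb _ _ M0 hM.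
have h1 : (w * B%:R + N1%:R + 1) / x < n%:R.
  by apply: lt_le_trans hq _; rewrite ler_nat.
have h2 : x * n%:R < (Num.truncn (x * n%:R)).+1%:R by exact: truncnS_gt.
move: h1; rewrite ltr_pdivrMr// -natr1 in h2 *.
have : w * M%:R <= w * B%:R by rewrite ler_wpM2l ?(ltW w0)// ler_nat ltnW.
by lra.
Qed.

(** The rate is applied at [M.-1], so that the match starts strictly before [M]. Its leftmost start
    is again a record, which allows the step to be iterated. *)
Lemma back_step t : G_set t -> exists N0 : nat, forall e u w N1 M,
  regular e t u w N1 -> is_record e t M -> (N1 < M)%N ->
  (N0 <= Num.truncn (u * M.-1%:R))%N ->
  exists m, [/\ (0 < m < M)%N, is_record e t m,
    agrees e t m (Num.truncn (u * M.-1%:R)),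
    (m + Num.truncn (u * M.-1%:R) <= M)%N &
    (Num.truncn (u * M.-1%:R))%:R <= w * m%:R + N1%:R].
Proof.
move=> /record_disjoint[N0 hG]; exists N0 => e u w N1 M [ha hb] rM NM hN0.
have [|n [/andP[n0 nM] hn]] := ha M.-1; first by lia.
have [m [/andP[m0 mn] hm rm]] := record_min n0 hn.
exists m; split=> //; first by lia.
- by apply: (hG e) => //; lia.
- exact: hb hm.
Qed.

Lemma no_small_rate t v theta : 0 < v -> v < 1 -> G_set t -> 1 < theta ->
  theta < (1 - v)^-1 ->
  [set e : nat -> 'I_S | (v%:E <= v_e R e t)%E] `&`
  [set e : nat -> 'I_S | v_s R e t = (theta * v)%:E] = set0.
Proof.
move=> v0 v1 Gt th1 thv; apply/seteqP; split=> // e [/= hv hs].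
have tv0 : 0 < theta * v by rewrite mulr_gt0// (lt_trans ltr01).
have th0 : 0 < 1 - theta * (1 - v).
  by rewrite subr_gt0 -ltr_pdivlMr ?subr_gt0// mul1r.
pose g := v * (1 - theta * (1 - v)).
have g0 : 0 < g by rewrite mulr_gt0.
(* u < v and w > theta v are taken so close to these bounds that u (1 + w) > w *)
have th0' : 0 < 1 + theta by lra.
pose k := g / (4 * (1 + theta)).
have k0 : 0 < k by rewrite divr_gt0// mulr_gt0.
have kE : k * (4 * (1 + theta)) = g by rewrite /k; field; lra.
pose u := v - Num.min k (v / 2); pose w := theta * v + k.
have mk : Num.min k (v / 2) <= k by rewrite ge_min lexx.
have mv : Num.min k (v / 2) <= v / 2 by rewrite ge_min lexx orbT.
have m0 : 0 < Num.min k (v / 2) by rewrite lt_min k0/= divr_gt0.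
have u0 : 0 < u by rewrite /u; lra.
have uv : u < v by rewrite /u; lra.
have w0 : 0 < w by rewrite /w; lra.
have uw : 0 < u * (1 + w) - w.
  have kv : k < v.
    rewrite -(ltr_pM2r (_ : 0 < 4 * (1 + theta))) ?mulr_gt0// kE /g.
    rewrite ltr_pM2l//; nra.
  have : u * (1 + w) - w >= (v - k) * (1 + w) - w.
    by rewrite lerD2r ler_wpM2r//; [lra|rewrite /u; lra].
  apply: lt_le_trans; rewrite /w.
  have -> : (v - k) * (1 + (theta * v + k)) - (theta * v + k) =
     g - k * (2 + theta * v - v + k) by rewrite /g; ring.
  rewrite -kE subr_gt0 ltr_pM2l//.
  have : theta * v < theta by rewrite gtr_pMr// (lt_trans ltr01).
  by lra.
have hs1 : ((theta * v)%:E <= v_s R e t)%E by rewrite hs.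
have hs2 : (v_s R e t <= (theta * v)%:E)%E by rewrite hs.
have yw : theta * v < w by rewrite /w; lra.
have [N1 reg] := exists_regular Gt (ltW u0) uv tv0 yw (ltW w0) hv hs1 hs2.
have x2 : 0 < theta * v / 2 by rewrite divr_gt0.
have x2x : theta * v / 2 < theta * v by rewrite ltr_pdivrMr// ltr_pMr// ltr1n.
have Rx := R_s_gt (ltW x2) x2x hs1.
have [N0 hback] := back_step Gt.
(* For [M] beyond [B1] the match passes the threshold of [back_step]; beyond [B2] the difference
   [(u (1 + w) - w) M] exceeds all rounding errors. *)
have [B1 hB1] := exists_nat_gt ((N0%:R + 1) / u).
have [B2 hB2'] := exists_nat_gt ((N1%:R + (u + 1) * (1 + w)) / (u * (1 + w) - w)).
have [M [MB M0 rM _]] := large_records w0 reg x2 Rx (N1.+1 + B1.+1 + B2)%N.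
have uM : N0%:R + 1 < u * M.-1%:R.
  rewrite mulrC -ltr_pdivrMr//; apply: lt_le_trans hB1 _.
  by rewrite ler_nat; clear -MB; lia.
have [||m [/andP[m0' mM'] rm hm mM hw]] := hback e u w N1 M reg rM.
- by clear -MB; lia.
- rewrite truncn_ge_nat; last by rewrite mulr_ge0// ltW.
  by apply: ltW; apply: lt_trans uM; rewrite ltrDl.
set l := Num.truncn _ in mM hw.
have hl : u * M.-1%:R < l.+1%:R by exact: truncnS_gt.
have hB2 : (N1%:R + (u + 1) * (1 + w)) < M%:R * (u * (1 + w) - w).
  rewrite -ltr_pdivrMr//; apply: lt_le_trans hB2' _.
  by rewrite ler_nat; clear -MB; lia.
have MM : M%:R = M.-1%:R + 1 :> R by rewrite natr1 prednK.
have mM2 : m%:R + l%:R <= M%:R :> R by rewrite -natrD ler_nat.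
rewrite -natr1 in hl.
have h1 : w * m%:R <= w * (M%:R - l%:R) by rewrite ler_wpM2l ?(ltW w0)//; lra.
have h2 : (u * M%:R - u - 1) * (1 + w) <= l%:R * (1 + w).
  by rewrite ler_wpM2r//; [lra|rewrite MM; lra].
by nra.
Qed.
End Rates.

(** * Pressure *)

Lemma tuple_cat_sum (R : nmodType) (T : finType) (F : seq T -> R) n p :
  \sum_(w : (n + p).-tuple T) F w = \sum_(w : n.-tuple T) \sum_(v : p.-tuple T) F (w ++ v).
Proof.
rewrite pair_big/=.
rewrite (reindex (fun x : n.-tuple T * p.-tuple T => [tuple of x.1 ++ x.2]))//=.
apply: onW_bij; apply: inj_card_bij => [[w v] [w' v'] /(congr1 val)/= h|].
  have := eqseq_cat v v' (etrans (size_tuple w) (esym (size_tuple w'))).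
  by rewrite h eqxx => /esym/andP[/eqP/val_inj-> /eqP/val_inj->].
by rewrite card_prod !card_tuple expnD.
Qed.

(** The limit is the infimum of [a n / n], whence the second conclusion. The linear lower bound
    makes the infimum finite. *)
Lemma fekete (R : realType) (a : nat -> R) (c : R) :
  (forall n p, a (n + p)%N <= a n + a p) -> (forall n, c * n%:R <= a n) ->
  exists L : R, (fun n => n%:R^-1 * a n) @ \oo --> L /\ forall n, n%:R * L <= a n.
Proof.
move=> asub alow.
have a00 : 0 <= a 0%N by have := alow 0%N; rewrite mulr0.
pose E := [set n.+1%:R^-1 * a n.+1 | n in [set: nat]].
have lE : has_inf E.
  split; first by exists (1%:R^-1 * a 1%N), 0%N.
  exists c => _ [n _ <-]; rewrite ler_pdivlMl// mulrC; exact: alow.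
pose L := inf E; exists L.
have Ln n : n%:R * L <= a n.
  case: n => [|n]; first by rewrite mul0r.
  rewrite mulrC -ler_pdivlMr// mulrC; apply: ge_inf; first by case: lE.
  by exists n.
split=> //; apply/cvgrPdist_le => e e0.
have e2 : 0 < e / 2 by rewrite divr_gt0.
have [_ [k _ <-] hk] := inf_adherent e2 lE.
set b := k.+1%:R^-1 * a k.+1 in hk.
have [C hC] : exists C, forall n, a n <= n%:R * b + C.
  have [C C0 hC] := finite_upper_bound (fun r : 'I_k.+1 => a r - r%:R * b).
  exists C; elim/ltn_ind => n ih.
  have [nk|kn] := ltnP n k.+1.
    by have := hC (Ordinal nk); rewrite /= lerBlDl.
  rewrite -{1}(subnK kn); apply: le_trans (asub _ _) _.
  have := ih (n - k.+1)%N; rewrite ltn_subrL/= (leq_trans _ kn)// => /(_ isT).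
  have -> : a k.+1 = k.+1%:R * b by rewrite /b mulrA divff ?mul1r// pnatr_eq0.
  by rewrite natrB//; lra.
have [q hq] := exists_nat_gt (`|C| / (e / 2)).
exists q.+1 => // n /= qn.
have n0 : 0 < n%:R :> R by rewrite ltr0n; exact: leq_ltn_trans qn.
have nV : n%:R != 0 :> R by rewrite gt_eqF.
have h1 : L <= n%:R^-1 * a n by rewrite ler_pdivlMl// Ln.
have h2 : n%:R^-1 * a n <= b + e / 2.
  rewrite ler_pdivrMl// mulrDr; apply: le_trans (hC n) _; rewrite lerD2l.
  apply: le_trans (ler_norm C) _; rewrite -ler_pdivrMr//; apply: ltW.
  by apply: lt_le_trans hq _; rewrite ler_nat ltnW.
by rewrite ler_norml; rewrite -/L in hk; lra.
Qed.

(** * Upper and lower limits of bounded sequences *)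

Section Limsup.
Variables (R : realType) (u : nat -> R).
Hypothesis bu : exists C, forall n, `|u n| <= C.

Lemma bounded_seq_fun : bounded_fun u.
Proof.
case: bu => C hC; exists C; split; first exact: num_real.
by move=> x /ltW Cx n _; exact: le_trans (hC n) Cx.
Qed.

Lemma sdrop_bounded n : has_sup (sdrop u n) /\ has_inf (sdrop u n).
Proof.
case: bu => C hC; split; (split; first by exists (u n), n => //=).
  by exists C => _ [k _ <-]; apply: le_trans (hC k); exact: ler_norm.
exists (- C) => _ [k _ <-]; rewrite lerNl; apply: le_trans (hC k).
by rewrite -normrN ler_norm.
Qed.

Lemma sups_has_inf : has_inf (range (sups u)).
Proof.
split; first by exists (sups u 0%N), 0%N.
case: bu => C hC; exists (- C) => _ [k _ <-].
apply: (@le_trans _ _ (u k)).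
  rewrite lerNl; apply: le_trans (hC k); by rewrite -normrN ler_norm.
by apply: ub_le_sup; [case: (sdrop_bounded k) => -[]|exists k => /=].
Qed.

Lemma limn_sup_le n c : (forall k, (n <= k)%N -> u k <= c) -> limn_sup u <= c.
Proof.
move=> h; rewrite (limn_supE bounded_seq_fun).
apply: (@le_trans _ _ (sups u n)).
  by apply: ge_inf; [case: sups_has_inf|exists n].
apply: ge_sup; first by case: (sdrop_bounded n) => -[].
by move=> _ [k /= nk <-]; exact: h.
Qed.

Lemma limn_sup_eventually e : 0 < e ->
  exists n, forall k, (n <= k)%N -> u k <= limn_sup u + e.
Proof.
move=> e0; rewrite (limn_supE bounded_seq_fun).
have [_ [n _ <-] hn] := inf_adherent e0 sups_has_inf.
exists n => k nk; apply: le_trans (ltW hn).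
by apply: ub_le_sup; [case: (sdrop_bounded n) => -[]|exists k].
Qed.

Lemma limn_inf_le n c : (forall k, (n <= k)%N -> u k <= c) -> limn_inf u <= c.
Proof.
move=> h; rewrite (limn_infE bounded_seq_fun).
apply: ge_sup; first by exists (infs u 0%N), 0%N.
move=> _ [k _ <-]; apply: (@le_trans _ _ (u (n + k)%N)); last by apply: h; exact: leq_addr.
by apply: ge_inf; [case: (sdrop_bounded k) => _ []|exists (n + k)%N => //=; exact: leq_addl].
Qed.

Lemma limn_inf_eventually e : 0 < e ->
  exists n, forall k, (n <= k)%N -> limn_inf u - e <= u k.
Proof.
move=> e0; rewrite (limn_infE bounded_seq_fun).
have [|_ [n _ <-] hn] := @sup_adherent _ (range (infs u)) e e0.
  split; first by exists (infs u 0%N), 0%N.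
  case: bu => C hC; exists C => _ [k _ <-].
  apply: (@le_trans _ _ (u k)); last by apply: le_trans (hC k); exact: ler_norm.
  by apply: ge_inf; [case: (sdrop_bounded k) => _ []|exists k => /=].
exists n => k nk; apply: le_trans (ltW hn) _.
by apply: ge_inf; [case: (sdrop_bounded n) => _ []|exists k].
Qed.
End Limsup.

Section Pressure.
Variables (R : realType) (S : nat) (hS : (2 <= S)%N).
Variables (N : seq 'I_S -> R) (K m l : R).
Hypothesis hN : word_norm N K m l.

Lemma norm_gt0 w : 0 < N w.
Proof. by apply: lt_le_trans (wn_low hN w); rewrite exprn_gt0// (wn_m hN). Qed.

Lemma wnK_gt0 : 0 < K.
Proof. exact: lt_le_trans ltr01 (wn_K hN). Qed.

Lemma ln_l_lt0 : ln l < 0.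
Proof. by rewrite ln_lt0// (wn_l0 hN) (wn_l1 hN). Qed.

Lemma ln_m_lt0 : ln m < 0.
Proof.
pose i0 : 'I_S := Ordinal (leq_trans (isT : (0 < 2)%N) hS).
have := le_trans (wn_low hN [:: i0]) (wn_up hN [:: i0]); rewrite /= !expr1 => ml.
by rewrite ln_lt0// (wn_m hN) (le_lt_trans ml)// (wn_l1 hN).
Qed.

Definition partition_sum (n : nat) (s : R) : R := \sum_(w : n.-tuple 'I_S) N w `^ s.

Local Notation Z := partition_sum.

Lemma const_tuple n : n.-tuple 'I_S.
Proof. exact: (nseq_tuple n (Ordinal (leq_trans (isT : (0 < 2)%N) hS))). Qed.

Lemma partition_sum_gt0 n s : 0 < Z n s.
Proof.
rewrite /Z (bigD1 (const_tuple n))//= ltr_pwDl ?powR_gt0 ?norm_gt0//.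
by apply: sumr_ge0 => w _; exact: powR_ge0.
Qed.

Lemma powR_norm s w : N w `^ s = expR (s * ln (N w)).
Proof. by rewrite /powR gt_eqF ?norm_gt0. Qed.

Lemma ln_norm_sub w v : ln (N (w ++ v)) <= ln (N w) + ln (N v).
Proof.
by rewrite -lnM ?posrE ?norm_gt0// ler_ln ?posrE ?mulr_gt0 ?norm_gt0// (wn_sub hN).
Qed.

Lemma ln_norm_super w v : ln (N w) + ln (N v) <= ln K + ln (N (w ++ v)).
Proof.
rewrite -!lnM ?posrE ?norm_gt0 ?wnK_gt0//.
by rewrite ler_ln ?posrE ?mulr_gt0 ?norm_gt0 ?wnK_gt0// (wn_super hN).
Qed.

Lemma lnK_ge0 : 0 <= ln K.
Proof. by rewrite ln_ge0// (wn_K hN). Qed.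

Lemma ln_norm_low w : (size w)%:R * ln m <= ln (N w).
Proof.
rewrite mulr_natl -lnXn ?(wn_m hN)//.
by rewrite ler_ln ?posrE ?norm_gt0 ?exprn_gt0 ?(wn_m hN)// (wn_low hN).
Qed.

Lemma ln_norm_up w : ln (N w) <= (size w)%:R * ln l.
Proof.
rewrite mulr_natl -lnXn ?(wn_l0 hN)//.
by rewrite ler_ln ?posrE ?norm_gt0 ?exprn_gt0 ?(wn_l0 hN)// (wn_up hN).
Qed.

Lemma ln_norm_le0 w : ln (N w) <= 0.
Proof.
apply: le_trans (ln_norm_up w) _; rewrite mulr_ge0_le0//; exact: ltW ln_l_lt0.
Qed.

Lemma powR_norm_cat s w v : N (w ++ v) `^ s <= expR (`|s| * ln K) * (N w `^ s * N v `^ s).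
Proof.
rewrite !powR_norm -!expRD ler_expR -mulrDr.
have h1 := ln_norm_sub w v; have h2 := ln_norm_super w v; have K0 := lnK_ge0.
have [s0|s0] := leP 0 s.
  by rewrite ler_wpDl ?mulr_ge0// ler_wpM2l.
have s0' : 0 <= - s by rewrite oppr_ge0 ltW.
rewrite ltr0_norm//; by have := ler_wpM2l s0' h2; lra.
Qed.

Lemma powR_norm_cat0 s w v : 0 <= s -> N (w ++ v) `^ s <= N w `^ s * N v `^ s.
Proof.
by move=> s0; rewrite !powR_norm -!expRD ler_expR -mulrDr ler_wpM2l// ln_norm_sub.
Qed.

Lemma partition_sum_add s n p :
  Z (n + p) s <= expR (`|s| * ln K) * (Z n s * Z p s).
Proof.
rewrite /Z (tuple_cat_sum (fun w => N w `^ s)) mulr_suml mulr_sumr; apply: ler_sum => w _.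
rewrite !mulr_sumr; apply: ler_sum => v _; exact: powR_norm_cat.
Qed.

Lemma partition_sum_add0 s n p : 0 <= s -> Z (n + p) s <= Z n s * Z p s.
Proof.
move=> s0; rewrite /Z (tuple_cat_sum (fun w => N w `^ s)) mulr_suml; apply: ler_sum => w _.
rewrite !mulr_sumr; apply: ler_sum => v _; exact: powR_norm_cat0.
Qed.

Lemma ln_partition_sum_low s n : (- `|s| * - ln m) * n%:R <= ln (Z n s).
Proof.
have h0 : N (const_tuple n) `^ s <= Z n s.
  by rewrite /Z (bigD1 (const_tuple n))//= lerDl; apply: sumr_ge0 => w _; exact: powR_ge0.
rewrite -[leLHS]expRK ler_ln ?posrE ?expR_gt0 ?partition_sum_gt0//.
apply: le_trans h0; rewrite powR_norm ler_expR.
have h1 := ln_norm_low (const_tuple n); rewrite size_tuple in h1.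
have h2 := ln_norm_le0 (const_tuple n).
have [s0|s0] := leP 0 s; first by rewrite ger0_norm//; have := ler_wpM2l s0 h1; lra.
rewrite ltr0_norm//.
have : 0 <= s * ln (N (const_tuple n)) by rewrite mulr_le0// ltW.
apply: le_trans; rewrite opprK.
have : 0 <= (- s) * (n%:R * - ln m).
  by rewrite mulr_ge0 ?oppr_ge0 ?(ltW s0)// mulr_ge0// oppr_ge0 ltW// ln_m_lt0.
lra.
Qed.

Definition pres (s : R) : R := limn (fun n : nat => n%:R^-1 * ln (Z n s)).

(** For [s < 0] the sequence is subadditive only up to [|s| ln K]; adding this constant restores
    subadditivity and does not change the limit. Negative [s] occur when roots of the pressure
    equation are shown to be nonnegative. *)
Lemma pres_cvg s : (fun n : nat => n%:R^-1 * ln (Z n s)) @ \oo --> pres s.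
Proof.
pose c := `|s| * ln K; have c0 : 0 <= c by rewrite mulr_ge0// lnK_ge0.
have [||L [cL _]] := @fekete R (fun n => ln (Z n s) + c) (- `|s| * - ln m).
- move=> n p; have := partition_sum_add s n p.
  rewrite -ler_ln ?posrE ?mulr_gt0 ?expR_gt0 ?partition_sum_gt0//.
  rewrite lnM ?posrE ?mulr_gt0 ?expR_gt0 ?partition_sum_gt0// expRK.
  by rewrite lnM ?posrE ?partition_sum_gt0// -/c; lra.
- move=> n; by apply: le_trans (ln_partition_sum_low s n) _; rewrite lerDl.
suff : (fun n : nat => n%:R^-1 * ln (Z n s)) @ \oo --> L.
  by move=> h; rewrite /pres (cvg_lim _ h).
have -> : (fun n : nat => n%:R^-1 * ln (Z n s)) =
    (fun n : nat => n%:R^-1 * (ln (Z n s) + c) - n%:R^-1 * c).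
  by apply/funext => n; ring.
rewrite -[L]subr0; apply: cvgB => //; rewrite -[0](mul0r c).
apply: cvgM; last exact: cvg_cst.
by rewrite -cvg_shiftS; exact: cvg_harmonic.
Qed.

Lemma pres_low s n : 0 <= s -> n%:R * pres s <= ln (Z n s).
Proof.
move=> s0; have [||L [cL hL]] := @fekete R (fun n => ln (Z n s)) (- `|s| * - ln m).
- move=> k p; have := partition_sum_add0 k p s0.
  rewrite -ler_ln ?posrE ?mulr_gt0 ?partition_sum_gt0//.
  by rewrite lnM ?posrE ?partition_sum_gt0.
- exact: ln_partition_sum_low.
by rewrite /pres (cvg_lim _ cL).
Qed.

Lemma pres_up (s e : R) : 0 < e -> exists C, forall n, Z n s <= expR (C + n%:R * (pres s + e)).
Proof.
move=> e0; have /cvgrPdist_le/(_ e e0)[n0 _ hn] := @pres_cvg s.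
have [C C0 hC] := finite_upper_bound (fun k : 'I_n0.+1 =>
  ln (Z k s) - k%:R * (pres s + e)).
exists C => n; rewrite -[leLHS]lnK ?posrE ?partition_sum_gt0// ler_expR.
have [nn|nn] := leqP n n0; first by have := hC (Ordinal (nn : n < n0.+1)%N); rewrite /= lerBlDr.
apply: ler_wpDl => //; rewrite -ler_pdivrMl; last by rewrite ltr0n; exact: leq_ltn_trans nn.
have := hn n (ltnW nn); rewrite /= ler_norml => /andP[h1 h2]; lra.
Qed.

(** Termwise, the factor [N w ^ (s' - s)] lies between the powers of [m ^ n] and [l ^ n]. The
    pressure is therefore continuous and decreasing. *)
Lemma pres_lip s s' : s <= s' ->
  pres s + (s' - s) * ln m <= pres s' <= pres s + (s' - s) * ln l.
Proof.
move=> ss; have ds : 0 <= s' - s by rewrite subr_ge0.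
have Zl n : ln (Z n s) + n%:R * ((s' - s) * ln m) <= ln (Z n s')
         <= ln (Z n s) + n%:R * ((s' - s) * ln l).
  have trl (c x y : R) : 0 < x -> 0 < y -> (ln x + c <= ln y) = (x * expR c <= y).
    move=> x0 y0; rewrite -[c in LHS]expRK -lnM ?posrE ?expR_gt0//.
    by rewrite ler_ln ?posrE ?mulr_gt0 ?expR_gt0.
  have tru (c x y : R) : 0 < x -> 0 < y -> (ln y <= ln x + c) = (y <= x * expR c).
    move=> x0 y0; rewrite -[c in LHS]expRK -lnM ?posrE ?expR_gt0//.
    by rewrite ler_ln ?posrE ?mulr_gt0 ?expR_gt0.
  rewrite trl ?tru ?partition_sum_gt0//.
  have e w : N w `^ s' = N w `^ s * expR ((s' - s) * ln (N w)).
    by rewrite !powR_norm -expRD; congr expR; ring.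
  apply/andP; split; rewrite /Z mulr_suml; apply: ler_sum => w _; rewrite e;
    apply: ler_wpM2l; rewrite ?powR_ge0// ler_expR.
    by have := ler_wpM2l ds (ln_norm_low w); rewrite size_tuple; lra.
  by have := ler_wpM2l ds (ln_norm_up w); rewrite size_tuple; lra.
have cvgD c : (fun n : nat => n%:R^-1 * ln (Z n s) + c) @ \oo --> pres s + c.
  by apply: cvgD; [exact: pres_cvg|exact: cvg_cst].
apply/andP; split.
  apply: (ler_cvg_to (cvgD _) (@pres_cvg s')).
  exists 1%N => // n /= n1; have n0 : 0 < n%:R :> R by rewrite ltr0n.
  rewrite ler_pdivlMl// mulrDr mulrA divff ?gt_eqF// mul1r.
  by have /andP[] := Zl n.
apply: (ler_cvg_to (@pres_cvg s') (cvgD _)).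
exists 1%N => // n /= n1; have n0 : 0 < n%:R :> R by rewrite ltr0n.
rewrite ler_pdivrMl// mulrDr mulrA divff ?gt_eqF// mul1r.
by have /andP[] := Zl n.
Qed.

Lemma pres0 : pres 0 = ln S%:R.
Proof.
apply: cvg_lim => //; rewrite -(cvg_shiftn 1).
apply: (@cvg_trans _ ((fun=> ln S%:R) @ \oo)); last exact: cvg_cst.
apply: near_eq_cvg; exists 0%N => // k _ /=; rewrite ?addn1.
have : (1 <= k.+1)%N by []; move: k.+1 => n n1.
have -> : Z n 0 = S%:R ^+ n.
  rewrite /Z (eq_bigr (fun=> 1)) => [|w _]; last by rewrite powRr0.
  by rewrite sumr_const card_tuple card_ord -natrX.
rewrite lnXn; last by rewrite ltr0n; exact: ltnW.
by rewrite -[ln _ *+ n]mulr_natl mulrA mulVf ?mul1r// pnatr_eq0 -lt0n.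
Qed.

Lemma pres0_gt0 : 0 < pres 0.
Proof. by rewrite pres0 ln_gt0// ltr1n. Qed.

Lemma pres_continuous : continuous pres.
Proof.
have dist s s' : `|pres s - pres s'| <= `|s - s'| * - ln m.
  wlog ss : s s' / s <= s'.
    move=> h; have [/h//|/ltW/h] := leP s s'.
    by move: (pres s) (pres s') => p p'; rewrite distrC [X in _ <= X * _]distrC.
  have /andP[] := pres_lip ss; move: (pres s) (pres s') => p p' h1 h2.
  have ds : 0 <= s' - s by rewrite subr_ge0.
  have := mulr_ge0_le0 ds (ltW ln_l_lt0).
  rewrite (distrC s) (ger0_norm ds) ler_norml => h3; apply/andP; split; lra.
move=> s; apply/cvgrPdist_le => e e0.
have m0 : 0 < - ln m by rewrite oppr_gt0 ln_m_lt0.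
apply/nbhs_normP; exists (e / - ln m); rewrite /= ?divr_gt0// => s' /= h.
by apply: le_trans (dist _ _) _; rewrite -ler_pdivlMr// ltW.
Qed.

(* s^{+-} is the root for A = free_rate v theta and B = - Omega^{+-}. *)
Lemma pres_root (A B : R) : 0 <= A -> 0 < B ->
  (exists s, A * pres s = B * s) /\ (forall s, A * pres s = B * s -> 0 <= s).
Proof.
move=> A0 B0; split; last first.
  move=> s e; rewrite leNgt; apply/negP => s0.
  have /andP[_ h] := pres_lip (ltW s0).
  have q : (0 - s) * ln l <= 0.
    by rewrite mulr_ge0_le0 ?subr_ge0 ?(ltW s0)//; exact: ltW ln_l_lt0.
  have p0 : 0 < pres s.
    by apply: lt_le_trans pres0_gt0 _; apply: le_trans h _; rewrite gerDl.
  have := mulr_ge0 A0 (ltW p0); rewrite e.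
  by rewrite leNgt pmulr_rlt0// s0.
pose h s := A * pres s - B * s.
pose b := A * pres 0 / B.
have b0 : 0 <= b by rewrite divr_ge0 ?(ltW B0)// mulr_ge0 ?(ltW pres0_gt0).
have hb : h b <= 0.
  have /andP[_ p] := pres_lip b0; have q : (b - 0) * ln l <= 0.
    by rewrite mulr_ge0_le0 ?subr_ge0//; exact: ltW ln_l_lt0.
  have e : B * b = A * pres 0 by rewrite /b mulrCA divff ?gt_eqF// mulr1.
  rewrite /h subr_le0 e; apply: (ler_wpM2l A0); apply: le_trans p _.
  by rewrite gerDl.
have h0 : 0 <= h 0 by rewrite /h mulr0 subr0 mulr_ge0 ?(ltW pres0_gt0).
have [||s _ hs] := @IVT R h 0 b 0 b0.
- apply: continuous_subspaceT => s; apply: cvgB; (apply: cvgM; first exact: cvg_cst).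
    exact: pres_continuous.
  exact: cvg_id.
- by rewrite ge_min hb orbT le_max h0.
by exists s; apply/eqP; rewrite -subr_eq0 -/(h s) hs.
Qed.
End Pressure.

(** * The words G(M, t, theta, v) *)

Lemma ln_le_linear (R : realType) (e : R) : 0 < e ->
  exists2 C : R, 0 <= C & forall y, 0 < y -> ln y <= e * y + C.
Proof.
move=> e0; exists (`|ln e|) => // y y0.
have h : ln (e * y) <= e * y by apply: ltW; rewrite ln_sublinear// mulr_gt0.
rewrite lnM ?posrE// in h; have := ler_norm (- ln e); rewrite normrN; lra.
Qed.

Section BlockRates.
Variables (R : realType) (S : nat) (hS : (2 <= S)%N).
Variables (N : seq 'I_S -> R) (K m l : R).
Hypothesis hN : word_norm N K m l.
Variables (t : nat -> 'I_S) (v theta : R).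
Hypotheses (v0 : 0 < v) (th1 : 1 < theta).

Let th0 : 0 < theta. Proof. exact: lt_trans ltr01 th1. Qed.

Definition tau L : R := ln (N (mkseq t L)).

Lemma tau0 : tau 0 = 0.
Proof. by rewrite /tau /= (wn_nil hN) ln1. Qed.

Lemma tau_le0 L : tau L <= 0.
Proof. exact: (ln_norm_le0 hN). Qed.

Lemma mkseq_addE L p :
  mkseq t (L + p) = mkseq t L ++ [seq t i | i <- iota L p].
Proof. by rewrite /mkseq iotaD map_cat. Qed.

Lemma tau_anti L p : tau (L + p) <= tau L.
Proof.
rewrite /tau mkseq_addE; apply: le_trans (ln_norm_sub hN _ _) _.
by rewrite gerDl (ln_norm_le0 hN).
Qed.

Lemma tau_lip L p : tau L + p%:R * ln m - ln K <= tau (L + p).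
Proof.
rewrite /tau mkseq_addE; have := ln_norm_super hN (mkseq t L) [seq t i | i <- iota L p].
have := ln_norm_low hN [seq t i | i <- iota L p]; rewrite size_map size_iota; lra.
Qed.

Lemma tau_le a b (D : R) : 0 <= D -> b%:R - a%:R <= D ->
  tau a <= tau b + (ln K + D * - ln m).
Proof.
move=> D0 hD; have K0 := lnK_ge0 hN; have m0 := ln_m_lt0 hS hN.
have [ab|ba] := leqP a b.
  have := tau_lip a (b - a); rewrite subnKC// natrB// => h.
  by have := ler_wnM2r (ltW m0) hD; lra.
have := tau_anti b (a - b); rewrite subnKC ?(ltnW ba)// => h.
have : 0 <= D * - ln m by rewrite mulr_ge0// oppr_ge0 ltW.
lra.
Qed.

Lemma tau_le_small a (y : R) : y < 1 -> tau a <= tau (Num.truncn y).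
Proof.
by move=> y1; rewrite (_ : Num.truncn y = 0%N) ?tau0 ?tau_le0//; apply/truncn0Pn; rewrite -ltNge.
Qed.

(** For [x = M] and [J = p + 1], this is the logarithm of the norm of [G_word] without its last
    block, up to distortion. The argument is real because the recursion divides it by [theta]; terms
    past the last nonempty block vanish. *)
Definition gam J (x : R) : R := \sum_(k < J) tau (Num.truncn (v * x / theta ^+ k)).

Lemma gam_recl J x : gam J.+1 x = tau (Num.truncn (v * x)) + gam J (x / theta).
Proof.
rewrite /gam big_ord_recl expr0 divr1; congr (_ + _); apply: eq_bigr => k _.
by rewrite lift0 exprS invfM !mulrA; congr (tau (Num.truncn _)); ring.
Qed.

(** The number of nonempty blocks, hence of distortion factors; it is at most [1 + ln y / ln theta]
    when [y >= 1]. *)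
Definition cnt J (y : R) : R := \sum_(k < J) (1 <= y / theta ^+ k)%R%:R.

Lemma cnt_bound J (y : R) : (1 <= y -> cnt J y * ln theta <= ln theta + ln y) /\
  (y < 1 -> cnt J y = 0).
Proof.
elim: J y => [|J ih] y; rewrite /cnt ?big_ord0.
  by rewrite mul0r; split=> // y1; rewrite addr_ge0// ln_ge0// ltW.
have e : cnt J.+1 y = (1 <= y)%R%:R + cnt J (y / theta).
  rewrite /cnt big_ord_recl expr0 divr1; congr (_ + _); apply: eq_bigr => k _.
  by rewrite lift0 exprS invfM mulrA.
rewrite -/(cnt _ _) e; have [ih1 ih2] := ih (y / theta).
split=> y1; last first.
  rewrite leNgt y1 add0r ih2// ltr_pdivrMr// mul1r.
  exact: lt_trans y1 th1.
rewrite y1 mulrDl mul1r lerD2l.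
have [yt|yt] := leP 1 (y / theta).
  have y0 : 0 < y by apply: lt_le_trans y1.
  by apply: le_trans (ih1 yt) _; rewrite ln_div ?posrE// addrC subrK.
by rewrite ih2// mul0r ln_ge0.
Qed.

Lemma cnt_linear (e : R) : 0 < e -> exists2 C : R, 0 <= C &
  forall J y, 0 <= y -> cnt J y <= e * y + C.
Proof.
move=> e0; have lt0 : 0 < ln theta by rewrite ln_gt0.
have [C C0 hC] := @ln_le_linear R (e * ln theta) (mulr_gt0 e0 lt0).
exists (1 + C / ln theta) => [|J y y0]; first by rewrite addr_ge0// divr_ge0// ltW.
have [h1 h2] := cnt_bound J y; have [y1|y1] := leP 1 y; last first.
  by rewrite h2// !addr_ge0// ?divr_ge0 ?mulr_ge0 ?(ltW e0) ?(ltW lt0).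
rewrite -(ler_pM2r lt0); apply: le_trans (h1 y1) _.
have := hC y (lt_le_trans ltr01 y1).
rewrite !mulrDl mul1r divfK ?gt_eqF//; lra.
Qed.

Lemma geom_le J : \sum_(k < J) (theta ^+ k)^-1 <= theta / (theta - 1).
Proof.
have t1 : 0 < theta - 1 by rewrite subr_gt0.
suff : \sum_(k < J) (theta ^+ k)^-1 <= theta / (theta - 1) - (theta ^+ J)^-1 * (theta / (theta - 1)).
  move=> /le_trans; apply; rewrite gerBl mulr_ge0// ?divr_ge0 ?(ltW th0) ?(ltW t1)//.
  by rewrite invr_ge0 exprn_ge0// ltW.
elim: J => [|J ih]; first by rewrite big_ord0 expr0 invr1 mul1r subrr.
rewrite big_ord_recr/=; apply: le_trans (lerD ih (lexx _)) _.
rewrite le_eqVlt; apply/orP; left; apply/eqP; rewrite exprS; field.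
by rewrite expf_neq0 ?gt_eqF.
Qed.

(** A Lipschitz constant for [gam] up to a sublinear error: [- ln m * v] times the sum of the powers
    of [1 / theta]. *)
Definition gam_slope : R := - ln m * v * (theta / (theta - 1)).

Lemma gam_slope_ge0 : 0 <= gam_slope.
Proof.
rewrite !mulr_ge0 ?(ltW v0) ?invr_ge0 ?subr_ge0 ?(ltW th0) ?(ltW th1)//.
by rewrite oppr_ge0 ltW// (ln_m_lt0 hS hN).
Qed.

(** An empty block gives 0 on the right and at most 0 on the left. The cost [ln K - ln m] of
    distortion and rounding is thus paid for nonempty blocks only. *)
Lemma gam_le_raw J (x x' D : R) : 0 <= x -> 0 <= x' -> 0 <= D -> x - x' <= D ->
  gam J x' <= gam J x + gam_slope * D + (ln K - ln m) * cnt J (v * x).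
Proof.
move=> x0 x'0 D0 xD; have K0 := lnK_ge0 hN; have m0 := ln_m_lt0 hS hN.
have term k : tau (Num.truncn (v * x' / theta ^+ k)) <=
   tau (Num.truncn (v * x / theta ^+ k)) + (- ln m * v * D) * (theta ^+ k)^-1 +
   (ln K - ln m) * (1 <= v * x / theta ^+ k)%R%:R.
  have tk : 0 < theta ^+ k by rewrite exprn_gt0.
  have p : 0 <= (- ln m * v * D) * (theta ^+ k)^-1.
    by rewrite !mulr_ge0 ?(ltW v0) ?invr_ge0 ?(ltW tk)// oppr_ge0 ltW.
  have [y1|y1] := leP 1 (v * x / theta ^+ k); last first.
    by rewrite mulr0 addr0; apply: le_trans (tau_le_small _ y1) _; rewrite lerDl.
  rewrite mulr1; set y := v * x / _ in y1 *; set y' := v * x' / _.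
  have yD : y - y' <= v * D / theta ^+ k.
    by rewrite -mulrBl -mulrBr ler_wpM2r ?invr_ge0 ?(ltW tk)// ler_wpM2l// ltW.
  have y'0 : 0 <= y' by rewrite !mulr_ge0 ?invr_ge0 ?(ltW v0) ?(ltW tk).
  have b1 : (Num.truncn y)%:R - (Num.truncn y')%:R <= v * D / theta ^+ k + 1.
    have h1 : (Num.truncn y)%:R <= y by rewrite truncn_le (le_trans ler01).
    have h2 := truncnS_gt y'; rewrite -natr1 in h2; lra.
  have D'0 : 0 <= v * D / theta ^+ k + 1.
    by rewrite addr_ge0// !mulr_ge0 ?invr_ge0 ?(ltW v0) ?(ltW tk).
  by apply: le_trans (tau_le D'0 b1) _; lra.
apply: (@le_trans _ _ (\sum_(k < J) (tau (Num.truncn (v * x / theta ^+ k)) + (- ln m * v * D) * (theta ^+ k)^-1 +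
   (ln K - ln m) * (1 <= v * x / theta ^+ k)%R%:R))); first by apply: ler_sum => k _.
rewrite !big_split/= -!mulr_sumr lerD2r lerD2l.
have -> : gam_slope * D = - ln m * v * D * (theta / (theta - 1)) by rewrite /gam_slope; ring.
by rewrite ler_wpM2l ?geom_le// !mulr_ge0 ?(ltW v0)// oppr_ge0 ltW.
Qed.

Lemma gam_le (e : R) : 0 < e -> exists2 C : R, 0 <= C &
  forall J x x' D, 0 <= x -> 0 <= x' -> 0 <= D -> x - x' <= D ->
  gam J x' <= gam J x + gam_slope * D + (e * x + C).
Proof.
move=> e0; have K0 := lnK_ge0 hN; have m0 := ln_m_lt0 hS hN.
pose c := ln K - ln m; have c0 : 0 < c by rewrite /c; lra.
have [C C0 hC] := @cnt_linear (e / (c * v)) (divr_gt0 e0 (mulr_gt0 c0 v0)).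
exists (c * C) => [|J x x' D x0 x'0 D0 xD]; first by rewrite mulr_ge0// ltW.
apply: le_trans (gam_le_raw J x0 x'0 D0 xD) _; rewrite lerD2l -/c.
have := ler_wpM2l (ltW c0) (hC J (v * x) (mulr_ge0 (ltW v0) x0)).
by congr (_ <= _); field; rewrite !gt_eqF.
Qed.

Lemma gam_le0 J x : gam J x <= 0.
Proof. by apply: sumr_le0 => k _; exact: tau_le0. Qed.

Lemma gam_ge J (x : R) : 0 <= x -> (ln m * v * (theta / (theta - 1))) * x <= gam J x.
Proof.
move=> x0; have m0 := ln_m_lt0 hS hN.
apply: (@le_trans _ _ (\sum_(k < J) (ln m * v * x) * (theta ^+ k)^-1)).
  rewrite -mulr_sumr.
  have -> : ln m * v * (theta / (theta - 1)) * x = ln m * v * x * (theta / (theta - 1)) by ring.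
  by rewrite ler_wnM2l ?geom_le// -mulrA mulr_le0_ge0 ?(ltW m0)// mulr_ge0// ltW.
apply: ler_sum => k _.
have y0 : 0 <= v * x / theta ^+ k by rewrite !mulr_ge0 ?invr_ge0 ?exprn_ge0 ?(ltW th0) ?(ltW v0).
have := ln_norm_low hN (mkseq t (Num.truncn (v * x / theta ^+ k))).
rewrite size_mkseq; apply: le_trans.
have -> : ln m * v * x / theta ^+ k = (v * x / theta ^+ k) * ln m by ring.
by rewrite ler_wnM2r ?(ltW m0)// truncn_le.
Qed.

Lemma ln_norm_flatten (ws : seq (seq 'I_S)) :
  ln (N (flatten ws)) <= \sum_(w <- ws) ln (N w) <= ln (N (flatten ws)) + (size ws)%:R * ln K.
Proof.
elim: ws => [|w ws /andP[ih1 ih2]] /=.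
  by rewrite big_nil (wn_nil hN) ln1 mul0r addr0 lexx.
rewrite big_cons; have h1 := ln_norm_sub hN w (flatten ws).
have h2 := ln_norm_super hN w (flatten ws).
by apply/andP; split; [lra|rewrite -natr1; lra].
Qed.

(** The assumption makes the exponent 1 admissible, and [cnt_linear] bounds the admissible
    exponents, so that the [get] has a value. *)
Lemma G_exponentP M : theta <= v * M%:R ->
  [/\ (0 < G_exponent v theta M)%N, 1 <= v * M%:R / theta ^+ G_exponent v theta M
    & forall q : nat, (0 < q)%N -> 1 <= v * M%:R / theta ^+ q ->
      (q <= G_exponent v theta M)%N].
Proof.
move=> hM; rewrite /G_exponent; set P := (X in get X).
suff : P !=set0 by move=> /getPex.
pose b p := (0 < p)%N && (1 <= v * M%:R / theta ^+ p).
have b1 : b 1%N by rewrite /b/= ler_pdivlMr ?expr1// mul1r.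
have [C C0 hC] := @cnt_linear 1 ltr01.
have [B hB] := exists_nat_gt (v * M%:R + C).
have ub p : b p -> (p <= B)%N.
  move=> /andP[p0 hp]; rewrite -(ler_nat R); apply: le_trans (ltW hB).
  have vM : 0 <= v * M%:R by rewrite mulr_ge0// ltW.
  have := hC p (v * M%:R) vM; rewrite mul1r; apply: le_trans.
  rewrite /cnt -[p in p%:R]card_ord -sumr_const; apply: ler_sum => k _.
  rewrite (le_trans hp)// ler_wpM2l// lef_pV2 ?posrE ?exprn_gt0//.
  by rewrite ler_eXn2l// ltnW.
have [p /andP[p0 hp] pmax] := ex_maxnP (ex_intro b 1%N b1) ub.
by exists p; split=> // q q0 hq; apply: pmax; rewrite /b q0.
Qed.

Lemma G_word_gam M : ln (N (G_word t v theta M)) <=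
    gam (G_exponent v theta M).+1 M%:R + tau (Num.truncn (theta * v * M%:R)) <=
    ln (N (G_word t v theta M)) + (G_exponent v theta M).+2%:R * ln K.
Proof.
set p := G_exponent v theta M.
pose ws := [seq block t 1 (Num.truncn (v * M%:R / theta ^+ k)) | k <- rev (iota 0 p.+1)].
pose b := block t 1 (Num.truncn (theta * v * M%:R)).
have -> : G_word t v theta M = flatten (rcons ws b).
  by rewrite flatten_rcons.
have := ln_norm_flatten (rcons ws b).
rewrite size_rcons size_map size_rev size_iota -cats1 big_cat big_seq1/=.
suff -> : \sum_(w <- ws) ln (N w) = gam p.+1 M%:R by rewrite /b blockE.
rewrite /ws big_map (perm_big (iota 0 p.+1)) ?perm_rev//=.
rewrite /gam -(big_mkord xpredT (fun k => tau (Num.truncn (v * M%:R / theta ^+ k)))).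
rewrite /index_iota subn0; apply: eq_bigr => k _.
by rewrite blockE.
Qed.

Lemma G_exponent_linear (e : R) : 0 < e -> exists2 C : R, 0 <= C &
  forall M, theta <= v * M%:R -> (G_exponent v theta M).+2%:R <= e * M%:R + C.
Proof.
move=> e0; have [C C0 hC] := @cnt_linear (e / v) (divr_gt0 e0 v0).
exists (C + 1) => [|M hM]; first by rewrite addr_ge0.
have [p0 hp _] := G_exponentP hM; set p := G_exponent _ _ _ in p0 hp *.
have vM : 0 <= v * M%:R by rewrite mulr_ge0// ltW.
have := hC p.+1 (v * M%:R) vM; rewrite mulrA divfK ?gt_eqF// addrA -natr1 lerD2r.
apply: le_trans; have -> : p.+1%:R = \sum_(k < p.+1) (1 : R) by rewrite sumr_const card_ord.
apply: ler_sum => k _.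
rewrite (le_trans hp)// ler_wpM2l// lef_pV2 ?posrE ?exprn_gt0//.
by rewrite ler_eXn2l// -ltnS.
Qed.

Definition word_rate M : R := M%:R^-1 * ln (N (G_word t v theta M)).

Lemma word_rate_low : exists C M0, forall M, (M0 <= M)%N -> C <= word_rate M.
Proof.
have [C C0 hC] := @G_exponent_linear 1 ltr01.
have K0 := lnK_ge0 hN; have m0 := ln_m_lt0 hS hN.
have [M0 hM0] := exists_nat_gt (theta / v).
pose A := ln m * v * (theta / (theta - 1)) + theta * v * ln m.
exists (A - (1 + C) * ln K), M0.+1 => M hM.
have M1 : (1 : R) <= M%:R by rewrite ler1n; exact: leq_trans hM.
have Mp : 0 < M%:R :> R by apply: lt_le_trans M1.
have hMt : theta <= v * M%:R.
  rewrite mulrC -ler_pdivrMr//; apply: le_trans (ltW hM0) _; rewrite ler_nat; exact: ltnW.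
rewrite /word_rate ler_pdivlMl//.
have /andP[_ h] := G_word_gam M.
have h1 := gam_ge (G_exponent v theta M).+1 (ltW Mp).
have y0 : 0 <= theta * v * M%:R by rewrite !mulr_ge0 ?(ltW th0) ?(ltW v0).
have h2 : theta * v * M%:R * ln m <= tau (Num.truncn (theta * v * M%:R)).
  have := ln_norm_low hN (mkseq t (Num.truncn (theta * v * M%:R))).
  by rewrite size_mkseq; apply: le_trans; rewrite ler_wnM2r ?(ltW m0)// truncn_le.
have h3 := ler_wpM2r K0 (hC M hMt).
have h4 : C * ln K <= C * ln K * M%:R by rewrite ler_peMr// mulr_ge0.
rewrite /A; lra.
Qed.

(** The last block alone has length about [theta v M]. This gives the sign of [Omega] that
    [pres_root] asks for. *)
Lemma word_rate_up : exists2 c : R, c < 0 &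
  exists M0, forall M, (M0 <= M)%N -> word_rate M <= c.
Proof.
have l0 := ln_l_lt0 hN.
exists (theta * v / 2 * ln l).
  by rewrite pmulr_rlt0// divr_gt0// mulr_gt0.
have [M0 hM0] := exists_nat_gt (2 / (theta * v)).
exists M0.+1 => M hM; have Mp : 0 < M%:R :> R by rewrite ltr0n; exact: leq_ltn_trans hM.
have tv : 0 < theta * v by rewrite mulr_gt0.
have big : 2 < M%:R * (theta * v).
  by rewrite -ltr_pdivrMr//; apply: lt_le_trans hM0 _; rewrite ler_nat; exact: ltnW.
rewrite /word_rate ler_pdivrMl//.
have /andP[h _] := G_word_gam M.
have h1 := gam_le0 (G_exponent v theta M).+1 M%:R.
have h2 := ln_norm_up hN (mkseq t (Num.truncn (theta * v * M%:R))).
rewrite size_mkseq -/(tau _) in h2.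
have h3 := truncnS_gt (theta * v * M%:R); rewrite -natr1 in h3.
have h4 : theta * v / 2 * M%:R <= (Num.truncn (theta * v * M%:R))%:R by lra.
have := ler_wnM2r (ltW l0) h4; lra.
Qed.

Lemma word_rate_bounded : exists C, forall M, `|word_rate M| <= C.
Proof.
have [a [M1 h1]] := word_rate_low; have [b _ [M2 h2]] := word_rate_up.
have [C C0 hC] := finite_upper_bound (fun k : 'I_(M1 + M2) => `|word_rate k|).
exists (C + `|a| + `|b|) => M; have [hM|hM] := ltnP M (M1 + M2).
  by apply: le_trans (hC (Ordinal hM)) _; rewrite -addrA lerDl addr_ge0.
have q1 := h1 M (leq_trans (leq_addr _ _) hM).
have q2 := h2 M (leq_trans (leq_addl _ _) hM).
have := ler_norm b; have := ler_norm (- a); rewrite normrN => n1 n2.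
have na := normr_ge0 a; have nb := normr_ge0 b.
by rewrite ler_norml; apply/andP; split; lra.
Qed.

Lemma rate_sup_lt0 : limn_sup word_rate < 0.
Proof.
have [c c0 [M0 h]] := word_rate_up.
exact: le_lt_trans (limn_sup_le word_rate_bounded h) c0.
Qed.

Lemma rate_inf_lt0 : limn_inf word_rate < 0.
Proof.
have [c c0 [M0 h]] := word_rate_up.
exact: le_lt_trans (limn_inf_le word_rate_bounded h) c0.
Qed.
End BlockRates.

(** * Upper bound *)

Lemma sum_tuple_eq (V : nmodType) (T : finType) (F : seq T -> V) n n' : n = n' ->
  \sum_(w : n.-tuple T) F w = \sum_(w : n'.-tuple T) F w.
Proof. by move->. Qed.

Section Recursion.
Variables (R : realType) (S : nat).
Variables (N : seq 'I_S -> R) (K m l : R).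
Hypothesis hN : word_norm N K m l.
Variables (t : nat -> 'I_S).

(** The letters of [x] do not decide whether its end is a record; hence the quantifier over the
    regular sequences that begin with [x]. *)
Definition record_word (u w : R) (N1 : nat) (x : seq 'I_S) : bool :=
  `[< exists e, [/\ regular e t u w N1, is_record e t (size x), (0 < size x)%N &
       x = mkseq e (size x)] >].

Definition record_sum (u w : R) N1 (s : R) M : R :=
  \sum_(x : M.-tuple 'I_S | record_word u w N1 x) N x `^ s.

Lemma record_sum_ge0 u w N1 s M : 0 <= record_sum u w N1 s M.
Proof. by apply: sumr_ge0 => x _; exact: powR_ge0. Qed.

Lemma record_sum_split u w N1 s M k : 0 <= s -> (k + Num.truncn (u * M.-1%:R) <= M)%N ->
  \sum_(x : M.-tuple 'I_S | record_word u w N1 (take k x) &&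
      (take (Num.truncn (u * M.-1%:R)) (drop k x) ==
        mkseq t (Num.truncn (u * M.-1%:R)))) N x `^ s <=
  record_sum u w N1 s k * N (mkseq t (Num.truncn (u * M.-1%:R))) `^ s *
    partition_sum N (M - k - Num.truncn (u * M.-1%:R)) s.
Proof.
move=> s0; set L := Num.truncn _ => kLM.
pose F x := if record_word u w N1 (take k x) && (take L (drop k x) == mkseq t L)
  then N x `^ s else 0.
have -> : \sum_(x : M.-tuple 'I_S | record_word u w N1 (take k x) &&
      (take L (drop k x) == mkseq t L)) N x `^ s = \sum_(x : M.-tuple 'I_S) F x.
  by rewrite big_mkcond.
have eM : M = (k + (L + (M - k - L)))%N by clear -kLM; lia.
rewrite (sum_tuple_eq F eM) tuple_cat_sum /record_sum [in leRHS]big_mkcond/= !mulr_suml; apply: ler_sum => a _.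
rewrite (tuple_cat_sum (fun z => F (a ++ z))).
have E (b : L.-tuple 'I_S) z : F (a ++ (b ++ z)) =
   if record_word u w N1 a && (b == mkseq t L :> seq _) then N (a ++ (b ++ z)) `^ s else 0.
  by rewrite /F take_size_cat ?size_tuple// drop_size_cat ?size_tuple// take_size_cat ?size_tuple.
case: (boolP (record_word u w N1 a)) => ha; last first.
  rewrite !mul0r big1// => b _; rewrite big1// => z _.
  by rewrite E (negPf ha).
have b0P : size (mkseq t L) == L by rewrite size_mkseq.
rewrite (bigD1 (Tuple b0P))//= [X in _ + X]big1 ?addr0 => [|b bt]; last first.
  rewrite big1// => z _; rewrite E ha/=; case: eqP => // e.
  by case/eqP: bt; apply: val_inj.
rewrite mulr_sumr; apply: ler_sum => z _.
rewrite (E (Tuple b0P)) ha eqxx/=.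
apply: le_trans (powR_norm_cat0 hN _ _ s0) _; rewrite -mulrA ler_wpM2l ?powR_ge0//.
exact: (powR_norm_cat0 hN).
Qed.

(** The step back, applied to a sequence that witnesses [x], yields an earlier record [k], and the
    same sequence makes [take k x] a record word. After [k] come a copy of [t] and free letters up
    to [M]. *)
Lemma record_sum_rec (ht : G_set t) : exists N0 : nat, forall u w N1 s M, 0 <= s ->
  (N1 < M)%N -> (N0 <= Num.truncn (u * M.-1%:R))%N ->
  record_sum u w N1 s M <=
  \sum_(k < M | (k + Num.truncn (u * M.-1%:R) <= M)%N &&
      ((Num.truncn (u * M.-1%:R))%:R <= w * k%:R + N1%:R))
    record_sum u w N1 s k * N (mkseq t (Num.truncn (u * M.-1%:R))) `^ s *
    partition_sum N (M - k - Num.truncn (u * M.-1%:R)) s.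
Proof.
have [N0 hback] := back_step R ht; exists N0 => u w N1 s M s0 NM hN0.
set L := Num.truncn _ in hN0 *.
apply: (@le_trans _ _ (\sum_(k < M | (k + L <= M)%N && (L%:R <= w * k%:R + N1%:R))
   \sum_(x : M.-tuple 'I_S | record_word u w N1 (take k x) &&
      (take L (drop k x) == mkseq t L)) N x `^ s)); last first.
  by apply: ler_sum => k /andP[kL _]; exact: record_sum_split.
rewrite (exchange_big_dep xpredT)//= [leLHS]big_mkcond/=; apply: ler_sum => x _.
case: ifPn => [/asboolP[e [re rec x0 xe]]|_]; last first.
  by apply: sumr_ge0 => k _; exact: powR_ge0.
rewrite size_tuple in rec x0 xe.
have [k [/andP[k0 kM] rk hk kL hw]] := hback e u w N1 M re rec NM hN0.
rewrite -/L in hk kL hw.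
rewrite (bigD1 (Ordinal kM))/=; last first.
  rewrite kL hw/=; apply/andP; split.
    have tk : take k x = mkseq e k by rewrite xe /mkseq -map_take take_iota (minn_idPl (ltnW kM)).
    by apply/asboolP; exists e; rewrite tk size_mkseq; split.
  apply/eqP; rewrite xe /mkseq -map_drop -map_take drop_iota take_iota add0n.
  rewrite (minn_idPl _); last by rewrite leq_subRL ?(ltnW kM).
  rewrite -[k in iota k]addn0 iotaDl -map_comp; apply/eq_in_map => i.
  by rewrite mem_iota => /andP[_ iL]; exact: hk.
by rewrite lerDl; apply: sumr_ge0 => *; exact: powR_ge0.
Qed.
End Recursion.

Section Growth.
Variables (R : realType) (S : nat) (hS : (2 <= S)%N).
Variables (N : seq 'I_S -> R) (K m l : R).
Hypothesis hN : word_norm N K m l.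
Variables (t : nat -> 'I_S) (ht : G_set t) (v theta : R).
Hypotheses (v0 : 0 < v) (v1 : v < 1) (th1 : 1 < theta).

Let th0 : 0 < theta. Proof. exact: lt_trans ltr01 th1. Qed.

(* Asymptotic proportion of the first M letters left free by disjoint blocks of
   lengths v M, v M / theta, v M / theta ^ 2, ... *)
Definition free_rate : R := 1 - v * (theta / (theta - 1)).

Local Notation A := free_rate.
Local Notation gs := (gam_slope m v theta).
Local Notation tau := (tau N t).
Local Notation gam := (gam N t v theta).

Hypothesis A0 : 0 <= A.
Variables (sm Pm : R).
Hypotheses (sm0 : 0 <= sm) (Pm0 : 0 <= Pm).

Definition growth_const : R := 2 / v *
  (Pm * (2 + 5 / (theta - 1)) + sm * ((5 * gs / (theta * v) + 2) + (1 - 2 * ln m)) + 3).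

Lemma growth_const_ge0 : 0 <= growth_const.
Proof.
have m0 := ln_m_lt0 hS hN; have g0 := gam_slope_ge0 hS hN v0 th1.
have t1 : 0 < theta - 1 by rewrite subr_gt0.
have h1 : 0 <= 5 / (theta - 1) by rewrite divr_ge0// ltW.
have tv : 0 < theta * v by rewrite mulr_gt0.
have h2 : 0 <= 5 * gs / (theta * v) by rewrite divr_ge0 ?(ltW tv)// mulr_ge0.
rewrite /growth_const; apply: mulr_ge0; first by rewrite divr_ge0// ltW.
have : 0 <= Pm * (2 + 5 / (theta - 1)) by rewrite mulr_ge0//; lra.
have : 0 <= sm * ((5 * gs / (theta * v) + 2) + (1 - 2 * ln m)) by rewrite mulr_ge0//; lra.
lra.
Qed.

(* The induction step of record_growth: x is a record, k the record that back_step
   finds before it, and L the length of the match of t at k; the error terms of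
   order de * x are absorbed by growth_const * de * (x - k). *)
Lemma growth_step (x k L gk gx tx tL Cg Cz lx s P de : R) :
  0 <= x -> 0 < de -> de <= v / 4 -> 0 <= s <= sm -> 0 <= P <= Pm ->
  v * x - 2 * de * x <= L -> x / theta - 5 * de * x / (theta * v) <= k -> k + L <= x ->
  gk <= gx + gs * (5 * de * x / (theta * v)) + (de * (x / theta) + Cg) -> Cg <= de * x ->
  tL <= tx + (ln K + 2 * de * x * - ln m) -> ln K <= de * x ->
  Cz <= de * x -> lx <= 2 * de * x ->
  A * k * P + s * gk + growth_const * de * k + s * tL + Cz + (x - k - L) * P + lx
  <= A * x * P + s * (tx + gx) + growth_const * de * x.
Proof.
move=> x0 de0 dev /andP[s0 ssm] /andP[P0 PPm] f1 f2 kL g3 hCg g4 hK hCz hlx.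
have m0 := ln_m_lt0 hS hN; have g0 := gam_slope_ge0 hS hN v0 th1.
have t1 : 0 < theta - 1 by rewrite subr_gt0.
have C0 := growth_const_ge0.
have dx0 : 0 <= de * x by rewrite mulr_ge0// ltW.
have B0 : 0 < v * (theta / (theta - 1)) by rewrite mulr_gt0// divr_gt0.
have h5 : x - L - (1 - A) * k <= A * x + (2 + 5 / (theta - 1)) * (de * x).
  have := ler_wpM2l (ltW B0) f2.
  have -> : v * (theta / (theta - 1)) * (x / theta - 5 * de * x / (theta * v)) =
    v / (theta - 1) * x - 5 / (theta - 1) * (de * x).
    by field; rewrite !gt_eqF.
  have e : A = 1 - v - v / (theta - 1) by rewrite /A; field; rewrite gt_eqF.
  have e' : 1 - A = v * (theta / (theta - 1)) by rewrite /A; ring.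
  rewrite e' e; lra.
have {h5}h5 := ler_wpM2r P0 h5.
have p5 : 0 <= (2 + 5 / (theta - 1)) * (de * x).
  by rewrite mulr_ge0// addr_ge0// divr_ge0// ltW.
have h5' := ler_wpM2l p5 PPm.
have xth : x / theta <= x by rewrite ler_pdivrMr// ler_peMr// ltW.
have h3 : gk <= gx + (5 * gs / (theta * v) + 2) * (de * x).
  have := ler_wpM2l (ltW de0) xth.
  have -> : (5 * gs / (theta * v) + 2) * (de * x) =
    gs * (5 * de * x / (theta * v)) + 2 * (de * x) by ring.
  lra.
have {h3}h3 := ler_wpM2l s0 h3.
have h4 : tL <= tx + (1 - 2 * ln m) * (de * x) by lra.
have {h4}h4 := ler_wpM2l s0 h4.
have p34 : 0 <= ((5 * gs / (theta * v) + 2) + (1 - 2 * ln m)) * (de * x).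
  have tv : 0 < theta * v by rewrite mulr_gt0.
  rewrite mulr_ge0//; have : 0 <= 5 * gs / (theta * v).
    by rewrite divr_ge0 ?(ltW tv)// mulr_ge0.
  lra.
have h34 := ler_wpM2r p34 ssm.
have Lv : v / 2 * x <= L.
  apply: le_trans f1; have := ler_wpM2r x0 dev; lra.
have kx : k <= x - v / 2 * x by lra.
have h6 := ler_wpM2l (mulr_ge0 C0 (ltW de0)) kx.
have hC : growth_const * (v / 2) = Pm * (2 + 5 / (theta - 1)) +
    sm * ((5 * gs / (theta * v) + 2) + (1 - 2 * ln m)) + 3.
  by rewrite /growth_const; field; rewrite !gt_eqF.
have h6' : growth_const * de * (x - v / 2 * x) =
  growth_const * de * x - (growth_const * (v / 2)) * (de * x) by ring.
rewrite h6' hC in h6.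
lra.
Qed.

(** Strong induction on [M] through [record_sum_rec]. Each of the [M] possible positions of the
    previous record contributes at most [1 / M] of the bound, which is [growth_step] with
    [lx = ln M]. The number of terms [J] drops by one at each step back, so it is general in the
    induction, and [B] serves all [J]. *)
Lemma record_growth (de s P Cz : R) N1 : 0 < de -> de <= v / 4 -> 0 <= s <= sm ->
  0 <= P <= Pm -> (forall n, partition_sum N n s <= expR (Cz + n%:R * P)) ->
  exists B, forall J M,
    record_sum N t ((1 - de) * v) ((theta + 2 * de) * v) N1 s M <=
    expR (B + A * M%:R * P + s * gam J M%:R + growth_const * de * M%:R).
Proof.
move=> de0 dev ssm PPm hZ; set u := (1 - de) * v; set w := (theta + 2 * de) * v.
have /andP[s0 _] := ssm; have /andP[P0 _] := PPm.
have v1' := v1; have v0' := v0; have th1' := th1.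
have de1 : de <= 1 by lra.
have m0 := ln_m_lt0 hS hN; have K0 := lnK_ge0 hN.
have C0 := growth_const_ge0.
have [N0 hrec] := record_sum_rec hN ht.
have [Cg Cg0 hCg] := gam_le hS hN t v0 th1 de0.
have [Cl Cl0 hCl] := ln_le_linear de0.
have [q hq] := exists_nat_gt ((`|Cz| + ln K + Cg + Cl + N1%:R + 2) / de).
have [q' hq'] := exists_nat_gt ((N0%:R + 1) / (v / 4)).
pose N2 := (N1 + q + q').+1.
have gl J M : - (gs * M%:R) <= gam J M%:R.
  have := gam_ge hS hN t v0 th1 J (ler0n R M).
  by rewrite /gs !mulNr opprK.
have [B hB] : exists B, forall J M, (M < N2)%N ->
    record_sum N t u w N1 s M <= expR (B + A * M%:R * P + s * gam J M%:R + growth_const * de * M%:R).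
  have [B B00 hB] := finite_upper_bound (fun M : 'I_N2 =>
    ln (1 + record_sum N t u w N1 s M) + s * (gs * M%:R)).
  exists B => J M MN; have r0 := record_sum_ge0 N t u w N1 s M.
  apply: (@le_trans _ _ (expR (ln (1 + record_sum N t u w N1 s M)))).
    by rewrite lnK ?posrE; lra.
  rewrite ler_expR; have := hB (Ordinal MN); rewrite /=.
  have := ler_wpM2l s0 (gl J M).
  have : 0 <= A * M%:R * P by rewrite !mulr_ge0.
  have : 0 <= growth_const * de * M%:R by exact: (mulr_ge0 (mulr_ge0 C0 (ltW de0)) (ler0n R M)).
  lra.
have gs0 : 0 <= gs := gam_slope_ge0 hS hN v0 th1.
exists B => J M; elim/ltn_ind: M J => M ih J.
have [MN|NM] := ltnP M N2; first exact: hB.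
(* One term has to be split off by [gam_recl]. The case of no term follows from that of one, since
   [gam] is nonpositive. *)
wlog J1 : J / (0 < J)%N.
  move=> h; case: J => [|J]; last exact: h.
  apply: le_trans (h 1%N isT) _; rewrite ler_expR lerD2r lerD2l ler_wpM2l//.
  by rewrite /gam big_ord0; exact: (gam_le0 hN t v theta 1%N).
case: J J1 => // J _.
have M0 : (0 < M)%N by apply: leq_trans NM.
set x : R := M%:R.
have x1 : 1 <= x by rewrite /x ler1n.
have x0 : 0 < x by apply: lt_le_trans x1.
have hx : `|Cz| + ln K + Cg + Cl + N1%:R + 2 <= de * x.
  rewrite mulrC -ler_pdivrMr//; apply: le_trans (ltW hq) _; rewrite ler_nat.
  by clear -NM; rewrite /N2 in NM; lia.
have hx' : N0%:R + 1 <= v / 4 * x.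
  rewrite mulrC -ler_pdivrMr ?divr_gt0//; apply: le_trans (ltW hq') _; rewrite ler_nat.
  by clear -NM; rewrite /N2 in NM; lia.
have nCz : 0 <= `|Cz| by [].
have nCz' := ler_norm Cz.
have n1 : 0 <= N1%:R :> R by [].
have n0 : 0 <= N0%:R :> R by [].
have u0 : 0 <= u by rewrite mulr_ge0 ?(ltW v0)// subr_ge0.
set L := Num.truncn (u * M.-1%:R).
have hL : u * M.-1%:R < L%:R + 1 by rewrite natr1 truncnS_gt.
have MM : M.-1%:R = x - 1 by rewrite /x -[in RHS](prednK M0) -natr1 addrK.
have f1 : v * x - 2 * de * x <= L%:R.
  rewrite MM /u in hL; have : de * x * v <= de * x by rewrite ler_piMr ?mulr_ge0 ?(ltW de0) ?(ltW x0)// ltW.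
  have : 0 <= de * v by rewrite mulr_ge0// ltW.
  lra.
have N0L : (N0 <= L)%N.
  rewrite -(ler_nat R); apply: le_trans f1.
  have := ler_wpM2r (ltW x0) dev; lra.
apply: le_trans (hrec u w N1 s M s0 _ N0L) _; first by clear -NM; rewrite /N2 in NM; lia.
rewrite -/L; set T := expR _.
apply: (@le_trans _ _ (\sum_(k < M) (T / x))); last first.
  rewrite sumr_const card_ord -[_ *+ M]mulr_natl -/x mulrCA divff ?mulr1//.
  by rewrite gt_eqF.
have T0 : 0 < T by exact: expR_gt0.
rewrite [leLHS]big_mkcond; apply: ler_sum => k _.
case: ifPn => [/andP[kL hw]|_]; last by rewrite divr_ge0// ltW.
have := ih k (ltn_ord k) J; set X := expR _ => hX.
have hX0 : 0 <= N (mkseq t L) `^ s by exact: powR_ge0.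
apply: (@le_trans _ _ (X * N (mkseq t L) `^ s * expR (Cz + (M - k - L)%:R * P))).
  apply: ler_pM; rewrite ?mulr_ge0 ?record_sum_ge0//.
  - by apply: sumr_ge0 => *; exact: powR_ge0.
  - by rewrite ler_wpM2r.
rewrite (powR_norm hN) -/(tau L) /X -!expRD ler_pdivlMr// -[x in leLHS]lnK ?posrE// -expRD ler_expR.
have eML : (M - k - L)%:R = x - k%:R - L%:R.
  rewrite /x natrB; last by clear -kL; lia.
  by rewrite natrB// ltnW.
have kLr : k%:R + L%:R <= x by rewrite /x -natrD ler_nat.
have k0 : 0 <= k%:R :> R by [].
have xth : 0 <= x / theta by rewrite divr_ge0// ltW.
have tv : 0 < theta * v by rewrite mulr_gt0.
have f2 : x / theta - 5 * de * x / (theta * v) <= k%:R.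
  have -> : x / theta - 5 * de * x / (theta * v) = (v * x - 5 * de * x) / (theta * v).
    by field; rewrite !gt_eqF.
  rewrite ler_pdivrMr//.
  have kx : k%:R <= x by rewrite /x ler_nat ltnW.
  have h1 : de * v * k%:R <= de * x.
    rewrite -mulrA ler_wpM2l ?(ltW de0)//; apply: le_trans kx.
    by rewrite ler_piMl// ltW.
  rewrite /w in hw; lra.
have D0 : 0 <= 5 * de * x / (theta * v) by rewrite divr_ge0 ?mulr_ge0 ?(ltW de0) ?(ltW x0)// ltW.
have hg : x / theta - k%:R <= 5 * de * x / (theta * v) by lra.
have g3 := hCg J (x / theta) k%:R _ xth k0 D0 hg.
have d2 : 0 <= 2 * de * x by rewrite !mulr_ge0 ?(ltW de0) ?(ltW x0).
have hb : (Num.truncn (v * x))%:R - L%:R <= 2 * de * x.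
  have : (Num.truncn (v * x))%:R <= v * x by rewrite truncn_le mulr_ge0 ?(ltW v0) ?(ltW x0).
  lra.
have g4 := tau_le hS hN t d2 hb.
rewrite gam_recl eML.
have hlx : ln x <= 2 * de * x by have := hCl x x0; lra.
have := @growth_step x k%:R L%:R (gam J k%:R) (gam J (x / theta)) (tau (Num.truncn (v * x))) (tau L)
  Cg Cz (ln x) s P de (ltW x0) de0 dev ssm PPm f1 f2 kLr g3 _ g4 _ _ hlx.
have a1 : Cg <= de * x by lra.
have a2 : ln K <= de * x by lra.
have a3 : Cz <= de * x by lra.
move=> /(_ a1 a2 a3); lra.
Qed.
End Growth.

Lemma decay_arith (R : realType) (A x P de s B C1 g tu D k Om sp sm : R) :
  s * (g + tu) <= s * (x * Om + D * (de * x) + k) ->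
  s * (D * (de * x)) <= sm * (D * (de * x)) ->
  A * P * x <= - sp * Om * x -> A * (de * x) <= de * x ->
  s * (x * Om) = sp * Om * x - (1 + sm * D + C1 + 1) * (de * x) ->
  B + A * x * (P + de) + s * g + C1 * de * x + s * tu <= B + s * k - de * x.
Proof. by lra. Qed.

(** Raising the exponent by [c * de] gains a factor of about [exp (c de Omega^+ M)]. As
    [Omega^+ < 0], a large [c] outweighs all errors of order [de * M] and leaves a decay. *)
Lemma record_decay (R : realType) (S : nat) (hS : (2 <= S)%N)
    (N : seq 'I_S -> R) (K m l : R) (hN : word_norm N K m l)
    (t : nat -> 'I_S) (ht : G_set t) (v theta sp : R) :
  0 < v -> v < 1 -> 1 < theta -> 0 <= free_rate v theta -> 0 <= sp ->
  free_rate v theta * pres N sp = - sp * limn_sup (word_rate N t v theta) ->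
  exists c de0 : R, [/\ 0 < de0, de0 <= 1 / 4 & forall de, 0 < de -> de < de0 ->
    0 < sp + c * de /\ forall N1, exists B, forall M,
      record_sum N t ((1 - de) * v) ((theta + 2 * de) * v) N1 (sp + c * de) M *
      N (mkseq t (Num.truncn ((theta - 2 * de) * v * M%:R))) `^ (sp + c * de) <=
      expR (B - de * M%:R)].
Proof.
move=> v0 v1 th1 A0 sp0 hsp.
have A1 : free_rate v theta <= 1.
  by rewrite /free_rate lerBlDr lerDl mulr_ge0 ?(ltW v0)// divr_ge0 ?subr_ge0 ?ltW// (lt_trans ltr01).
have Om0 := rate_sup_lt0 hS hN t v0 th1.
have hOm := limn_sup_eventually (word_rate_bounded hS hN t v0 th1).
move: Om0 hOm hsp; move: (limn_sup _) => Om Om0 hOm hsp.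
have m0 := ln_m_lt0 hS hN; have K0 := lnK_ge0 hN.
have p0 := pres0_gt0 hS N.
have [sm sm0 smE] : exists2 sm, 0 <= sm & sm = sp + 1 by exists (sp + 1); rewrite ?addr_ge0.
have [Pm Pm0 PmE] : exists2 Pm, 0 <= Pm & Pm = pres N 0 + 1.
  by exists (pres N 0 + 1); rewrite ?addr_ge0// ltW.
have := growth_const_ge0 hS hN v0 th1 sm0 Pm0.
have := record_growth hS hN ht v0 v1 th1 A0 sm0 Pm0.
move: A0 A1 hsp; move: (growth_const _ _ _ _ _) (free_rate v theta).
move=> C1 A A0 A1 hsp hgr C10.
(* Errors per [de * M]: 1 from the upper limit, [ln K] from the number of blocks of [G_word], and
   [- 2 ln m] from shortening the last block. *)
have [D DE] : exists D, D = 1 + ln K - 2 * ln m by exists (1 + ln K - 2 * ln m).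
have D0 : 0 <= D by rewrite DE; clear -K0 m0; lra.
(* The summands pay for the [de] added to the pressure, for the comparison with [G_word] and for
   [record_growth]. The further 1 in [c] is the decay that remains. *)
pose C3 := 1 + sm * D + C1.
have C30 : 0 <= C3 by rewrite /C3 !addr_ge0// mulr_ge0.
pose c := (C3 + 1) / - Om.
have c0 : 0 < c by rewrite divr_gt0 ?oppr_gt0//; clear -C30; lra.
have cOm : c * - Om = C3 + 1 by rewrite /c divfK// gt_eqF// oppr_gt0.
(* The bounds are those of [record_growth] and [coding_null]; [c^-1] keeps the exponent below
   [sm = sp + 1]. *)
pose de0 := Num.min (v / 4) (Num.min (1 / 4) c^-1).
exists c, de0; split.
- by rewrite !lt_min invr_gt0 c0 !divr_gt0.
- by rewrite !ge_min lexx orbT.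
move=> de dp; rewrite !lt_min => /andP[dv /andP[d4 dc]].
set s := sp + c * de.
have cd0 : 0 < c * de by rewrite mulr_gt0.
have cd1 : c * de <= 1 by rewrite mulrC -ler_pdivlMr// div1r ltW.
have s0 : 0 < s by rewrite /s; clear -sp0 cd0; lra.
split=> // N1.
have ssm : 0 <= s <= sm by rewrite (ltW s0)/= /s smE lerD2l.
(* The growth estimate wants a nonnegative pressure. When [pres N s] is negative,
   [A * 0 <= - sp * Om] still holds. *)
pose Pp := Num.max (pres N s) 0.
have Pp0 : 0 <= Pp by rewrite le_max lexx orbT.
have l0 := ln_l_lt0 hN.
have pdec a b : a <= b -> pres N b <= pres N a.
  move=> ab; have /andP[_ h] := pres_lip hS hN ab.
  by apply: le_trans h _; rewrite gerDl mulr_ge0_le0 ?subr_ge0// ltW.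
have PpPm : Pp <= pres N 0.
  by rewrite ge_max (ltW p0) andbT pdec// ltW.
have APp : A * Pp <= - sp * Om.
  rewrite /Pp; have [h|h] := lerP (pres N s) 0.
    by rewrite mulr0 mulNr -mulrN mulr_ge0// oppr_ge0 ltW.
  by rewrite -hsp; apply: (ler_wpM2l A0); apply: pdec; rewrite /s lerDl ltW.
have [Cz hZ] := pres_up hS hN s dp.
have hZ' n : partition_sum N n s <= expR (Cz + n%:R * (Pp + de)).
  apply: le_trans (hZ n) _; rewrite ler_expR lerD2l ler_wpM2l// lerD2r.
  by rewrite le_max lexx.
have PPm : 0 <= Pp + de <= Pm by rewrite addr_ge0 ?(ltW dp)//= PmE lerD//; clear -d4; lra.
have [B hB] := hgr de s (Pp + de) Cz N1 dp (ltW dv) ssm PPm hZ'.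
have [C' C'0 hC'] := G_exponent_linear v0 th1 dp.
have [M1 hM1] := hOm de dp.
have [M2 hM2] := exists_nat_gt (theta / v).
pose Q := s * (C' * ln K + ln K - ln m).
pose E M := B + A * M%:R * (Pp + de) + s * gam N t v theta (G_exponent v theta M).+1 M%:R
   + C1 * de * M%:R + s * tau N t (Num.truncn ((theta - 2 * de) * v * M%:R)).
have bE M : record_sum N t ((1 - de) * v) ((theta + 2 * de) * v) N1 s M *
      N (mkseq t (Num.truncn ((theta - 2 * de) * v * M%:R))) `^ s <= expR (E M).
  rewrite (powR_norm hN) -/(tau _ _ _) /E expRD ler_wpM2r ?expR_ge0//.
have key M : (M1 + M2 < M)%N -> E M <= B + Q - de * M%:R.
  move=> hM.
  have Mp : 0 < M%:R :> R by rewrite ltr0n; exact: leq_ltn_trans hM.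
  have hMt : theta <= v * M%:R.
    rewrite mulrC -ler_pdivrMr//; apply: le_trans (ltW hM2) _; rewrite ler_nat.
    by clear -hM; lia.
  have h1 := hM1 M ltac:(clear -hM; lia).
  rewrite /word_rate ler_pdivrMl// in h1.
  have /andP[_ h2] := G_word_gam hN t v theta M.
  have h3 := ler_wpM2r K0 (hC' M hMt).
  have y0 : 0 <= (theta - 2 * de) * v * M%:R.
    by rewrite !mulr_ge0 ?(ltW v0)//; clear -d4 th1; lra.
  have z0 : 0 <= theta * v * M%:R by rewrite !mulr_ge0 ?(ltW v0)//; clear -th1; lra.
  have dM0 : 0 <= de * M%:R by rewrite mulr_ge0// ltW.
  have dvM : de * M%:R * v <= de * M%:R by rewrite ler_piMr// ltW.
  have D'0 : 0 <= 2 * (de * M%:R) + 1 by clear -dM0; lra.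
  have hb : (Num.truncn (theta * v * M%:R))%:R -
      (Num.truncn ((theta - 2 * de) * v * M%:R))%:R <= 2 * (de * M%:R) + 1.
    have q1 : (Num.truncn (theta * v * M%:R))%:R <= theta * v * M%:R by rewrite truncn_le.
    have q2 := truncnS_gt ((theta - 2 * de) * v * M%:R); rewrite -natr1 in q2.
    clear -q1 q2 dvM; lra.
  have h4 := tau_le hS hN t D'0 hb.
  have h5 : gam N t v theta (G_exponent v theta M).+1 M%:R +
      tau N t (Num.truncn ((theta - 2 * de) * v * M%:R)) <=
      M%:R * Om + D * (de * M%:R) + (C' * ln K + ln K - ln m).
    rewrite DE; clear -h1 h2 h3 h4; lra.
  have h6 := ler_wpM2l (ltW s0) h5.
  have dD0 : 0 <= D * (de * M%:R) by rewrite mulr_ge0.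
  have /andP[_ ssm'] := ssm.
  have h7 := ler_wpM2r dD0 ssm'.
  have h8 := ler_wpM2r (ltW Mp) APp.
  have h9 : A * (de * M%:R) <= de * M%:R by rewrite ler_piMl.
  have h10 : s * (M%:R * Om) = sp * Om * M%:R - (C3 + 1) * (de * M%:R).
    by rewrite -cOm /s; ring.
  exact: (decay_arith _ h6 h7 h8 h9 h10).
have [B' B'0 hB'] := finite_upper_bound (fun M : 'I_(M1 + M2).+1 => E M + de * M%:R).
exists (`|B + Q| + B') => M; apply: le_trans (bE M) _; rewrite ler_expR.
have [hM|hM] := ltnP (M1 + M2) M.
  by apply: le_trans (key M hM) _; have := ler_norm (B + Q); clear -B'0; lra.
by have := hB' (Ordinal (hM : M < (M1 + M2).+1)%N); rewrite /=; have := normr_ge0 (B + Q); clear; lra.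
Qed.

Lemma diam_bounds (R : realType) (d : nat) (c : R) (A : set 'rV[R]_d) : A !=set0 ->
  (forall x y, A x -> A y -> enorm (x - y) <= c) -> 0 <= diam A <= c.
Proof.
move=> [x Ax] h; apply/andP; split.
  apply: (@le_trans _ _ (enorm (x - x))); first exact: enorm_ge0.
  apply: ub_le_sup; last by exists (x, x).
  by exists c => _ [[y z] [/= Ay Az] <-]; exact: h.
apply: ge_sup; first by exists (enorm (x - x)), (x, x).
by move=> _ [[y z] [/= Ay Az] <-]; exact: h.
Qed.

Lemma diam_pow_le (R : realType) (d : nat) (s c : R) (A : set 'rV[R]_d) : 0 <= s -> 0 <= c ->
  (forall x y, A x -> A y -> enorm (x - y) <= c) -> diam_pow s A <= c `^ s.
Proof.
move=> s0 c0 h; rewrite /diam_pow; case: ifPn => [_|/set0P A0]; first exact: powR_ge0.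
by have /andP[d0 dc] := diam_bounds A0 h; apply: ge0_ler_powR; rewrite ?nnegrE.
Qed.

Lemma sum_words_le (R : realType) (T : finType) (P : pred (seq T)) (g : seq T -> R) M
    (r : seq (seq T)) : uniq r -> (forall x, 0 <= g x) ->
  \sum_(x <- r | (size x == M) && P x) g x <= \sum_(x : M.-tuple T | P x) g x.
Proof.
move=> ur g0; rewrite -big_filter; set r' := seq.filter _ r.
have ur' : uniq r' by exact: filter_uniq.
pose ry := pmap (insub : seq T -> option (M.-tuple T)) r'.
have ery : r' = map val ry.
  rewrite /ry pmap_filter; last exact: insubK.
  apply/esym/all_filterP/allP => x; rewrite mem_filter => /andP[/andP[sx _] _].
  by rewrite isSome_insub.
have ury : uniq ry by apply: pmap_sub_uniq.
rewrite ery big_map big_uniq//= [leRHS]big_mkcond.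
rewrite [leLHS]big_mkcond; apply: ler_sum => y _.
case: ifP => yr; last by case: ifP.
have : val y \in r' by rewrite ery; apply: map_f.
by rewrite mem_filter => /andP[/andP[_ ->]].
Qed.

Lemma geometric_tail (R : realType) (q : R) M0 n : 0 < q -> q < 1 ->
  \sum_(k < n) (if (M0 <= k)%N then q ^+ k else 0) <= q ^+ M0 / (1 - q).
Proof.
move=> q0 q1; have q1' : 0 < 1 - q by rewrite subr_gt0.
suff : \sum_(k < n) (if (M0 <= k)%N then q ^+ k else 0) + q ^+ (maxn n M0) / (1 - q) <=
    q ^+ M0 / (1 - q).
  by apply: le_trans; rewrite lerDl divr_ge0 ?exprn_ge0 ?ltW.
elim: n => [|n ih]; first by rewrite big_ord0 max0n add0r.
rewrite big_ord_recr/=; case: leqP => Mn; last first.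
  by rewrite addr0; move: ih; rewrite (maxn_idPr (ltnW Mn)) (maxn_idPr Mn).
move: ih; rewrite (maxn_idPl Mn) (maxn_idPl (leqW Mn)); apply: le_trans.
rewrite -addrA lerD2l le_eqVlt; apply/orP; left; apply/eqP; rewrite exprS.
by field; rewrite gt_eqF.
Qed.

Lemma exists_expr_small (R : realType) (q e : R) : 0 < q -> q < 1 -> 0 < e ->
  exists M0 : nat, forall M, (M0 <= M)%N -> q ^+ M <= e.
Proof.
move=> q0 q1 e0; have lq : ln q < 0 by rewrite ln_lt0// q0.
have [M0 hM0] := exists_nat_gt (ln e / ln q).
exists M0 => M hM; rewrite -ler_ln ?posrE ?exprn_gt0// lnXn// -mulr_natl.
rewrite -ler_ndivrMr//; apply: le_trans (ltW hM0) _; by rewrite ler_nat.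
Qed.

Section UpperBound.
Variables (R : realType) (d S : nat) (hd : (1 <= d)%N).
Variables (D U : set 'rV[R]_d) (f : 'I_S -> 'rV[R]_d -> 'rV[R]_d).
Hypothesis hF : conformal_IFS D U f.
Variable N : seq 'I_S -> R.
Hypothesis hNd : forall w, N w = dnorm U (fword f w).
Variable Lam : set 'rV[R]_d.
Hypothesis hLam : is_attractor U f Lam.
Variables (K m l : R).
Hypothesis hN : word_norm N K m l.
Variables (t : nat -> 'I_S) (ht : G_set t) (v theta : R).
Hypotheses (v0 : 0 < v) (v1 : v < 1) (th1 : 1 < theta).

(** The class [N1] is covered by the images of the words made of a record word of length
    [M >= M0 N1] and the match of length [L M] that follows it; [large_records] finds such an [M]
    for each sequence. The bounds [(theta - de) v] and [(theta + de) v] on [v_s] leave room for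
    matches of rate [(theta - 2 de) v] and for [w = (theta + 2 de) v]. *)
Lemma coding_null (s de : R) : 0 < s -> 0 < de -> de < 1 / 4 ->
  (forall N1, exists B, forall M,
      record_sum N t ((1 - de) * v) ((theta + 2 * de) * v) N1 s M *
      N (mkseq t (Num.truncn ((theta - 2 * de) * v * M%:R))) `^ s <=
      expR (B - de * M%:R)) ->
  hausdorff_measure s (coding f Lam @` Upsilon t theta v de) = 0%E.
Proof.
move=> s0 d0 d4 /choice[B hB].
have v0' := v0; have v1' := v1; have th1' := th1.
set u := (1 - de) * v in hB; set w := (theta + 2 * de) * v in hB.
have [Bd Bd0 hBd] := attractor_diam hd hF hNd hLam.
pose L M := Num.truncn ((theta - 2 * de) * v * M%:R).
apply: (@hausdorff_null_countable _ _ (nat * (nat * seq 'I_S))%type) => delta e de0 e0.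
pose q := expR (- de).
have q0 : 0 < q := expR_gt0 _.
have q1 : q < 1 by rewrite expR_lt1 oppr_lt0.
have Bs0 : 0 < Bd `^ s by rewrite powR_gt0.
(* The tail over [M >= M0] gives the class [N1] its share [e / 2 ^ (N1 + 1)]; the second condition
   makes the diameters at most [delta]. *)
have exM0 N1 : exists M0, (Bd `^ s * expR (B N1)) * (q ^+ M0 / (1 - q)) <= e / 2 ^+ N1.+1 /\
    forall M, (M0 <= M)%N -> Bd * l ^+ M <= delta.
  have c0 : 0 < Bd `^ s * expR (B N1) / (1 - q).
    by rewrite divr_gt0 ?mulr_gt0 ?expR_gt0// subr_gt0.
  have e' : 0 < e / 2 ^+ N1.+1 / (Bd `^ s * expR (B N1) / (1 - q)).
    by apply: divr_gt0 => //; apply: divr_gt0 => //; exact: exprn_gt0.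
  have [Ma hMa] := exists_expr_small q0 q1 e'.
  have [Mb hMb] := exists_expr_small (wn_l0 hN) (wn_l1 hN) (divr_gt0 de0 Bd0).
  exists (Ma + Mb)%N; split.
    have := hMa (Ma + Mb)%N (leq_addr _ _); rewrite ler_pdivlMr//.
    by congr (_ <= _); ring.
  move=> M hM; rewrite mulrC -ler_pdivlMr//; apply: hMb.
  exact: leq_trans (leq_addl _ _) hM.
have [M0 hM0] := choice exM0.
pose good (i : nat * (nat * seq 'I_S)) := (M0 i.1 <= i.2.1)%N &&
  ((size i.2.2 == i.2.1) && record_word t u w i.1 i.2.2).
pose C i := if good i then fword f (i.2.2 ++ mkseq t (L i.2.1)) @` Lam else set0.
have N0 x : 0 <= N x by apply: ltW; exact: (norm_gt0 hN).
have CD i x y : C i x -> C i y -> enorm (x - y) <= Bd * N (i.2.2 ++ mkseq t (L i.2.1)).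
  by rewrite /C; case: ifP => // _; exact: hBd.
exists C; split.
- move=> _ [a [/= ha [hs1 hs2]] <-].
  have x0 : 0 < (theta - de) * v by rewrite mulr_gt0// subr_gt0; lra.
  have [N1 reg] : exists N1, regular a t u w N1.
    apply: (exists_regular ht _ _ x0 _ _ ha hs1 hs2).
    + by rewrite mulr_ge0 ?(ltW v0)// subr_ge0; lra.
    + by rewrite /u gtr_pMl//; lra.
    + by rewrite /w ltr_pM2r//; lra.
    + by rewrite mulr_ge0 ?(ltW v0)//; lra.
  have u'0 : 0 < (theta - 2 * de) * v by rewrite mulr_gt0// subr_gt0; lra.
  have u'x : (theta - 2 * de) * v < (theta - de) * v by rewrite ltr_pM2r//; lra.
  have Rs := R_s_gt (ltW u'0) u'x hs1.
  have w0 : 0 < w by rewrite mulr_gt0//; lra.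
  have [M [MM0 Mp rM hM]] := large_records w0 reg u'0 Rs (M0 N1).
  exists (N1, (M, mkseq a M)) => //.
  have gd : good (N1, (M, mkseq a M)).
    rewrite /good/= MM0 size_mkseq eqxx/=; apply/asboolP; exists a.
    by rewrite size_mkseq; split.
  rewrite /C gd/=.
  have -> : mkseq a M ++ mkseq t (L M) = mkseq a (M + L M).
    rewrite mkseq_addE; congr (_ ++ _).
    rewrite -[X in iota X (L M)]addn0 iotaDl -map_comp; apply/esym/eq_in_map => i.
    by rewrite mem_iota => /andP[_ iL]; exact: hM.
  exact: (coding_fword hF hLam).
- move=> i x y Cx Cy; have := CD i x y Cx Cy.
  have : good i by move: Cx; rewrite /C; case: ifP.
  move=> /andP[Mi /andP[/eqP si _]] /le_trans; apply.
  have [_ /(_ _ Mi)] := hM0 i.1; apply: le_trans.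
  rewrite ler_pM2l//; apply: le_trans (wn_sub hN _ _) _.
  rewrite -[leRHS]mulr1; apply: ler_pM => //.
    by rewrite -si (wn_up hN).
  apply: le_trans (wn_up hN _) _; rewrite exprn_ile1// ?(ltW (wn_l0 hN)) ?(ltW (wn_l1 hN))//.
have CP i : diam_pow s (C i) <= if good i then
    Bd `^ s * (N i.2.2 `^ s * N (mkseq t (L i.2.1)) `^ s) else 0.
  have [gi|gi] := boolP (good i); last by rewrite /C (negPf gi) /diam_pow eqxx.
  apply: (@le_trans _ _ ((Bd * N (i.2.2 ++ mkseq t (L i.2.1))) `^ s)).
    apply: diam_pow_le; rewrite ?mulr_ge0 ?(ltW s0) ?(ltW Bd0)//; exact: CD.
  rewrite powRM ?(ltW Bd0)// ler_wpM2l ?(ltW Bs0)//.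
  exact: (powR_norm_cat0 hN _ _ (ltW s0)).
apply: (@sum_uniq_prod _ _ _ (fun N1 => e / 2 ^+ N1.+1)).
- by move=> i; exact: diam_pow_ge0.
- move=> N1; apply: (@sum_uniq_prod _ _ (fun j => diam_pow s (C (N1, j)))
    (fun M => if (M0 N1 <= M)%N then Bd `^ s * expR (B N1) * q ^+ M else 0)).
  + by move=> j; exact: diam_pow_ge0.
  + move=> M r ur.
    have [MM|MM] := leqP (M0 N1) M; last first.
      rewrite big1// => x _; apply/eqP; rewrite eq_le diam_pow_ge0 andbT.
      by apply: le_trans (CP _) _; rewrite /good/= leqNgt MM.
    apply: (@le_trans _ _ (\sum_(x <- r | (size x == M) && record_word t u w N1 x)
       Bd `^ s * (N x `^ s * N (mkseq t (L M)) `^ s))).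
      rewrite [leRHS]big_mkcond; apply: ler_sum => x _; apply: le_trans (CP _) _.
      by rewrite /good/= MM.
    rewrite -mulr_sumr -mulr_suml -mulrA ler_wpM2l ?(ltW Bs0)//.
    have -> : expR (B N1) * q ^+ M = expR (B N1 - de * M%:R).
      by rewrite /q -expRM_natr -expRD mulNr.
    apply: le_trans (hB N1 M); rewrite ler_wpM2r ?powR_ge0//.
    by apply: (@sum_words_le _ _ (record_word t u w N1) (fun x => N x `^ s)) => // x; exact: powR_ge0.
  + move=> n; have [h _] := hM0 N1; apply: le_trans h.
    have cB : 0 <= Bd `^ s * expR (B N1) by rewrite mulr_ge0 ?expR_ge0 ?(ltW Bs0).
    apply: le_trans (ler_wpM2l cB (geometric_tail (M0 N1) n q0 q1)).
    by rewrite mulr_sumr; apply: ler_sum => k _; case: ifP; rewrite ?mulr0.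
- move=> n; rewrite -mulr_sumr -[leRHS]mulr1 ler_wpM2l ?(ltW e0)//.
  by rewrite sum_half_powers gerBl invr_ge0 exprn_ge0.
Qed.
End UpperBound.

(** * Mass distribution *)

Section ProductMass.
Variables (R : realType) (Q : finType) (g : nat -> Q -> R).
Hypotheses (g0 : forall k c, 0 <= g k c) (g1 : forall k, \sum_c g k c = 1).

Fixpoint mass_from k (u : seq Q) : R :=
  if u is c :: u' then g k c * mass_from k.+1 u' else 1.

Definition mass := mass_from 0.

Lemma mass_from_cat k u u' : mass_from k (u ++ u') = mass_from k u * mass_from (k + size u) u'.
Proof.
elim: u k => [|c u ih] k /=; first by rewrite mul1r addn0.
by rewrite ih addSnnS mulrA.
Qed.

Lemma mass_rcons u c : mass (rcons u c) = mass u * g (size u) c.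
Proof. by rewrite -cats1 /mass mass_from_cat /= mulr1. Qed.

Lemma mass_ge0 u : 0 <= mass u.
Proof.
rewrite /mass; elim: u 0%N => [|c u ih] k //=.
by rewrite mulr_ge0.
Qed.

Lemma mass_sum u : \sum_c mass (rcons u c) = mass u.
Proof.
by rewrite (eq_bigr (fun c => mass u * g (size u) c)) => [|c _];
  rewrite ?mass_rcons// -mulr_sumr g1 mulr1.
Qed.

(* A point of the tree avoiding a family of words of total mass < 1: descend into
   a child whose mass exceeds the total mass of the forbidden words below it. *)
Lemma mass_avoid (X : nat -> seq (seq Q)) (b : R) : b < 1 ->
  (forall n, \sum_(i < n) \sum_(x <- X i) mass x <= b) ->
  exists w : nat -> Q, forall n, 0 < mass (mkseq w n) /\
    forall i, mkseq w n \notin X i.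
Proof.
move=> b1 hb.
pose T n u := \sum_(i < n) \sum_(x <- X i | prefix u x) mass x.
have T0 n u : 0 <= T n u.
  by apply: sumr_ge0 => i _; apply: sumr_ge0 => x _; exact: mass_ge0.
(* A bound [b'] uniform in [n] and strictly below the mass takes the place of the infinite sum. *)
pose inv u := exists2 b', b' < mass u & forall n, T n u <= b'.
have Tmono n n' u : (n <= n')%N -> T n u <= T n' u.
  move=> nn; rewrite /T -!(big_mkord xpredT (fun i => \sum_(x <- X i | prefix u x) mass x)).
  rewrite [leRHS](big_cat_nat (n := n))//= lerDl; apply: sumr_ge0 => i _.
  by apply: sumr_ge0 => x _; exact: mass_ge0.
have inv0 : inv [::].
  exists b => [|n]; first by rewrite /mass.
  apply: le_trans (hb n); apply: ler_sum => i _.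
  by rewrite (eq_bigl xpredT)// => x; rewrite prefix0s.
have Tsum n u : \sum_c T n (rcons u c) <= T n u.
  rewrite /T exchange_big; apply: ler_sum => i _ /=.
  rewrite (exchange_big_dep (prefix u)) => [|c x _]/=; last first.
    by move=> h; apply: prefix_trans h; exact: prefix_rcons.
  apply: ler_sum => x ux.
  (* A forbidden word below [u] lies below at most one child of [u], and below none if it is [u]
     itself. *)
  have [ex|nex] := pselect (exists c, prefix (rcons u c) x); last first.
    by rewrite big1 ?mass_ge0// => c h; case: nex; exists c.
  case: ex => c hc; rewrite (bigD1 c)//= big1 ?addr0// => c' /andP[hc' cc'].
  case/eqP: cc'.
  move: hc hc' => /prefixP[y ->] /prefixP[y' ].
  rewrite !cat_rcons => /eqP; rewrite eqseq_cat// eqxx/= => /eqP[->//].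
have inv_step u : inv u -> exists c, inv (rcons u c).
  move=> [b' b'u hb']; apply: contrapT => nex.
  (* If no child works, the forbidden mass below each child comes within [e] of the mass of the
     child. Summed over the children, the deficit is at most [#|Q| * e], less than [mass u - b']. *)
  pose e := (mass u - b') / (#|Q|%:R + 1).
  have q0 : 0 < #|Q|%:R + 1 :> R by rewrite ltr_wpDl.
  have e0 : 0 < e by rewrite divr_gt0// subr_gt0.
  have hn c : exists n, mass (rcons u c) - e < T n (rcons u c).
    apply: contrapT => h; apply: nex; exists c; exists (mass (rcons u c) - e).
      by rewrite ltrBlDr ltrDl.
    by move=> n; rewrite leNgt; apply/negP => lt; apply: h; exists n.
  have [nc hnc] := choice hn.
  pose n := (\max_c nc c)%N.
  have : \sum_c (mass (rcons u c) - e) <= \sum_c T n (rcons u c).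
    apply: ler_sum => c _; apply: le_trans (ltW (hnc c)) _; apply: Tmono.
    exact: leq_bigmax.
  rewrite sumrB mass_sum sumr_const -mulr_natl => /le_trans/(_ (Tsum n u)).
  move=> /le_trans/(_ (hb' n)); apply/negP; rewrite -ltNge.
  have : #|Q|%:R * e < mass u - b'.
    have -> : mass u - b' = (#|Q|%:R + 1) * e by rewrite /e mulrC divfK// gt_eqF.
    by rewrite ltr_pM2r// ltrDl.
  move: (#|Q|%:R * e) => z; lra.
have [c0 _] : exists c : Q, True.
  by have [c _] := inv_step _ inv0; exists c.
have hex u : exists c, inv u -> inv (rcons u c).
  have [iu|niu] := pselect (inv u); last by exists c0.
  by have [c hc] := inv_step _ iu; exists c.
have [h hh] := choice hex.
pose V := fix V n := if n is n'.+1 then rcons (V n') (h (V n')) else [::].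
pose w n := h (V n).
have wV n : mkseq w n = V n.
  by elim: n => [//|n ih]; rewrite mkseqS ih.
have invV n : inv (V n) by elim: n => [//|n ih]; exact: hh.
exists w => n; rewrite wV; have [b' b'V hb'] := invV n; split.
  by apply: le_lt_trans b'V; have := hb' 0%N; rewrite /T big_ord0.
move=> i; apply/negP => Vi; have := hb' i.+1; apply/negP; rewrite -ltNge.
apply: lt_le_trans b'V _; rewrite /T big_ord_recr/=; apply: ler_wpDl.
  by apply: sumr_ge0 => j _; apply: sumr_ge0 => x _; exact: mass_ge0.
rewrite (big_rem _ Vi)/= prefix_refl lerDl.
by apply: sumr_ge0 => x _; exact: mass_ge0.
Qed.
End ProductMass.

(** A duplicate-free list of maximal length is exhaustive. This turns the bound on cut words into a
    list of all of them. *)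
Lemma uniq_bounded_enum (T : eqType) (P : T -> Prop) (B : nat) :
  (forall s : seq T, uniq s -> (forall x, x \in s -> P x) -> (size s <= B)%N) ->
  exists s : seq T, [/\ uniq s, (forall x, x \in s -> P x) & forall x, P x -> x \in s].
Proof.
move=> hB.
pose b n := `[< exists s : seq T, [/\ uniq s, (forall x, x \in s -> P x) & size s = n] >].
have b0 : b 0%N by apply/asboolP; exists [::].
have ub n : b n -> (n <= B)%N by move=> /asboolP[s [us sP <-]]; exact: hB.
have [n /asboolP[s [us sP sn]] nmax] := ex_maxnP (ex_intro b 0%N b0) ub.
exists s; split=> // x Px; apply: contrapT => /negP xs.
suff : (n.+1 <= n)%N by rewrite ltnn.
apply: nmax; apply/asboolP; exists (x :: s); rewrite /= xs us sn; split=> // y.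
by rewrite inE => /orP[/eqP->|/sP].
Qed.

(** * Words composed of cells of [q] letters *)

Section Cells.
Variables (S q : nat) (q0 : (0 < q)%N).
Local Notation Q := (q.-tuple 'I_S).

Definition cell_word (u : seq Q) : seq 'I_S := flatten (map val u).

Definition unfold_cells (w : nat -> Q) (i : nat) : 'I_S :=
  tnth (w (i %/ q)%N) (Ordinal (ltn_pmod i q0)).

Lemma cell_word_cat u u' : cell_word (u ++ u') = cell_word u ++ cell_word u'.
Proof. by rewrite /cell_word map_cat flatten_cat. Qed.

Lemma cell_word_rcons u c : cell_word (rcons u c) = cell_word u ++ c.
Proof. by rewrite -cats1 cell_word_cat /cell_word /= cats0. Qed.

Lemma size_cell_word u : size (cell_word u) = (q * size u)%N.
Proof.
elim: u => [|c u ih]; first by rewrite muln0.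
by rewrite -cat1s cell_word_cat size_cat ih /cell_word /= cats0 size_tuple mulnS.
Qed.

Lemma mkseq_unfold w n : mkseq (unfold_cells w) (q * n) = cell_word (mkseq w n).
Proof.
elim: n => [|n ih]; first by rewrite muln0.
rewrite mkseqS cell_word_rcons -ih mulnSr mkseq_addE; congr (_ ++ _).
have i0 : 'I_S := tnth (w n) (Ordinal q0).
apply: (@eq_from_nth _ i0); rewrite size_map size_iota ?size_tuple// => j jq.
rewrite (nth_map 0%N) ?size_iota// nth_iota// /unfold_cells (tnth_nth i0)/=.
by rewrite mulnC divnMDl// (divn_small jq) addn0 modnMDl modn_small.
Qed.

Lemma prefix_cell_word u u' : prefix (cell_word u) (cell_word u') -> prefix u u'.
Proof.
elim: u u' => [|c u ih] [|c' u'] h; rewrite ?prefix0s//.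
  by have := size_prefix h; rewrite !size_cell_word/= muln0 leqn0 muln_eq0 gtn_eqF.
move: h; rewrite -cat1s -(cat1s c') !cell_word_cat => /prefixP[z].
rewrite -(catA (cell_word [:: c])) => /eqP; rewrite eqseq_cat ?size_cell_word// /cell_word /= !cats0.
move=> /andP[/eqP e1 /eqP e].
have -> : c = c' by apply: val_inj.
by rewrite eqxx/=; apply: ih; apply/prefixP; exists z.
Qed.
End Cells.

Section MassDistribution.
Variables (R : realType) (d S : nat) (hd : (1 <= d)%N).
Variables (D U : set 'rV[R]_d) (f : 'I_S -> 'rV[R]_d -> 'rV[R]_d).
Hypothesis hF : conformal_IFS D U f.
Variable N : seq 'I_S -> R.
Hypothesis hNd : forall w, N w = dnorm U (fword f w).
Variable Lam : set 'rV[R]_d.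
Hypothesis hLam : is_attractor U f Lam.
Variables (K m l : R).
Hypothesis hN : word_norm N K m l.
Hypothesis hO : open_set_condition U f.
Variables (q : nat) (q0 : (0 < q)%N).
Local Notation Q := (q.-tuple 'I_S).
Local Notation W := (@cell_word S q).

(** The words of cells stopped when their norm first drops to [r] or below, among those whose image
    meets [C]. *)
Definition cut_word (r : R) (C : set 'rV[R]_d) (u : seq Q) : Prop :=
  [/\ N (W u) <= r, (exists u' c, u = rcons u' c /\ r < N (W u')) &
      exists2 x, (fword f (W u) @` Lam) x & C x].

(** One cell lowers the norm at most by the factor [m ^ q / K], so the norm of a cut word is
    comparable to [r]. Proper prefixes of a cut word have norm above [r]; hence no cut word is a
    prefix of another one. *)
Lemma cut_word_count : exists Nmax : nat, forall r C s, 0 < r ->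
  (forall x y, C x -> C y -> enorm (x - y) <= r) ->
  uniq s -> (forall u, u \in s -> cut_word r C u) -> (size s <= Nmax)%N.
Proof.
have Kp : 0 < K := wnK_gt0 hN; have mp : 0 < m := wn_m hN.
have k0 : 0 < m ^+ q / K by rewrite divr_gt0// exprn_gt0.
have [Nmax hc] := cut_count hd hF hNd hLam k0 hO.
exists Nmax => r C s r0 Cr us hs.
have Winj : injective W.
  move=> u u' e; apply/eqP.
  have p1 : prefix u u' by apply: (prefix_cell_word q0); rewrite e prefix_refl.
  have p2 : prefix u' u by apply: (prefix_cell_word q0); rewrite e prefix_refl.
  have /prefixP[z e1] := p1; have := size_prefix p2; rewrite e1 size_cat -{2}[size u]addn0.
  by rewrite leq_add2l leqn0 size_eq0 => /eqP->; rewrite cats0.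
rewrite -(size_map W); apply: (hc r C _ r0 Cr); first by rewrite map_inj_uniq.
  move=> _ /mapP[u /hs[Nr [u' [c [e Nu']]] ex] ->]; split=> //.
  rewrite mulrAC ler_pdivrMr// mulrC [leRHS]mulrC e cell_word_rcons.
  apply: le_trans (wn_super hN _ _).
  apply: ler_pM; rewrite ?exprn_ge0 ?(ltW r0) ?(ltW mp) ?(ltW Nu')//.
  by rewrite -[q in m ^+ q](size_tuple c) (wn_low hN).
move=> _ _ /mapP[u us' ->] /mapP[v vs ->] uv; apply/negP => /(prefix_cell_word q0) puv.
have [Nr _ _] := hs u us'; have [_ [v' [c [e Nv']]] _] := hs v vs.
have puv' : prefix u v'.
  move: puv uv; rewrite e => /prefixP[z]; case/lastP: z => [|z b].
    by rewrite cats0 => ->; rewrite eqxx.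
  by rewrite -rcons_cat => /rcons_inj[-> _] _; exact: prefix_prefix.
move/prefixP: puv' => [z ez]; move: Nv'; rewrite ez cell_word_cat; apply/negP.
rewrite -leNgt; apply: le_trans (wn_sub hN _ _) _; apply: le_trans Nr.
rewrite ger_pMr ?(norm_gt0 hN)//; apply: le_trans (wn_up hN _) _.
by rewrite exprn_ile1// ltW ?(wn_l0 hN) ?(wn_l1 hN).
Qed.

Lemma mass_distribution (g : nat -> Q -> R) (C s : R) (A : set 'rV[R]_d) :
  (forall k c, 0 <= g k c) -> (forall k, \sum_c g k c = 1) ->
  0 < s -> 0 < C -> (forall u, mass g u <= C * N (W u) `^ s) ->
  (forall w, (forall n, 0 < mass g (mkseq w n)) ->
     A (coding f Lam (unfold_cells q0 w))) ->
  hausdorff_measure s A <> 0%E.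
Proof.
move=> g0 g1 s0 C0 hm hA hnull.
have [Nmax hc] := cut_word_count.
(* The cover has total weight at most [2 e1] after enlargement, so that the forbidden words have
   mass at most [1 / 2]. *)
pose e := (1 / 4) / (C * Nmax.+1%:R).
have e'0 : 0 < C * Nmax.+1%:R by rewrite mulr_gt0.
have e0 : 0 < e by rewrite /e divr_gt0.
pose e1 := Num.min e (1 / 4).
have e10 : 0 < e1 by rewrite lt_min e0/=; lra.
have [E [cE dE] sE] := hausdorff_null_cover hnull ltr01 e10.
have p2 k : 0 < 2 ^+ k :> R by rewrite exprn_gt0.
(* The second summand makes the scale positive even if [E i] is empty or a point, and adds at most
   [e1] in all. *)
pose rs i := diam_pow s (E i) + e1 / 2 ^+ i.+1.
have rs0 i : 0 < rs i by rewrite ltr_wpDl ?diam_pow_ge0// divr_gt0.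
pose r i := rs i `^ s^-1.
have r0 i : 0 < r i by rewrite powR_gt0.
have rE i : r i `^ s = rs i by rewrite /r -powRrM mulVf ?gt_eqF// powRr1// ltW.
have sums n : \sum_(i < n) rs i <= e1 + e1.
  rewrite big_split/= lerD ?sE// -mulr_sumr -[leRHS]mulr1 ler_wpM2l ?(ltW e10)//.
  by rewrite sum_half_powers gerBl invr_ge0 exprn_ge0.
(* The empty word has norm 1. With [r i < 1] every stopped word is nonempty, as [cut_word]
   requires. *)
have r1 i : r i < 1.
  have : rs i < 1.
    apply: (@le_lt_trans _ _ (e1 + e1)); last first.
      have : e1 <= 1 / 4 by rewrite /e1 ge_min lexx orbT.
      move: e1 {e10 sE rs rs0 r r0 rE sums} => z; lra.
    apply: le_trans (sums i.+1); rewrite big_ord_recr/= lerDr.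
    by apply: sumr_ge0 => k _; exact: ltW.
  move=> h; rewrite /r.
  have si : 0 < s^-1 by rewrite invr_gt0.
  have := @gt0_ltr_powR R s^-1 si (rs i) 1; rewrite !nnegrE powR1 ler01 (ltW (rs0 i)).
  by apply.
have Er i x y : E i x -> E i y -> enorm (x - y) <= r i.
  move=> Ex Ey; have nE : (E i == set0) = false by apply/negbTE/set0P; exists x.
  have xy : enorm (x - y) <= diam (E i).
    apply: ub_le_sup; last by exists (x, y).
    by exists 1 => _ [[a b] [/= Ea Eb] <-]; exact: (dE i).
  apply: le_trans xy _.
  have dd : 0 <= diam (E i) by apply: le_trans (enorm_ge0 (x - y)) _; apply: ub_le_sup;
    [by exists 1 => _ [[a b] [/= Ea Eb] <-]; exact: (dE i)|by exists (x, y)].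
  have -> : diam (E i) = (diam (E i) `^ s) `^ s^-1.
    by rewrite -powRrM mulfV ?gt_eqF// powRr1.
  apply: ge0_ler_powR; rewrite ?nnegrE ?powR_ge0 ?invr_ge0 ?(ltW s0) ?(ltW (rs0 i))//.
  by rewrite /rs /diam_pow nE lerDl divr_ge0 ?(ltW e10) ?(ltW (p2 _)).
have exX i : exists X : seq (seq Q), [/\ uniq X,
    (forall u, u \in X -> cut_word (r i) (E i) u) & forall u, cut_word (r i) (E i) u -> u \in X].
  apply: (@uniq_bounded_enum _ _ Nmax) => X uX hX.
  exact: (hc (r i) (E i) X (r0 i) (Er i)).
have [X hX] := choice exX.
have Xsum n : \sum_(i < n) \sum_(x <- X i) mass g x <= 1 / 2.
  apply: (@le_trans _ _ (\sum_(i < n) (C * Nmax.+1%:R) * rs i)).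
    apply: ler_sum => i _; have [uX XP _] := hX i.
    apply: (@le_trans _ _ (\sum_(x <- X i) C * rs i)).
      rewrite big_seq [leRHS]big_seq; apply: ler_sum => x xX.
      apply: le_trans (hm x) _; rewrite ler_wpM2l ?(ltW C0)// -rE.
      have [Nr _ _] := XP x xX.
      by apply: ge0_ler_powR; rewrite ?nnegrE ?(ltW s0) ?(ltW (r0 i)) ?(ltW (norm_gt0 hN _)).
    rewrite big_const_seq count_predT iter_addr addr0 -[_ *+ size _]mulr_natr mulrAC.
    rewrite ler_wpM2r ?(ltW (rs0 i))// ler_wpM2l ?(ltW C0)// ler_nat.
    by apply: leqW; exact: (hc (r i) (E i) (X i) (r0 i) (Er i) uX XP).
  rewrite -mulr_sumr; apply: le_trans (ler_wpM2l (ltW e'0) (sums n)) _.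
  have h : C * Nmax.+1%:R * e1 <= 1 / 4.
    rewrite mulrC -ler_pdivlMr// -/e /e1 ge_min lexx//.
  rewrite mulrDr; move: (C * _ * e1) h => z; lra.
have [w hw] := mass_avoid g0 g1 (ltac:(lra) : 1 / 2 < 1 :> R) Xsum.
have [i _ Ei] := cE _ (hA w (fun n => (hw n).1)).
have exn : exists n, N (W (mkseq w n)) <= r i.
  have [M0 hM0] := exists_expr_small (wn_l0 hN) (wn_l1 hN) (r0 i).
  exists M0; apply: le_trans (wn_up hN _) _; apply: hM0.
  by rewrite size_cell_word size_mkseq leq_pmull.
have [n hn nmin] := ex_minnP exn.
have [_ _ hXi] := hX i; have /negP := (hw n).2 i; apply; apply: hXi; split=> //.
  case: n hn nmin => [|n] hn nmin.
    by exfalso; move: hn; rewrite /cell_word /= (wn_nil hN) leNgt r1.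
  exists (mkseq w n), (w n); split; first by rewrite mkseqS.
  by rewrite ltNge; apply/negP => /nmin; rewrite ltnn.
exists (coding f Lam (unfold_cells q0 w)) => //.
by rewrite -(mkseq_unfold q0); exact: (coding_fword hF hLam).
Qed.
End MassDistribution.

(** * Lower bound *)

Section CellWeights.
Variables (R : realType) (S : nat) (hS : (2 <= S)%N).
Variables (N : seq 'I_S -> R) (K m l : R).
Hypothesis hN : word_norm N K m l.
Variables (t : nat -> 'I_S) (v theta : R).
Variables (q : nat) (q0 : (0 < q)%N) (k0 : nat) (s : R).
Local Notation Q := (q.-tuple 'I_S).
Local Notation W := (@cell_word S q).
Hypotheses (th1 : 1 < theta) (s0 : 0 <= s).

(* The k-th forced block occupies the cells [start k, start k + len k), each cell
   consisting of q letters, and copies an initial segment of t. *)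
Definition start (k : nat) : nat := Num.truncn (theta ^+ k).
Definition len (k : nat) : nat := (Num.truncn (theta * v * (start k)%:R)).+1.

Definition forced (k a : nat) : bool := (k0 <= k)%N && (start k <= a < start k + len k)%N.

Definition tcell (j : nat) : Q := [tuple t (q * j + i)%N | i < q].

(** A point mass on forced cells and normalised weights [||f_c'|| ^ s] on free ones. Once the blocks
    are disjoint, [get] returns the only block that contains [a]. *)
Definition cell_weight (a : nat) (c : Q) : R :=
  if `[< exists k, forced k a >]
  then (c == tcell (a - start (get [set k | forced k a])))%:R
  else N c `^ s / partition_sum N q s.

Hypothesis hk0 : forall k, (k0 <= k)%N -> (start k + len k <= start k.+1)%N.

Lemma start_le k k' : (k <= k')%N -> (start k <= start k')%N.
Proof. by move=> kk; apply: le_truncn; rewrite ler_weXn2l// ltW. Qed.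

Lemma forced_uniq k k' a : forced k a -> forced k' a -> k = k'.
Proof.
wlog kk : k k' / (k <= k')%N.
  by move=> h f f'; have [kk|kk] := leqP k k'; [exact: h|apply/esym/h => //; exact: ltnW].
move=> /andP[hk /andP[a1 a2]] /andP[hk' /andP[a1' a2']].
move: kk; rewrite leq_eqVlt => /orP[/eqP//|kk].
have := start_le kk; have := hk0 hk => h1 h2; exfalso; clear -a2 a1' h1 h2; lia.
Qed.

Lemma cell_weight_forced k a c : forced k a ->
  cell_weight a c = (c == tcell (a - start k))%:R.
Proof.
move=> fk; rewrite /cell_weight asboolT; last by exists k.
suff -> : get [set k | forced k a] = k by [].
by apply: (@forced_uniq _ _ a) => //; apply: (@getPex _ [set k | forced k a]); exists k.
Qed.

Lemma cell_weight_free a c : (forall k, ~~ forced k a) ->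
  cell_weight a c = N c `^ s / partition_sum N q s.
Proof.
by move=> h; rewrite /cell_weight asboolF// => -[k fk]; have := h k; rewrite fk.
Qed.

Lemma free_gap k a : (k0 <= k)%N -> (start k + len k <= a < start k.+1)%N ->
  forall k', ~~ forced k' a.
Proof.
move=> hk /andP[a1 a2] k'; apply/negP => /andP[hk' /andP[b1 b2]].
have [kk|kk|kk] := ltngtP k' k.
- have := hk0 hk'; have := start_le kk => h1 h2; clear -a1 b2 h1 h2; lia.
- have := start_le kk => h1; clear -a2 b1 h1; lia.
- move: b2; rewrite kk; clear -a1; lia.
Qed.

Lemma free_start a : (a < start k0)%N -> forall k', ~~ forced k' a.
Proof.
move=> ha k'; apply/negP => /andP[hk' /andP[b1 b2]].
have := start_le hk' => h; clear -ha b1 h; lia.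
Qed.

Lemma cell_weight_ge0 a c : 0 <= cell_weight a c.
Proof.
rewrite /cell_weight; case: ifP => // _.
by rewrite divr_ge0 ?powR_ge0// ltW// (partition_sum_gt0 hS hN).
Qed.

Lemma cell_weight_sum a : \sum_c cell_weight a c = 1.
Proof.
have [[k fk]|nf] := pselect (exists k, forced k a).
  rewrite (eq_bigr (fun c => (c == tcell (a - start k))%:R)) => [|c _]; last first.
    exact: cell_weight_forced.
  by rewrite (bigD1 (tcell (a - start k)))//= eqxx big1 ?addr0// => c /negPf->.
rewrite (eq_bigr (fun c : Q => N c `^ s / partition_sum N q s)) => [|c _]; last first.
  by apply: cell_weight_free => k; apply/negP => fk; apply: nf; exists k.
by rewrite -mulr_suml divff// gt_eqF// (partition_sum_gt0 hS hN).
Qed.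

Local Notation mu := (mass cell_weight).

(* A bound on the excess is the mass distribution condition mu u <= C * N (W u) `^ s. *)
Definition excess (u : seq Q) : R := ln (mu u) - s * ln (N (W u)).
(** A lower bound for the decrease of the excess over one free cell, with the distortion of one
    concatenation deducted. *)
Definition gain : R := ln (partition_sum N q s) - s * ln K.

Lemma mass_take_gt0 u n : 0 < mu u -> 0 < mu (take n u).
Proof.
rewrite -{1}(cat_take_drop n u) /mass mass_from_cat => h.
rewrite lt_neqAle (mass_ge0 cell_weight_ge0) andbT eq_sym.
by apply: contraTneq h => h; rewrite -/mass h mul0r ltxx.
Qed.

Lemma excess_free u n : 0 < mu u -> (n <= size u)%N ->
  (forall a k, (n <= a < size u)%N -> ~~ forced k a) ->
  excess u <= excess (take n u) - gain * ((size u)%:R - n%:R).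
Proof.
elim/last_ind: u => [|u c ih] mu0.
  by rewrite leqn0 => /eqP-> _; rewrite subrr mulr0 subr0.
rewrite size_rcons leq_eqVlt => /orP[/eqP->|nu] hf.
  by rewrite -(size_rcons u c) take_size subrr mulr0 subr0.
rewrite ltnS in nu.
have muu : 0 < mu u.
  by have := mass_take_gt0 (size u) mu0; rewrite -cats1 take_size_cat.
have fr k : ~~ forced k (size u) by apply: hf; rewrite nu/=.
have hf' a k : (n <= a < size u)%N -> ~~ forced k a.
  by move=> /andP[na au]; apply: hf; rewrite na ltnW.
have := ih muu nu hf'.
have -> : take n (rcons u c) = take n u by rewrite -cats1 takel_cat.
suff : excess (rcons u c) <= excess u - gain by rewrite -natr1; lra.
rewrite /excess cell_word_rcons mass_rcons cell_weight_free//.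
have Nc : 0 < N c `^ s by rewrite powR_gt0 ?(norm_gt0 hN).
have Z0 := partition_sum_gt0 hS hN q s.
rewrite lnM ?posrE ?divr_gt0// ln_div ?posrE// ln_powR.
have := ler_wpM2l s0 (ln_norm_super hN (W u) c); rewrite /gain; lra.
Qed.

Lemma block_word u k : 0 < mu u -> (k0 <= k)%N ->
  (start k <= size u)%N -> (size u <= start k + len k)%N ->
  mu u = mu (take (start k) u) /\
  u = take (start k) u ++ [seq tcell j | j <- iota 0 (size u - start k)].
Proof.
move=> + hk; elim/last_ind: u => [|u c ih] mu0.
  by rewrite leqn0 => /eqP-> _; rewrite take0.
rewrite size_rcons leq_eqVlt => /orP[/eqP->|ku] uk.
  by rewrite -(size_rcons u c) take_size subnn cats0.
rewrite ltnS in ku.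
have muu : 0 < mu u.
  by have := mass_take_gt0 (size u) mu0; rewrite -cats1 take_size_cat.
have [e1 e2] := ih muu ku (ltnW uk).
have fk : forced k (size u) by rewrite /forced hk ku.
move: mu0; rewrite mass_rcons (cell_weight_forced _ fk).
have [->|] := eqVneq c (tcell (size u - start k)); last by rewrite mulr0 ltxx.
move=> _; rewrite mulr1.
have -> : take (start k) (rcons u (tcell (size u - start k))) = take (start k) u.
  by rewrite -cats1 takel_cat.
split=> //; rewrite subSn// -addn1 iotaD map_cat catA -e2 add0n /=.
by rewrite cats1.
Qed.

Lemma cell_word_tcell n : W [seq tcell j | j <- iota 0 n] = mkseq t (q * n).
Proof.
have -> : [seq tcell j | j <- iota 0 n] = mkseq tcell n by [].
rewrite -(mkseq_unfold q0); apply: eq_map => i.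
rewrite /unfold_cells /tcell tnth_mktuple/=; congr t.
by rewrite mulnC -divn_eq.
Qed.

(** Inside a forced block the mass is constant while the norm shrinks. The charge of the whole block
    also covers the words that end inside it. *)
Lemma excess_block u k : 0 < mu u -> (k0 <= k)%N ->
  (start k <= size u)%N -> (size u <= start k + len k)%N ->
  excess u <= excess (take (start k) u) + s * (ln K - tau N t (q * len k)).
Proof.
move=> mu0 hk uk1 uk2; have [e1 e2] := block_word mu0 hk uk1 uk2.
rewrite /excess -e1; rewrite [in X in _ - s * ln (N (W X)) <= _]e2.
rewrite cell_word_cat cell_word_tcell.
have h1 := ln_norm_super hN (W (take (start k) u)) (mkseq t (q * (size u - start k))).
have h2 : tau N t (q * len k) <= tau N t (q * (size u - start k)).
  have -> : (q * len k = q * (size u - start k) + q * (len k - (size u - start k)))%N.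
    by rewrite -mulnDr subnKC// leq_subLR.
  exact: (tau_anti hN).
rewrite -/(tau N t _) in h1.
have h3 : ln (N (W (take (start k) u))) + tau N t (q * len k) <=
  ln K + ln (N (W (take (start k) u) ++ mkseq t (q * (size u - start k)))) by lra.
have := ler_wpM2l s0 h3; lra.
Qed.

(** The blocks [k0] to [k0 + n] are charged in full, and the gain is that of the free cells between
    [start k0] and [start (k0 + n)]. The gain before [start k0] is given away. *)
Definition excess_bound (n : nat) : R :=
  s * (\sum_(j < n.+1) (ln K - tau N t (q * len (k0 + j)))) -
  gain * ((start (k0 + n))%:R - (start k0)%:R - \sum_(j < n) (len (k0 + j))%:R).

Hypothesis gain0 : 0 <= gain.

(** The block that begins where [u] ends is charged in advance, so that one bound serves the words
    that end in this block or in the gap after it. *)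
Lemma excess_start n u : 0 < mu u -> size u = start (k0 + n) ->
  excess u + s * (ln K - tau N t (q * len (k0 + n))) <= excess_bound n.
Proof.
elim: n u => [|n ih] u mu0 su.
  rewrite /excess_bound addn0 in su *.
  rewrite big_ord_recl big_ord0 addr0 addn0 subrr big_ord0 subrr mulr0 subr0.
  rewrite gerDr; have := excess_free mu0 (leq0n _).
  rewrite take0 subr0 => /(_ ltac:(by move=> a k /andP[_]; rewrite su => h; exact: (free_start h k))).
  have -> : excess [::] = 0.
    by rewrite /excess /cell_word /mass /= (wn_nil hN) ln1 mulr0 subr0.
  by have := mulr_ge0 gain0 (ler0n R (size u)); lra.
have kn : (k0 <= k0 + n)%N by exact: leq_addr.
have sl := hk0 kn; rewrite -addnS in sl.
pose w := take (start (k0 + n) + len (k0 + n)) u.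
have szw : size w = (start (k0 + n) + len (k0 + n))%N by rewrite size_takel// su.
have muw : 0 < mu w by exact: mass_take_gt0.
pose x := take (start (k0 + n)) w.
have szx : size x = start (k0 + n) by rewrite size_takel// szw leq_addr.
have mux : 0 < mu x by exact: mass_take_gt0.
have h1 := ih x mux szx.
have h2 : excess w <= excess x + s * (ln K - tau N t (q * len (k0 + n))).
  by apply: excess_block => //; rewrite szw ?leq_addr.
have h3 : excess u <= excess w - gain * ((size u)%:R - (start (k0 + n) + len (k0 + n))%:R).
  apply: excess_free => //; first by rewrite su.
  by move=> a k ha; apply: (free_gap kn); rewrite -addnS -su.
rewrite su natrD in h3.
move: h1; rewrite /excess_bound => h1.
rewrite [in leRHS]big_ord_recr [X in _ - gain * (_ - X)]big_ord_recr/=.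
lra.
Qed.

Lemma excess_le (C : R) u : 0 <= C -> (forall n, excess_bound n <= C) ->
  0 < mu u -> excess u <= C.
Proof.
move=> C0 hC mu0.
have e0 : excess [::] = 0.
  by rewrite /excess /cell_word /mass /= (wn_nil hN) ln1 mulr0 subr0.
have [su|su] := leqP (size u) (start k0).
  have := excess_free mu0 (leq0n _).
  rewrite take0 subr0 e0 => /(_ _)/le_trans; apply; last first.
    by apply: le_trans C0; rewrite sub0r oppr_le0 mulr_ge0.
  by move=> a k /andP[_ ha]; apply: (free_start (leq_trans ha su)).
have sS k : (k0 <= k)%N -> (start k < start k.+1)%N.
  by move=> hk; apply: leq_trans (hk0 hk); rewrite /len addnS ltnS leq_addr.
have [n [n1 n2]] : exists n, (start (k0 + n) <= size u)%N /\ (size u < start (k0 + n).+1)%N.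
  have exb : exists n, (start (k0 + n) <= size u)%N by exists 0%N; rewrite addn0 ltnW.
  have ub n : (start (k0 + n) <= size u)%N -> (n <= size u)%N.
    apply: leq_trans; elim: n => // n ih; apply: leq_ltn_trans ih _.
    by rewrite addnS; apply: sS; exact: leq_addr.
  have [n n1 nmax] := ex_maxnP exb ub; exists n; split=> //.
  by rewrite ltnNge -addnS; apply/negP => /nmax; rewrite ltnn.
have kn : (k0 <= k0 + n)%N by exact: leq_addr.
apply: le_trans (hC n).
have st := excess_start (mass_take_gt0 (start (k0 + n)) mu0) (size_takel n1).
apply: le_trans st.
have [ub|ub] := leqP (size u) (start (k0 + n) + len (k0 + n)); first exact: excess_block.
pose w := take (start (k0 + n) + len (k0 + n)) u.
have szw : size w = (start (k0 + n) + len (k0 + n))%N by rewrite size_takel// ltnW.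
have muw : 0 < mu w by exact: mass_take_gt0.
have h3 : excess u <= excess w - gain * ((size u)%:R - (start (k0 + n) + len (k0 + n))%:R).
  apply: excess_free => //; first exact: ltnW.
  by move=> a k /andP[a1 a2]; apply: (free_gap kn); rewrite a1 (ltn_trans a2).
have h2 := excess_block muw kn.
rewrite szw leq_addr leqnn in h2; have {}h2 := h2 isT isT.
have tt : take (start (k0 + n)) w = take (start (k0 + n)) u.
  by rewrite /w take_takel// leq_addr.
rewrite tt in h2.
have : 0 <= gain * ((size u)%:R - (start (k0 + n) + len (k0 + n))%:R).
  by rewrite mulr_ge0// subr_ge0 ler_nat ltnW.
lra.
Qed.

Lemma mass_le (C : R) : 0 <= C -> (forall n, excess_bound n <= C) ->
  forall u, mu u <= expR C * N (W u) `^ s.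
Proof.
move=> C0 hC u; have := mass_ge0 cell_weight_ge0 u; rewrite le_eqVlt => /orP[/eqP<-|mu0].
  by rewrite mulr_ge0 ?expR_ge0 ?powR_ge0.
have := excess_le C0 hC mu0; rewrite /excess (powR_norm hN) -expRD => h.
by rewrite -[leLHS]lnK ?posrE// ler_expR; lra.
Qed.

Lemma forced_agrees (w : nat -> Q) : (forall n, 0 < mu (mkseq w n)) ->
  forall k, (k0 <= k)%N -> agrees (unfold_cells q0 w) t (q * start k) (q * len k).
Proof.
move=> hw k hk i il.
have h := block_word (hw (start k + len k)%N) hk.
rewrite size_mkseq leq_addr leqnn in h; have [_ e] := h isT isT.
have qi : (i %/ q < len k)%N by rewrite ltn_divLR// mulnC.
have wk : w (start k + i %/ q)%N = tcell (i %/ q).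
  have := congr1 (fun z => nth (tcell 0) z (start k + i %/ q)%N) e.
  rewrite nth_mkseq ?ltn_add2l// nth_cat size_takel ?size_mkseq ?leq_addr//.
  rewrite ltnNge leq_addr/= addKn addKn (nth_map 0%N) ?size_iota// nth_iota//.
have dq : ((q * start k + i) %/ q = start k + i %/ q)%N by rewrite mulnC divnMDl.
have -> : unfold_cells q0 w (q * start k + i)%N = unfold_cells q0 tcell i.
  rewrite /unfold_cells !(tnth_nth (t 0%N))/= dq wk.
  by rewrite mulnC modnMDl.
by rewrite /unfold_cells /tcell tnth_mktuple/= mulnC -divn_eq.
Qed.
End CellWeights.

(** * Asymptotics of the forced blocks *)

Lemma nat_le_geometric (R : realType) (theta e : R) : 1 < theta -> 0 < e ->
  exists2 C : R, 0 <= C & forall n : nat, n%:R <= e * theta ^+ n + C.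
Proof.
move=> th1 e0; have th0 : 0 < theta by apply: lt_trans th1.
have lt0 : 0 < ln theta by rewrite ln_gt0.
have [C C0 hC] := @ln_le_linear R (e * ln theta) (mulr_gt0 e0 lt0).
exists (C / ln theta) => [|n]; first by rewrite divr_ge0// ltW.
have tn : 0 < theta ^+ n by rewrite exprn_gt0.
have := hC _ tn; rewrite lnXn// -[ln theta *+ n]mulr_natl -ler_pdivlMr// => /le_trans; apply.
by rewrite le_eqVlt; apply/orP; left; apply/eqP; field; rewrite gt_eqF.
Qed.

Lemma start_bounds (R : realType) (theta : R) k : 1 < theta ->
  theta ^+ k - 1 <= (start theta k)%:R <= theta ^+ k.
Proof.
move=> th1; have tk : 0 <= theta ^+ k by rewrite exprn_ge0// (le_trans ler01)// ltW.
rewrite /start truncn_le tk andbT.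
by have := truncnS_gt (theta ^+ k); rewrite -natr1; lra.
Qed.

Lemma len_bounds (R : realType) (theta v : R) k : 1 < theta -> 0 < v ->
  theta * v * (start theta k)%:R <= (len v theta k)%:R <= theta * v * (start theta k)%:R + 1.
Proof.
move=> th1 v0; have th0 : 0 < theta by apply: lt_trans th1.
have p : 0 <= theta * v * (start theta k)%:R by rewrite !mulr_ge0 ?(ltW th0) ?(ltW v0).
rewrite /len; apply/andP; split; first exact: ltW (truncnS_gt _).
by rewrite -natr1 lerD2r truncn_le.
Qed.

(** The gap after block [k] is about [theta ^ k * (theta - 1) * free_rate], which outgrows the
    rounding errors. *)
Lemma eventually_disjoint (R : realType) (theta v : R) : 0 < v -> 1 < theta ->
  0 < free_rate v theta ->
  exists k0, forall k, (k0 <= k)%N -> (start theta k + len v theta k <= start theta k.+1)%N.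
Proof.
move=> v0 th1 A0; have t1 : 0 < theta - 1 by rewrite subr_gt0.
have th0 : 0 < theta by apply: lt_trans th1.
have B0 : 0 < theta - 1 - theta * v.
  have -> : theta - 1 - theta * v = free_rate v theta * (theta - 1).
    by rewrite /free_rate; field; rewrite gt_eqF.
  by rewrite mulr_gt0.
have [|C _ hC] := @nat_le_geometric R theta 1 th1; first exact: ltr01.
have [k0 hk0] := exists_nat_gt ((theta - 1 - theta * v)^-1 + C).
exists k0 => k hk.
have tk : (theta - 1 - theta * v)^-1 <= theta ^+ k.
  have := hC k; rewrite mul1r; have : k0%:R <= k%:R :> R by rewrite ler_nat.
  move: (theta ^+ k) (_^-1) hk0 => x y; lra.
rewrite [X in (_ <= X)%N]/start truncn_ge_nat; last by rewrite exprn_ge0// ltW.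
have /andP[_ h1] := start_bounds k th1; have /andP[_ h2] := len_bounds k th1 v0.
rewrite natrD; apply: le_trans (lerD h1 h2) _.
have tv : 0 < theta * v by rewrite mulr_gt0.
have h3 := ler_wpM2l (ltW tv) h1.
have h4 : 1 <= theta ^+ k * (theta - 1 - theta * v).
  by rewrite -ler_pdivrMr// div1r.
rewrite exprS; move: (theta ^+ k) h3 h4 => x; lra.
Qed.

(** Let [x = theta ^ (k0 + n)] and [M = q * start (k0 + n)]. The free cells gain about
    [A * gain * x]. The forced blocks, taken backwards, have up to rounding the lengths of the
    blocks of [G_word] at [M], and cost about [- s M (Omega^- - e1)]. The losses per block are of
    order [n], logarithmic in [x], and [e2 * x] absorbs them. *)
Lemma excess_bound_bounded (R : realType) (S : nat) (hS : (2 <= S)%N)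
    (N : seq 'I_S -> R) (K m l : R) (hN : word_norm N K m l) (t : nat -> 'I_S)
    (v theta : R) (q k0 : nat) (s e1 e2 : R) :
  (0 < q)%N -> 0 < v -> v < 1 -> 1 < theta -> 0 < s -> 0 <= gain N K q s ->
  0 < e1 -> 0 < e2 ->
  0 < free_rate v theta * gain N K q s + s * q%:R * (limn_inf (word_rate N t v theta) - e1) - e2 ->
  exists2 C, 0 <= C & forall n, excess_bound N K t v theta q k0 s n <= C.
Proof.
move=> q0 v0 v1 th1 s0 g0 e10 e20 hpos.
have th0 : 0 < theta by apply: lt_trans th1.
have K0 := lnK_ge0 hN; have m0 := ln_m_lt0 hS hN.
have t1 : 0 < theta - 1 by rewrite subr_gt0.
have Om0 := rate_inf_lt0 hS hN t v0 th1.
have [M1 hM1] := limn_inf_eventually (word_rate_bounded hS hN t v0 th1) e10.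
move: Om0 hM1 hpos; move: (limn_inf _) => Om Om0 hM1 hpos.
(* A forced block exceeds its counterpart in [G_word] by at most [2 q + 1] letters. *)
pose c1 := ln K + (2 * q%:R + 1) * - ln m.
have q1 : 1 <= q%:R :> R by rewrite ler1n.
have D0 : 0 <= 2 * q%:R + 1 :> R by clear -q1; lra.
have c10 : 0 <= c1 by rewrite /c1 addr_ge0// mulr_ge0// oppr_ge0 ltW.
set lam := gain N K q s in g0 hpos *.
pose c2 := s * ln K + s * c1 + lam.
have c20 : 0 <= c2 := addr_ge0 (addr_ge0 (mulr_ge0 (ltW s0) K0) (mulr_ge0 (ltW s0) c10)) g0.
have [Ca Ca0 hCa] := @nat_le_geometric R theta (e2 / (c2 + 1)) th1
  (divr_gt0 e20 (ltr_wpDl c20 ltr01)).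
have key n : (M1 < q * start theta (k0 + n))%N -> theta <= v * (q * start theta (k0 + n))%:R ->
  excess_bound N K t v theta q k0 s n <=
  c2 * (Ca + 1) + lam * (start theta k0)%:R + lam.
  move=> hM hMt; set k := (k0 + n)%N in hM hMt *; set M := (q * start theta k)%N in hM hMt *.
  pose x := theta ^+ k; have x0 : 0 < x by rewrite exprn_gt0.
  have /andP[st1 st2] := start_bounds k th1.
  have ME : M%:R = q%:R * (start theta k)%:R :> R by rewrite natrM.
  have hlen j : (len v theta j)%:R <= v * theta * theta ^+ j + 1.
    have /andP[_ h] := len_bounds j th1 v0; have /andP[_ h'] := start_bounds j th1.
    apply: le_trans h _; rewrite lerD2r [v * _]mulrC ler_wpM2l// mulr_ge0 ?(ltW v0)//.
    exact: ltW.
  have sumlen : \sum_(j < n) (len v theta (k0 + j))%:R <= v * (theta / (theta - 1)) * x + n%:R.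
    apply: (@le_trans _ _ (\sum_(j < n) (v * theta * theta ^+ (k0 + j) + 1))).
      by apply: ler_sum => j _.
    rewrite big_split/= sumr_const card_ord lerD2r -mulr_sumr.
    have -> : v * (theta / (theta - 1)) * x = v * theta * (x / (theta - 1)) by ring.
    rewrite ler_wpM2l ?mulr_ge0 ?(ltW v0) ?(ltW th0)// /x /k.
    elim: (n) => [|i ih]; first by rewrite big_ord0 divr_ge0 ?exprn_ge0 ?ltW.
    rewrite big_ord_recr/=; apply: le_trans (lerD ih (lexx _)) _.
    rewrite addnS exprS le_eqVlt; apply/orP; left; apply/eqP; field.
    by rewrite gt_eqF.
  have freecells : free_rate v theta * x - 1 - n%:R - (start theta k0)%:R <=
     (start theta k)%:R - (start theta k0)%:R - \sum_(j < n) (len v theta (k0 + j))%:R.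
    have -> : free_rate v theta * x = x - v * (theta / (theta - 1)) * x by rewrite /free_rate; ring.
    rewrite -/x in st1; move: (v * _ * x) sumlen => y; move: (\sum_(j < n) _) => z; clear -st1; lra.
  have blocks : gam N t v theta n M%:R + tau N t (Num.truncn (theta * v * M%:R)) <=
      \sum_(j < n.+1) tau N t (q * len v theta (k0 + j)) + c1 * n.+1%:R.
    rewrite big_ord_recr/= -natr1 mulrDr mulr1 addrACA; apply: lerD.
      rewrite /gam (reindex_inj rev_ord_inj)/=.
      have -> : c1 * n%:R = \sum_(j < n) c1 by rewrite sumr_const card_ord mulr_natr.
      rewrite -big_split/=; apply: ler_sum => j _.
      apply: (tau_le hS hN t D0).
      have tj : 0 < theta ^+ (n - j.+1) by rewrite exprn_gt0.
      have hT := truncnS_gt (v * M%:R / theta ^+ (n - j.+1)); rewrite -natr1 in hT.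
      have hL := hlen (k0 + j)%N.
      have hy : v * q%:R * (theta * theta ^+ (k0 + j)) - v * q%:R <= v * M%:R / theta ^+ (n - j.+1).
        rewrite ler_pdivlMr// mulrBl.
        have -> : v * q%:R * (theta * theta ^+ (k0 + j)) * theta ^+ (n - j.+1) = v * q%:R * x.
          rewrite -mulrA -exprS -exprD /x /k; congr (_ * _ ^+ _).
          by have := ltn_ord j; clear; lia.
        have vq0 : 0 <= v * q%:R by rewrite mulr_ge0// ltW.
        have t1' : 1 <= theta ^+ (n - j.+1) by rewrite exprn_ege1// ltW.
        have := ler_wpM2l vq0 t1'; have := ler_wpM2l vq0 st1; rewrite -/x ME.
        move: (theta ^+ (n - j.+1)) => z; clear; lra.
      have vq1 : v * q%:R <= q%:R by rewrite ler_piMl// ltW.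
      have := ler_wpM2l (ler0n R q) hL; move: hy hT vq1; rewrite [(q * len _ _ _)%:R]natrM.
      move: (theta ^+ (k0 + j)) (v * M%:R / _) (Num.truncn _)%:R (len _ _ _)%:R => z y T L.
      clear; lra.
    apply: (tau_le hS hN t D0).
    have hT := truncnS_gt (theta * v * M%:R); rewrite -natr1 in hT.
    have /andP[_ hL] := len_bounds k th1 v0.
    have := ler_wpM2l (ler0n R q) hL; rewrite -natrM.
    rewrite -/k ME in hT *; move: (Num.truncn _)%:R hT => T; clear -q1; lra.
  (* With fewer than [G_exponent + 1] terms, [gam] omits nonpositive ones; with more, it adds empty
     blocks. *)
  have gp : gam N t v theta (G_exponent v theta M).+1 M%:R <= gam N t v theta n M%:R.
    have [_ _ pmax] := G_exponentP v0 th1 hMt.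
    have nonpos a b : (a <= b)%N -> gam N t v theta b M%:R <= gam N t v theta a M%:R.
      move=> ab; rewrite /gam -!(big_mkord xpredT (fun k => tau N t (Num.truncn (v * M%:R / theta ^+ k)))).
      rewrite [leLHS](big_cat_nat (n := a))//= gerDl; apply: sumr_le0 => *; exact: (tau_le0 hN).
    have [np|pn] := leqP n (G_exponent v theta M).+1; first exact: nonpos.
    rewrite /gam -!(big_mkord xpredT (fun k => tau N t (Num.truncn (v * M%:R / theta ^+ k)))).
    rewrite [leRHS](big_cat_nat (n := (G_exponent v theta M).+1)) ?(ltnW pn)//= lerDl.
    rewrite big_nat big1// => i /andP[pi _]; rewrite (_ : Num.truncn _ = 0%N) ?(tau0 hN)//.
    apply/truncn0Pn/negP => h1; have := pmax i (leq_ltn_trans (leq0n _) pi) h1.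
    by rewrite leqNgt pi.
  have /andP[hG _] := G_word_gam hN t v theta M.
  have Mp : 0 < M%:R :> R by rewrite ltr0n; exact: leq_ltn_trans hM.
  have := hM1 M (ltnW hM); rewrite /word_rate ler_pdivlMl// => hr.
  have Mx : M%:R <= q%:R * x by rewrite ME ler_wpM2l.
  have Oe : Om - e1 < 0 by clear -Om0 e10; lra.
  have hr' : q%:R * x * (Om - e1) <= M%:R * (Om - e1) by rewrite ler_wnM2r// ltW.
  have tausum : q%:R * x * (Om - e1) - c1 * n.+1%:R <=
      \sum_(j < n.+1) tau N t (q * len v theta (k0 + j)).
    move: hG gp blocks hr hr'; clear; lra.
  rewrite /excess_bound -/lam -/k sumrB sumr_const card_ord -[ln K *+ _]mulr_natl.
  have h1 := ler_wpM2l (ltW s0) tausum.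
  have h2 := ler_wpM2l g0 freecells.
  have hn : c2 * n%:R <= e2 * x + c2 * Ca.
    have hnk : n%:R <= e2 / (c2 + 1) * x + Ca.
      by apply: le_trans (hCa k); rewrite ler_nat leq_addl.
    apply: le_trans (ler_wpM2l c20 hnk) _; rewrite mulrDr lerD2r mulrA ler_wpM2r ?(ltW x0)//.
    rewrite mulrCA ler_piMr ?(ltW e20)// ler_pdivrMr ?mul1r ?lerDl//; exact: ltr_wpDl.
  have hx := mulr_ge0 (ltW hpos) (ltW x0).
  move: h1 h2 hn hx; rewrite /c2 -natr1.
  move: (\sum_(j < n.+1) _) (\sum_(j < n) _) (free_rate v theta) => X Y A.
  have := g0.
  move: (start theta k)%:R (start theta k0)%:R (Om - e1) (ln K) n%:R => Z Z0 W L n0; clear; lra.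
have [n1 hn1] : exists n1, forall n, (n1 <= n)%N -> (M1 < q * start theta (k0 + n))%N /\
    theta <= v * (q * start theta (k0 + n))%:R.
  have [|C _ hC] := @nat_le_geometric R theta 1 th1; first exact: ltr01.
  have [n1 hn1] := exists_nat_gt (M1%:R + theta / v + C + 1).
  exists n1 => n hn.
  have st : M1%:R + theta / v < (start theta (k0 + n))%:R.
    have /andP[h _] := start_bounds (k0 + n) th1; apply: lt_le_trans h.
    have := hC (k0 + n)%N; rewrite mul1r.
    have : n1%:R <= (k0 + n)%:R :> R by rewrite ler_nat (leq_trans hn)// leq_addl.
    move: (theta ^+ _) (theta / v) hn1 => y z; clear; lra.
  have tv0 : 0 <= theta / v by rewrite divr_ge0// ltW.
  have stq : (start theta (k0 + n))%:R <= (q * start theta (k0 + n))%:R :> R.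
    by rewrite ler_nat leq_pmull.
  split.
    rewrite -(ltr_nat R); apply: lt_le_trans stq; apply: le_lt_trans st.
    by rewrite lerDl.
  rewrite mulrC -ler_pdivrMr//; apply: le_trans stq; apply: ltW; apply: le_lt_trans st.
  by rewrite lerDr.
have [B B0 hB] := finite_upper_bound (fun n : 'I_n1 => excess_bound N K t v theta q k0 s n).
have C00 : 0 <= c2 * (Ca + 1) + lam * (start theta k0)%:R + lam.
  exact: addr_ge0 (addr_ge0 (mulr_ge0 c20 (addr_ge0 Ca0 ler01)) (mulr_ge0 g0 (ler0n _ _))) g0.
exists (B + (c2 * (Ca + 1) + lam * (start theta k0)%:R + lam)) => [|n].
  exact: addr_ge0.
have [hn|hn] := ltnP n n1.
  by apply: le_trans (hB (Ordinal hn)) _; rewrite lerDl.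
have [a b] := hn1 n hn; apply: le_trans (key n a b) _; by rewrite lerDr.
Qed.

Lemma start_ge (R : realType) (theta : R) : 1 < theta ->
  forall x : R, exists k1, forall k, (k1 <= k)%N -> x <= (start theta k)%:R.
Proof.
move=> th1 x.
have [|C _ hC] := @nat_le_geometric R theta 1 th1; first exact: ltr01.
have [k1 hk1] := exists_nat_gt (x + C + 1); exists k1 => k hk.
have /andP[h _] := start_bounds k th1; have := hC k; rewrite mul1r.
have : k1%:R <= k%:R :> R by rewrite ler_nat.
move: (theta ^+ k) (start theta k)%:R h => y z; clear -hk1; lra.
Qed.

Lemma truncn_leq (R : realType) (x : R) (n : nat) : 0 <= x -> x <= n%:R -> (Num.truncn x <= n)%N.
Proof. by move=> x0 h; rewrite -(ler_nat R) (le_trans _ h)// truncn_le. Qed.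

(** The block at [n = q * start k] gives a match of length [theta v n], hence the bound on [v_s].
    For [v_e], each [n] from there to [q * start k.+1], about [theta] times as far, is served by the
    same block, whose length is at least about [v n]; passing to [u < v] absorbs the rounding. *)
Lemma forced_Delta (R : realType) (S : nat) (t e : nat -> 'I_S) (v theta : R) (q k0 : nat) :
  (0 < q)%N -> 0 < v -> 1 < theta ->
  (forall k, (k0 <= k)%N -> agrees e t (q * start theta k) (q * len v theta k)) ->
  Delta t theta v e.
Proof.
move=> q0 v0 th1 he; have th0 : 0 < theta by apply: lt_trans th1.
have qR : 0 < q%:R :> R by rewrite ltr0n.
have tv0 : 0 <= theta * v by rewrite mulr_ge0 ?ltW.
split=> /=; last first.
  apply: ereal_sup_ubound; exists (theta * v) => //; split=> //; apply/R_sP => B.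
  have [k1 hk1] := start_ge th1 (B%:R + 1).
  have h := hk1 (k0 + k1)%N (leq_addl _ _).
  have B1 : (B < start theta (k0 + k1))%N by rewrite -(ler_nat R) -natr1.
  exists (q * start theta (k0 + k1))%N; split.
  - by apply: leq_trans (ltnW B1) _; rewrite leq_pmull.
  - by rewrite muln_gt0 q0 (leq_ltn_trans (leq0n _) B1).
  apply: agrees_le (he _ (leq_addr _ _)); apply: truncn_leq; first by rewrite mulr_ge0.
  have /andP[hl _] := len_bounds (k0 + k1) th1 v0.
  by rewrite !natrM mulrCA ler_wpM2l// ltW.
apply/lee_subgt0Pr => a a0.
have uv : Num.max 0 (v - a) < v by rewrite gt_max v0 gtrBl.
apply: (@le_trans _ _ (Num.max 0 (v - a))%:E).
  by rewrite -EFinB lee_fin le_max lexx orbT.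
move: uv; set u := Num.max 0 (v - a) => uv.
have u0 : 0 <= u by rewrite le_max lexx.
clearbody u; apply: ereal_sup_ubound; exists u => //; split=> //.
have vu : 0 < v - u by rewrite subr_gt0.
have [k1 hk1] := start_ge th1 (u / (v - u) + 1).
pose k2 := (k0 + k1)%N.
exists (q * start theta k2).+1 => // n hn.
have exk : exists k, (q * start theta k <= n)%N by exists k2; apply: ltnW.
have [k3 hk3] := start_ge th1 (n%:R + 1).
have ubk k : (q * start theta k <= n)%N -> (k <= k3)%N.
  move=> h; rewrite leqNgt; apply/negP => /ltnW/hk3; rewrite natr1 ler_nat => h'.
  have := leq_trans (leq_pmull (start theta k) q0) h; by rewrite leqNgt h'.
have [k hk kmax] := ex_maxnP exk ubk.
have kk2 : (k2 <= k)%N by apply: kmax; exact: ltnW.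
have hn' : (n < q * start theta k.+1)%N.
  by rewrite ltnNge; apply/negP => /kmax; rewrite ltnn.
have sk := hk1 k (leq_trans (leq_addl _ _) kk2).
have uvu0 : 0 <= u / (v - u) by rewrite divr_ge0// ltW.
have sk1 : (0 < start theta k)%N.
  rewrite -(ltr_nat R); apply: lt_le_trans sk; rewrite ltr_wpDl//; exact: ltr01.
exists (q * start theta k)%N; split=> //; first by rewrite muln_gt0 q0.
apply/cylinder_agrees; apply: agrees_le (he _ (leq_trans (leq_addr _ _) kk2)).
apply: truncn_leq; first by rewrite mulr_ge0.
have /andP[hl _] := len_bounds k th1 v0.
have /andP[_ hs] := start_bounds k.+1 th1; have /andP[hs' _] := start_bounds k th1.
have hu : u <= (v - u) * (start theta k)%:R.
  by rewrite -ler_pdivrMl// mulrC (le_trans _ sk)// lerDl ler01.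
have nq : n%:R <= q%:R * (theta * ((start theta k)%:R + 1)).
  apply: (@le_trans _ _ (q * start theta k.+1)%:R); first by rewrite ler_nat ltnW.
  rewrite natrM ler_wpM2l// (le_trans hs)// exprS ler_wpM2l ?(ltW th0)//.
  by move: hs'; rewrite lerBlDr.
apply: le_trans (ler_wpM2l u0 nq) _; rewrite natrM.
have -> : u * (q%:R * (theta * ((start theta k)%:R + 1))) =
  q%:R * (theta * (u * ((start theta k)%:R + 1))) by ring.
rewrite ler_wpM2l ?(ltW qR)//; apply: le_trans hl; rewrite -mulrA ler_wpM2l ?(ltW th0)//.
by move: (start theta k)%:R hu => z; clear; lra.
Qed.

(** By [pres_low] the gain is at least [q P(s) - s ln K]. With [h = A P(s) + s Om] and [e1] taking
    half of [h], the expression is at least [q h / 2] minus a constant. *)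
Lemma exists_gain (R : realType) (S : nat) (hS : (2 <= S)%N)
    (N : seq 'I_S -> R) (K m l : R) (hN : word_norm N K m l) (A Om s : R) :
  0 < s -> 0 < A -> Om < 0 -> 0 < A * pres N s + s * Om ->
  exists q : nat, exists e1 e2 : R, [/\ (0 < q)%N, 0 < e1, 0 < e2, 0 <= gain N K q s &
    0 < A * gain N K q s + s * q%:R * (Om - e1) - e2].
Proof.
move=> s0 A0 Om0 h0; have K0 := lnK_ge0 hN.
have sO : s * Om < 0 by rewrite pmulr_rlt0.
have P0 : 0 < pres N s by rewrite -(pmulr_rgt0 _ A0); clear -h0 sO; lra.
pose h := A * pres N s + s * Om.
have [n1 hn1] := exists_nat_gt (s * ln K / pres N s).
have [n2 hn2] := exists_nat_gt ((A * s * ln K + 1) * 2 / h).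
(* Through [n1] the gain is nonnegative; through [n2], [q h / 2] exceeds [A s ln K + e2] with
   [e2 = 1]. *)
pose q := (n1 + n2).+1.
have q1 : n1%:R <= q%:R :> R by rewrite ler_nat /q -addnS leq_addr.
have q2 : n2%:R <= q%:R :> R by rewrite ler_nat /q -addSn leq_addl.
exists q, (h / (2 * s)), 1; split=> //; first by rewrite divr_gt0// mulr_gt0.
  rewrite /gain subr_ge0; apply: le_trans (pres_low hS hN q (ltW s0)).
  by rewrite -ler_pdivrMr// (le_trans (ltW hn1)).
have g : q%:R * pres N s - s * ln K <= gain N K q s.
  by rewrite /gain lerD2r; exact: (pres_low hS hN q (ltW s0)).
have g' := ler_wpM2l (ltW A0) g.
have e : s * q%:R * (Om - h / (2 * s)) = q%:R * (s * Om) - q%:R * (h / 2).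
  by field; rewrite gt_eqF.
have hq : A * s * ln K + 1 < q%:R * (h / 2).
  have := lt_le_trans hn2 q2; rewrite ltr_pdivrMr// mulrA.
  by move: (q%:R * h) (A * s * ln K) => x y; clear; lra.
rewrite e; move: g' hq; rewrite /h; move: (gain _ _ _ _) (pres _ _) => G P; clear; lra.
Qed.

(** In covers by sets of diameter at most 1, a larger exponent gives smaller weights. *)
Lemma hausdorff_null_ge (R : realType) (d : nat) (s s' : R) (A : set 'rV[R]_d) :
  0 <= s -> s <= s' -> hausdorff_measure s A = 0%E -> hausdorff_measure s' A = 0%E.
Proof.
move=> s0; rewrite le_eqVlt => /orP[/eqP<-//|ss' hA].
have s'0 : 0 < s' by exact: le_lt_trans ss'.
apply: hausdorff_null => delta e d0 e0.
have d1 : 0 < Num.min delta 1 by rewrite lt_min d0 ltr01.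
have [C [AC dC] hC] := hausdorff_null_cover hA d1 e0.
exists C.
  split=> // i x y Cx Cy; apply: le_trans (dC _ _ _ Cx Cy) _; by rewrite ge_min lexx.
move=> n; apply: le_trans (hC n); apply: ler_sum => i _.
rewrite /diam_pow; case: ifPn => // /set0P Cne.
have /andP[+ D1] : 0 <= diam (C i) <= 1.
  apply: diam_bounds => // x y Cx Cy; apply: le_trans (dC _ _ _ Cx Cy) _.
  by rewrite ge_min lexx orbT.
rewrite le_eqVlt => /orP[/eqP<-|D0]; first by rewrite powR0 ?powR_ge0// gt_eqF.
by apply: ger_powR; rewrite ?D0 ?D1// ltW.
Qed.

Lemma coding_Delta_pos (R : realType) (d S : nat) (hd : (1 <= d)%N) (hS : (2 <= S)%N)
    (D U : set 'rV[R]_d) (f : 'I_S -> 'rV[R]_d -> 'rV[R]_d)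
    (hF : conformal_IFS D U f) (hO : open_set_condition U f)
    (N : seq 'I_S -> R) (hNd : forall w, N w = dnorm U (fword f w))
    (Lam : set 'rV[R]_d) (hLam : is_attractor U f Lam)
    (K m l : R) (hN : word_norm N K m l) (t : nat -> 'I_S) (v theta s : R) :
  0 < v -> v < 1 -> 1 < theta -> 0 < s -> 0 < free_rate v theta ->
  0 < free_rate v theta * pres N s + s * limn_inf (word_rate N t v theta) ->
  hausdorff_measure s (coding f Lam @` Delta t theta v) <> 0%E.
Proof.
move=> v0 v1 th1 s0 A0 h.
have [q [e1 [e2 [q0 e10 e20 g0 hq]]]] :=
  exists_gain hS hN s0 A0 (rate_inf_lt0 hS hN t v0 th1) h.
have [k0 hk0] := eventually_disjoint v0 th1 A0.
have [C C0 hC] := excess_bound_bounded hS hN k0 q0 v0 v1 th1 s0 g0 e10 e20 hq.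
apply: (mass_distribution hd hF hNd hLam hN hO (q0 := q0)
  (g := @cell_weight _ _ N t v theta q k0 s) (C := expR C)) => //.
- move=> k c; exact: (cell_weight_ge0 hS hN).
- exact: (cell_weight_sum hS hN _ _ _ th1 hk0).
- exact: expR_gt0.
- exact: (mass_le hS hN q0 th1 (ltW s0) hk0 g0 C0 hC).
move=> w hw; exists (unfold_cells q0 w) => //.
apply: (forced_Delta (k0 := k0) q0 v0 th1) => k hk.
exact: (forced_agrees hS hN q0 th1 hk0 hw hk).
Qed.

(** * Dimensions *)

Lemma free_rateE (R : realType) (v theta : R) : 1 < theta ->
  free_rate v theta * (theta - 1) = theta - theta * v - 1.
Proof. by move=> th1; rewrite /free_rate; field; rewrite subr_eq0 gt_eqF. Qed.

Lemma free_rate_ge0 (R : realType) (v theta : R) : v < 1 -> 1 < theta ->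
  (0 <= free_rate v theta) = ((1 - v)^-1 <= theta) /\
  (0 < free_rate v theta) = ((1 - v)^-1 < theta).
Proof.
move=> v1 th1; have t1 : 0 < theta - 1 by rewrite subr_gt0.
have v1' : 0 < 1 - v by rewrite subr_gt0.
have e : theta - theta * v - 1 = theta * (1 - v) - 1 by ring.
rewrite -(pmulr_lge0 _ t1) -(pmulr_lgt0 _ t1) free_rateE// e subr_ge0 subr_gt0.
by rewrite -ler_pdivrMr// -ltr_pdivrMr// div1r.
Qed.

(** As [free_rate = (theta - theta v - 1) / (theta - 1)], both readings of the equation take the
    same form. *)
Lemma s_equationE (R : realType) (d S : nat) (U : set 'rV[R]_d)
    (f : 'I_S -> 'rV[R]_d -> 'rV[R]_d) (theta v Om s : R) : v < 1 -> 1 < theta ->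
  s_equation U f theta v Om s <-> free_rate v theta * pressure U f s = - s * Om.
Proof.
move=> v1 th1; have t1 : theta - 1 != 0 by rewrite subr_eq0 gt_eqF.
have e := free_rateE v th1; rewrite /s_equation -e; have [_ <-] := free_rate_ge0 v1 th1.
move: (pressure U f s) (free_rate v theta) => P A.
case: ifPn => [A0|_]; split=> h.
- by rewrite h; field; rewrite t1 gt_eqF.
- apply: (mulfI (_ : A != 0)); first by rewrite gt_eqF.
  by rewrite h; field; rewrite t1 gt_eqF.
- by apply: (mulIf t1); rewrite mulrAC h; ring.
- by rewrite mulrAC h; ring.
Qed.

Section Dimension.
Variables (R : realType) (d S : nat) (hd : (1 <= d)%N) (hS : (2 <= S)%N).
Variables (D U : set 'rV[R]_d) (f : 'I_S -> 'rV[R]_d -> 'rV[R]_d).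
Hypothesis hF : conformal_IFS D U f.
Variable Lam : set 'rV[R]_d.
Hypothesis hLam : is_attractor U f Lam.
Variables (v : R) (v0 : 0 < v) (v1 : v < 1).
Variables (t : nat -> 'I_S) (theta : R) (th1 : 1 < theta).
Hypothesis hth : (1 - v)^-1 <= theta.

Local Notation N := (fun w => dnorm U (fword f w)).

Let A0 : 0 <= free_rate v theta.
Proof. by have [->] := free_rate_ge0 v1 th1. Qed.

(** A root exists by [pres_root] with [B = - Om], so that [get] returns one. The form with
    [s = get _] fits both [s_plus] and [s_minus]. *)
Lemma s_equation_root Om s : Om < 0 ->
  s = get [set s | s_equation U f theta v Om s] ->
  0 <= s /\ free_rate v theta * pressure U f s = - s * Om.
Proof.
move=> Om0 ->; have [K [m [l [hN _]]]] := IFS_word_norm hd hF (fun=> erefl).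
have nOm : 0 < - Om by rewrite oppr_gt0.
have [[r hr] ge0] := pres_root hS hN A0 nOm.
have : s_equation U f theta v Om (get [set s | s_equation U f theta v Om s]).
  apply: (@getPex _ [set s | s_equation U f theta v Om s]); exists r.
  by apply/s_equationE => //; rewrite [RHS]mulNr -mulrN [RHS]mulrC.
move/s_equationE => /(_ v1 th1); move: (get _) => x hx; split=> //.
by apply: ge0; rewrite [LHS]hx mulNr -mulNr mulrC mulNr mulrN.
Qed.

Lemma hausdorff_dim_Upsilon : G_set t ->
  exists c delta0 : R, 0 < delta0 /\ forall delta, 0 < delta -> delta < delta0 ->
    (hausdorff_dim (coding f Lam @` Upsilon t theta v delta) <=
      Order.min (s_plus U f t v theta + c * delta)%:E (hausdorff_dim Lam))%E.
Proof.
move=> ht; have [K [m [l [hN _]]]] := IFS_word_norm hd hF (fun=> erefl).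
have [sp0 hsp] := s_equation_root (rate_sup_lt0 hS hN t v0 th1) (erefl (s_plus U f t v theta)).
have [c [de0 [d0 d4 hd0]]] := record_decay hS hN ht v0 v1 th1 A0 sp0 hsp.
exists c, de0; split=> // de de1 de2; have [s0 hs] := hd0 de de1 de2.
rewrite le_min; apply/andP; split; last first.
  by apply: hausdorff_dim_le => _ [e _ <-]; exact: (coding_attractor hF hLam).
apply: ereal_inf_lbound; exists (s_plus U f t v theta + c * de) => //; split; first exact: ltW.
by apply: (coding_null hd hF _ hLam hN ht v0 v1 th1 s0 de1 _ hs) => //; exact: lt_le_trans d4.
Qed.

Lemma hausdorff_dim_Delta : open_set_condition U f ->
  ((s_minus U f t v theta)%:E <= hausdorff_dim (coding f Lam @` Delta t theta v))%E.
Proof.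
move=> hO; have [K [m [l [hN _]]]] := IFS_word_norm hd hF (fun=> erefl).
have Om0 := rate_inf_lt0 hS hN t v0 th1.
have [sm0 hsm] := s_equation_root Om0 (erefl (s_minus U f t v theta)).
apply: le_ereal_inf_tmp => _ [s [s0 hs] <-]; rewrite lee_fin leNgt; apply/negP => ssm.
(* If the free rate vanishes, the equation forces [s_minus = 0]. *)
have [Az|/eqP Ap] := eqVneq (free_rate v theta) 0.
  move: hsm; rewrite Az mul0r => /esym/eqP; rewrite mulf_eq0 oppr_eq0 (lt_eqF Om0) orbF.
  by move=> /eqP e; move: ssm; rewrite e ltNge s0.
have A1 : 0 < free_rate v theta by rewrite lt_def A0 andbT; apply/eqP.
move: ssm hsm sm0; move: (s_minus U f t v theta) => sm ssm hsm sm0.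
(* Strictly between [s] and [s_minus], the exponent [r] is positive even for [s = 0], and the
   pressure inequality at [r] is strict. *)
pose r := (s + sm) / 2.
have sr : s < r by rewrite /r; lra.
have rsm : r < sm by rewrite /r; lra.
have r0 : 0 < r by exact: le_lt_trans sr.
have pos : 0 < free_rate v theta * pres N r + r * limn_inf (word_rate N t v theta).
  have /andP[_ h] := pres_lip hS hN (ltW rsm).
  have h1 : (sm - r) * ln l <= 0.
    by rewrite mulr_ge0_le0 ?subr_ge0 ?(ltW rsm)// ltW// (ln_l_lt0 hN).
  have h2 : pres N sm <= pres N r by apply: le_trans h _; rewrite gerDl.
  have := ler_wpM2l A0 h2; rewrite [X in X <= _]hsm => h4.
  apply: lt_le_trans (lerD h4 (lexx _)); rewrite mulNr addrC subr_gt0.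
  by rewrite ltr_nM2r.
exact: (coding_Delta_pos hd hS hF hO (fun=> erefl) hLam hN v0 v1 th1 r0 A1 pos
  (hausdorff_null_ge s0 (ltW sr) hs)).
Qed.
End Dimension.

Theorem theorem2 (R : realType) (d S : nat) (hd : (1 <= d)%N) (hS : (2 <= S)%N)
  (D U : set 'rV[R]_d) (f : 'I_S -> 'rV[R]_d -> 'rV[R]_d)
  (hF : conformal_IFS D U f) (hO : open_set_condition U f)
  (Lam : set 'rV[R]_d) (hLam : is_attractor U f Lam)
  (v : R) (hv0 : 0 < v) (hv1 : v < 1)
  (t : nat -> 'I_S) (ht : @G_set S t)
  (theta : R) (htheta : 1 < theta) :
  (theta < (1 - v)^-1 ->
     [set e : nat -> 'I_S | (v%:E <= v_e R e t)%E] `&`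
     [set e : nat -> 'I_S | v_s R e t = (theta * v)%:E] = set0) /\
  ((1 - v)^-1 <= theta ->
     (exists c delta0 : R, 0 < delta0 /\
        forall delta : R, 0 < delta -> delta < delta0 ->
          (hausdorff_dim (coding f Lam @` Upsilon t theta v delta) <=
           Order.min (s_plus U f t v theta + c * delta)%:E
                     (hausdorff_dim Lam))%E) /\
     (Order.min (s_minus U f t v theta)%:E (hausdorff_dim Lam) <=
      hausdorff_dim (coding f Lam @` Delta t theta v))%E).
Proof.
split=> [|hth]; first exact: no_small_rate.
split; first exact: (hausdorff_dim_Upsilon hd hS hF hLam).
by rewrite ge_min (hausdorff_dim_Delta hd hS hF hLam).
Qed.
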